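(* Let $n\ge1$ be an integer, $s\in(0,1)$ and let $\Omega$ be a bounded Lipschitz domain in $\mathbb{R}^n$. Then the eigenvalue problem $$(-\Delta)^{s+\mathrm{Log}}u=\lambda u\ \text{ in }\Omega,\qquad u=0\ \text{ in }\mathbb{R}^n\setminus\Omega$$ admits a nondecreasing sequence of real eigenvalues $$\lambda_1^{s+\mathrm{Log}}(\Omega)\le\lambda_2^{s+\mathrm{Log}}(\Omega)\le\cdots\le\lambda_k^{s+\mathrm{Log}}(\Omega)\le\cdots,$$ with corresponding eigenfunctions $\{\xi_k\}_{k\in\mathbb{N}}\subset\mathcal{H}^{s+\mathrm{Log}}_0(\Omega)$ such that: (i) For every $k\in\mathbb{N}$, $$\lambda_k^{s+\mathrm{Log}}(\Omega)=\min\bigl\{\mathcal{E}_{s+\mathrm{Log}}(u,u):u\in\mathcal{H}_k(\Omega),\ \|u\|_{L^2(\Omega)}=1\bigr\},$$ where $\mathcal{H}_1(\Omega):=\mathcal{H}^{s+\mathrm{Log}}_0(\Omega)$ and, for $k\ge2$, $\mathcal{H}_k(\Omega):=\{u\in\mathcal{H}^{s+\mathrm{Log}}_0(\Omega):\int_\Omega u\,\xi_i\,dx=0\text{ for }i=1,\dots,k-1\}$. (ii) $\lambda_k^{s+\mathrm{Log}}(\Omega)\to+\infty$ as $k\to\infty$. (iii) The family $\{\xi_k\}_{k\in\mathbb{N}}$ forms an orthonormal basis of $L^2(\Omega)$. (iv) Assume that $\operatorname{diam}(\Omega)<e^{-1/(2s)}$ and $b_{n,s}\ge0$. Then $\lambda_1^{s+\mathrm{Log}}(\Omega)>0$,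 and the first eigenfunction $\xi_1$ can be chosen nonnegative.
   Context: Functions are real-valued. Notation: $a_\pm:=\max\{0,\pm a\}$; $c_{n,s}=2^{2s}\pi^{-n/2}s\frac{\Gamma((n+2s)/2)}{\Gamma(1-s)}$; $b_{n,s}=\ln4+\frac1s+\psi(1-s)+\psi(\frac{n+2s}{2})$ with $\psi=\Gamma'/\Gamma$; $\mathbf{k}_{s+\mathrm{Log},\pm}(z):=c_{n,s}|z|^{-n-2s}(-\ln|z|)_\pm$ for $z\ne0$; $\operatorname{diam}(\Omega)=\sup\{|x-y|:x,y\in\Omega\}$. Forms: $\mathcal{E}_\pm(u,w):=\iint_{\mathbb{R}^n\times\mathbb{R}^n}(u(x)-u(y))(w(x)-w(y))\,\mathbf{k}_{s+\mathrm{Log},\pm}(x-y)\,dx\,dy$, $\mathcal{E}_s(u,w):=\iint_{\mathbb{R}^n\times\mathbb{R}^n}(u(x)-u(y))(w(x)-w(y))|x-y|^{-n-2s}\,dx\,dy$, $\mathcal{E}_{s+\mathrm{Log}}(u,w):=\mathcal{E}_+(u,w)-\mathcal{E}_-(u,w)+\frac{b_{n,s}c_{n,s}}{2}\mathcal{E}_s(u,w)$ (the quadratic form of the fractional-logarithmic Laplacian $(-\Delta)^{s+\mathrm{Log}}$). Space: $\mathcal{H}^{s+\mathrm{Log}}_0(\Omega):=\{u\in L^2(\mathbb{R}^n):\mathcal{E}_+(u,u)<\infty,\ u=0\text{ a.e. in }\Omega^c\}$ with norm $\sqrt{\mathcal{E}_+(u,u)}$. Eigenfunctions: $u\in\mathcal{H}^{s+\mathrm{Log}}_0(\Omega)$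 is an eigenfunction of the problem associated with the eigenvalue $\lambda$ if $\mathcal{E}_{s+\mathrm{Log}}(u,\varphi)=\lambda\int_\Omega u\varphi\,dx$ for all $\varphi\in\mathcal{H}^{s+\mathrm{Log}}_0(\Omega)$ (with $u\neq0$). *)

(* Defs.v *)
From HB Require Import structures.
From mathcomp Require Import all_boot all_order all_algebra.
From mathcomp Require Import all_classical all_reals all_analysis.

Set Implicit Arguments.
Unset Strict Implicit.
Unset Printing Implicit Defensive.

Import Order.TTheory GRing.Theory Num.Theory.
Import numFieldNormedType.Exports.

Local Open Scope classical_set_scope.
Local Open Scope ring_scope.

(* R^n is 'rV[R]_n with the library's (product) topology; its sigma-algebra is
   the one generated by the coordinates, that is, the Borel one. *)
Section measurable_rV.
Context (R : realType) (n : nat).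

Definition rV_coord (i : 'I_n) (x : 'rV[R]_n) : R := x ord0 i.

Let rV_set0 : g_sigma_preimage rV_coord set0.
Proof. exact: sigma_algebra0. Qed.

Let rV_setC A : g_sigma_preimage rV_coord A -> g_sigma_preimage rV_coord (~` A).
Proof. exact: sigma_algebraC. Qed.

Let rV_bigcup (F : (set 'rV[R]_n)^nat) :
  (forall i, g_sigma_preimage rV_coord (F i)) ->
  g_sigma_preimage rV_coord (\bigcup_i (F i)).
Proof. exact: sigma_algebra_bigcup. Qed.

HB.instance Definition _ := @isMeasurable.Build default_measure_display
  'rV[R]_n (g_sigma_preimage rV_coord) rV_set0 rV_setC rV_bigcup.

End measurable_rV.

Lemma measurable_rV_coord (R : realType) n (i : 'I_n) :
  measurable_fun [set: 'rV[R]_n] (@rV_coord R n i).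
Proof.
move=> _ Y mY; rewrite setTI; apply: sub_sigma_algebra => /=.
rewrite -bigcup_seq/=; exists i => /=; first by rewrite mem_index_enum.
by exists Y => //; rewrite setTI.
Qed.

Lemma measurable_fun_rVP (R : realType) n d (T : measurableType d)
    (f : T -> 'rV[R]_n) :
  (forall i, measurable_fun [set: T] (@rV_coord R n i \o f)) ->
  measurable_fun [set: T] f.
Proof.
move=> mf _ A mA; rewrite setTI.
suff : g_sigma_preimage (fun i => @rV_coord R n i \o f) `<=` measurable.
  apply; rewrite g_sigma_preimage_comp; exists A => //; by rewrite setTI.
apply: smallest_sub; first exact: sigma_algebra_measurable.
move=> B; rewrite -bigcup_seq/= => -[i _ [C mC <-]].
exact: mf.
Qed.

Section lebesgue_rV_step.
Context (R : realType) (n : nat).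

Definition rV_cons (p : R * 'rV[R]_n) : 'rV[R]_n.+1 :=
  row_mx (const_mx p.1 : 'rV_1) p.2.

Definition rV_uncons (x : 'rV[R]_n.+1) : R * 'rV[R]_n :=
  (x ord0 ord0, @rsubmx R 1 1 n x).

Lemma rV_consK : cancel rV_cons rV_uncons.
Proof.
move=> [r x]; rewrite /rV_uncons /rV_cons/= row_mxKr; congr pair.
have -> : (ord0 : 'I_n.+1) = @lshift 1 n ord0 by exact/val_inj.
by rewrite (@row_mxEl R 1 1 n) mxE.
Qed.

Lemma measurable_rV_cons : measurable_fun [set: R * 'rV[R]_n] rV_cons.
Proof.
apply: measurable_fun_rVP => i.
case: (@split_ordP 1 n i) => j ->.
  suff -> : @rV_coord R n.+1 (lshift n j) \o rV_cons = fst by exact: measurable_fst.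
  by apply/funext => p /=; rewrite /rV_coord /rV_cons (@row_mxEl R 1 1 n) mxE.
suff -> : @rV_coord R n.+1 (@rshift 1 n j) \o rV_cons = @rV_coord R n j \o snd.
  by apply: measurableT_comp; [exact: measurable_rV_coord|exact: measurable_snd].
by apply/funext => p /=; rewrite /rV_coord /rV_cons (@row_mxEr R 1 1 n).
Qed.

Lemma measurable_rV_uncons : measurable_fun [set: 'rV[R]_n.+1] rV_uncons.
Proof.
apply/measurable_fun_pairP; split; first exact: measurable_rV_coord.
apply: measurable_fun_rVP => i.
suff -> : @rV_coord R n i \o (snd \o rV_uncons) = @rV_coord R n.+1 (rshift 1 i).
  exact: measurable_rV_coord.
by apply/funext => x /=; rewrite /rV_coord mxE.
Qed.

Variable mu : {sigma_finite_measure set 'rV[R]_n -> \bar R}.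

Definition lebesgue_rV_step : set 'rV[R]_n.+1 -> \bar R :=
  pushforward (@lebesgue_measure R \x mu)%E rV_cons.

Let preim_measurable A : measurable A -> measurable (rV_cons @^-1` A).
Proof. by move=> mA; rewrite -[X in measurable X]setTI; exact: measurable_rV_cons. Qed.

Let step0 : lebesgue_rV_step set0 = 0%E.
Proof. by rewrite /lebesgue_rV_step /pushforward preimage_set0 measure0. Qed.

Let step_ge0 A : (0 <= lebesgue_rV_step A)%E.
Proof. by rewrite /lebesgue_rV_step /pushforward; exact: measure_ge0. Qed.

Let step_sigma_additive : semi_sigma_additive lebesgue_rV_step.
Proof.
move=> F mF tF mUF; rewrite /lebesgue_rV_step /pushforward preimage_bigcup.
apply: measure_semi_sigma_additive.
- by move=> k; exact: preim_measurable.
- apply/trivIsetP => /= i j _ _ ij; rewrite -preimage_setI.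
  by move/trivIsetP : tF => /(_ _ _ _ _ ij) ->//; rewrite preimage_set0.
- by rewrite -preimage_bigcup; exact: preim_measurable.
Qed.

HB.instance Definition _ := isMeasure.Build _ _ _ lebesgue_rV_step
  step0 step_ge0 step_sigma_additive.

Let step_sigma_finite : sigma_finite setT lebesgue_rV_step.
Proof.
have /sigma_finiteP[F [FT ndF Foo]] := sigma_finiteT (@lebesgue_measure R).
have /sigma_finiteP[G [GT ndG Goo]] := sigma_finiteT mu.
exists (fun k => rV_uncons @^-1` (F k `*` G k)).
  apply/esym; rewrite -subTset => x _; set p := rV_uncons x.
  have [i _ Fi] : (\bigcup_i F i) p.1 by rewrite -FT.
  have [j _ Gj] : (\bigcup_j G j) p.2 by rewrite -GT.
  exists (maxn i j) => //; split.
    by move: Fi; exact/subsetPset/ndF/leq_maxl.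
  by move: Gj; exact/subsetPset/ndG/leq_maxr.
move=> k; have [mF Fk] := Foo k; have [mG Gk] := Goo k.
have mFG : measurable (F k `*` G k) by exact: measurableX.
split; first by rewrite -[X in measurable X]setTI; exact: measurable_rV_uncons.
rewrite /lebesgue_rV_step /pushforward -comp_preimage.
have -> : rV_uncons \o rV_cons = id by apply/funext/rV_consK.
by rewrite preimage_id product_measure1E// lte_mul_pinfty// ge0_fin_numE.
Qed.

HB.instance Definition _ := Measure_isSigmaFinite.Build _ _ _ lebesgue_rV_step
  step_sigma_finite.

End lebesgue_rV_step.

(* Lebesgue measure on R^n: the point mass on R^0, then R^(n+1) = R x R^n. *)
Fixpoint lebesgue_rV (R : realType) (n : nat) :
    {sigma_finite_measure set 'rV[R]_n -> \bar R} :=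
  match n with
  | 0%N => \d_ (0 : 'rV[R]_0)
  | n'.+1 => lebesgue_rV_step (lebesgue_rV R n')
  end.

Lemma lebesgue_rVS (R : realType) n (A : set R) (B : set 'rV[R]_n) :
  measurable A -> measurable B ->
  lebesgue_rV R n.+1 [set x | A (rV_uncons x).1 /\ B (rV_uncons x).2] =
  (@lebesgue_measure R A * lebesgue_rV R n B)%E.
Proof.
move=> mA mB; rewrite /= /lebesgue_rV_step /pushforward.
have -> : @rV_cons R n @^-1`
    [set x | A (rV_uncons x).1 /\ B (rV_uncons x).2] = A `*` B.
  by apply/seteqP; split => p; rewrite /preimage /mkset rV_consK.
by rewrite product_measure1E.
Qed.

Section special_functions.
Context (R : realType).

Definition Gamma (x : R) : R :=
  \int[@lebesgue_measure R]_(t in `]0, +oo[) (t `^ (x - 1) * expR (- t)).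

Definition digamma (x : R) : R := derive1 Gamma x / Gamma x.

Definition c_ns (n : nat) (s : R) : R :=
  2 `^ (2 * s) * pi `^ (- (n%:R / 2)) * s
  * (Gamma ((n%:R + 2 * s) / 2) / Gamma (1 - s)).

Definition b_ns (n : nat) (s : R) : R :=
  ln 4 + s^-1 + digamma (1 - s) + digamma ((n%:R + 2 * s) / 2).

Definition pospart (a : R) : R := Num.max 0 a.
Definition negpart (a : R) : R := Num.max 0 (- a).

End special_functions.

(* The library's norm on 'rV[R]_n is the sup norm, hence this one. *)
Definition dotv (R : realType) n (x y : 'rV[R]_n) : R :=
  \sum_(i < n) x ord0 i * y ord0 i.
Definition enorm (R : realType) n (x : 'rV[R]_n) : R := Num.sqrt (dotv x x).

Section domains.
Context (R : realType) (n : nat).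
Implicit Type Omega : set 'rV[R]_n.

Definition diam Omega : R := sup [set enorm (x - y) | x in Omega & y in Omega].

(* Near each boundary point, Omega is the part of a ball lying strictly above
   the graph of a Lipschitz function g. The rotated coordinate frame is encoded
   by its last axis, the unit vector e: the point x has height dotv x e over its
   projection to the hyperplane orthogonal to e, on which g is considered. For
   n = 1 that hyperplane is {0}. *)
Definition lipschitz_boundary Omega : Prop :=
  forall x0, (closure Omega `\` interior Omega) x0 ->
  exists (r : R) (e : 'rV[R]_n) (g : 'rV[R]_n -> R) (L : R),
    [/\ 0 < r, enorm e = 1,
        forall y z, dotv y e = 0 -> dotv z e = 0 ->
          `|g y - g z| <= L * enorm (y - z)
      & forall x, enorm (x - x0) < r ->
          (Omega x <-> g (x - dotv x e *: e) < dotv x e)].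

Definition bounded_lipschitz_domain Omega : Prop :=
  [/\ open Omega, connected Omega, Omega !=set0,
      exists M : R, forall x, Omega x -> enorm x <= M
    & lipschitz_boundary Omega].

End domains.

Section fractional_logarithmic.
Context (R : realType) (n : nat) (s : R).
Local Notation mu := (lebesgue_rV R n).
Implicit Types (Omega : set 'rV[R]_n) (u w : 'rV[R]_n -> R).

Definition frac_kernel (z : 'rV[R]_n) : R := enorm z `^ (- n%:R - 2 * s).

(* At z = 0 these kernels take the value 0, which is irrelevant: the diagonal is
   negligible and the integrands below vanish on it. *)
Definition k_plus (z : 'rV[R]_n) : R :=
  c_ns n s * frac_kernel z * pospart (- ln (enorm z)).
Definition k_minus (z : 'rV[R]_n) : R :=
  c_ns n s * frac_kernel z * negpart (- ln (enorm z)).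

Local Open Scope ereal_scope.

Definition kernel_form (k : 'rV[R]_n -> R) u w : \bar R :=
  \int[mu \x mu]_p
    ((u p.1 - u p.2) * (w p.1 - w p.2) * k (p.1 - p.2))%R%:E.

Definition E_plus := kernel_form k_plus.
Definition E_minus := kernel_form k_minus.
Definition E_s := kernel_form frac_kernel.

Definition E_sLog u w : \bar R :=
  E_plus u w - E_minus u w + (b_ns n s * c_ns n s / 2)%R%:E * E_s u w.

(* As usual, elements of L^2 and of H0 are represented by functions. *)
Definition H0 Omega : set ('rV[R]_n -> R) :=
  [set u | [/\ u \in Lfun mu 2%:E, E_plus u u < +oo
             & {ae mu, forall x, ~ Omega x -> u x = 0%R}]].

Definition dotL2 Omega u w : \bar R := \int[mu]_(x in Omega) (u x * w x)%:E.

Definition normL2 Omega u : \bar R := Lnorm mu 2%:E (EFin \o u \_ Omega).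

Definition in_L2 Omega u : Prop := u \_ Omega \in Lfun mu 2%:E.

Definition eigenfunction Omega (lambda : R) u : Prop :=
  [/\ H0 Omega u, ~ {ae mu, forall x, u x = 0%R}
    & forall phi, H0 Omega phi ->
        E_sLog u phi = lambda%:E * dotL2 Omega u phi].

(* Hilbert basis: orthonormal, with dense linear span. *)
Definition orthonormal_basis_L2 Omega (xi : nat -> 'rV[R]_n -> R) : Prop :=
  [/\ forall i, in_L2 Omega (xi i),
      forall i j, dotL2 Omega (xi i) (xi j) = (i == j)%:R%:E
    & forall f, in_L2 Omega f -> forall eps : R, (0 < eps)%R ->
        exists (m : nat) (a : nat -> R),
          normL2 Omega (fun x => f x - \sum_(i < m) a i * xi i x)%R < eps%:E].

(* Sequences are indexed from 0: lambda_(k+1), xi_(k+1), H_(k+1) are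
   lam k, xi k, Hk Omega xi k. *)
Definition Hk Omega (xi : nat -> 'rV[R]_n -> R) (k : nat) :
    set ('rV[R]_n -> R) :=
  [set u | H0 Omega u /\ forall i, (i < k)%N -> dotL2 Omega u (xi i) = 0].

End fractional_logarithmic.

Definition is_minimum (R : realType) (A : set (\bar R)) (m : \bar R) : Prop :=
  A m /\ lbound A m.

(* Main.v *)
(* The eigenpairs are obtained by successively minimizing the quadratic form B of
   (-Delta)^(s+Log) on the L^2-unit sphere of the orthogonal complement of the
   previous eigenfunctions. This needs three facts about the form domain.
   Coercivity: k_minus is integrable and |z|^(-n-2s) is at most eps k_plus plus
   an integrable kernel, because k_plus carries an additional logarithm near 0;
   hence B + kappa |.|^2 dominates half of E_plus for large kappa.
   Completeness: Fatou's lemma. Compactness of the embedding into L^2: on a cube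
   of small side, E_plus controls the variance of u with a small constant.
   Lipschitz bumps supported in open subsets of Omega lie in the form domain and
   show that it is dense in L^2(Omega), so the eigenfunctions form a basis.
   For part (iv), let diam(Omega) < d < exp(-1/(2s)). A kernel k restricted to
   {|z| >= d} never meets two points of Omega, so its form at u is twice the
   integral of k times the squared L^2 norm of u. On {|z| >= d} the
   integral of |z|^(-n-2s) (- ln|z|) is positive, since the mean of ln(|z|/d) for
   the weight |z|^(-n-2s) is 1/(2s), less than - ln d. Hence B is bounded below by
   a positive multiple of the L^2 norm squared. Moreover E_minus(|u|,|u|) =
   E_minus(u,u) while the other parts decrease, so a first minimizer can be
   replaced by its absolute value. *)
From HB Require Import structures.
Require Import Defs.
From mathcomp Require Import all_boot all_order all_algebra.
From mathcomp Require Import all_classical all_reals all_analysis.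
From mathcomp Require Import measurable_realfun.
From mathcomp Require Import ring lra.

Set Implicit Arguments.
Unset Strict Implicit.
Unset Printing Implicit Defensive.

Import Order.TTheory GRing.Theory Num.Theory.
Import numFieldNormedType.Exports.

Local Open Scope classical_set_scope.
Local Open Scope ring_scope.

(** * Spectral theorem for a form with compact embedding *)

(** The argument runs on functions, not on classes modulo null sets: the form domain is a module of
    functions, the L^2 product [form_D] on it is only semidefinite, and the abstract spectral
    theorem is stated for such a product. Each of the three kernels is nonnegative, so its form is
    the L^2 product on R^n x R^n of the functions (u(x) - u(y)) sqrt(k(x - y)); bilinearity, passage
    to the limit and comparison of forms become facts about L^2. Compactness enters the abstract
    part as an inequality D <= eps A + finitely many squared functionals, which the cubes deliver
    directly. The first minimizer is an argument of the spectral theorem: in (iv) it has to be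
    replaced by its absolute value before later eigenfunctions are chosen orthogonal to it. Density
    is used in dual form: Fourier series converge in L^2, and the remainder, orthogonal to all
    bumps, integrates to 0 over every Borel set. The mean of the logarithm in (iv) is bounded by
    comparing the tail integral with its own dilations. *)

Section symmetric_form.
Context (R : realType) (V : lmodType R) (Q : V -> V -> R).
Context (Qsym : forall u v, Q u v = Q v u).
Context (Qlin : forall a u v w, Q (a *: u + v) w = a * Q u w + Q v w).

Lemma form0l w : Q 0 w = 0.
Proof. by have := Qlin 1 0 0 w; rewrite scale1r add0r mul1r => /eqP; rewrite -subr_eq subrr eq_sym => /eqP. Qed.

Lemma formDl u v w : Q (u + v) w = Q u w + Q v w.
Proof. by rewrite -[u]scale1r Qlin mul1r scale1r. Qed.

Lemma formZl a u w : Q (a *: u) w = a * Q u w.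
Proof. by rewrite -[a *: u]addr0 Qlin form0l addr0. Qed.

Lemma formNl u w : Q (- u) w = - Q u w.
Proof. by rewrite -scaleN1r formZl mulN1r. Qed.

Lemma formBl u v w : Q (u - v) w = Q u w - Q v w.
Proof. by rewrite formDl formNl. Qed.

Lemma formDr u v w : Q w (u + v) = Q w u + Q w v.
Proof. by rewrite Qsym formDl !(Qsym w). Qed.

Lemma formZr a u w : Q w (a *: u) = a * Q w u.
Proof. by rewrite Qsym formZl (Qsym w). Qed.

Lemma formBr u v w : Q w (u - v) = Q w u - Q w v.
Proof. by rewrite Qsym formBl !(Qsym w). Qed.

Lemma form_suml I (r : seq I) (P : pred I) (F : I -> V) w :
  Q (\sum_(i <- r | P i) F i) w = \sum_(i <- r | P i) Q (F i) w.
Proof. by apply: (big_morph (Q^~ w)); [move=> ? ?; rewrite formDl|exact: form0l]. Qed.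

Lemma form_sumr I (r : seq I) (P : pred I) (F : I -> V) w :
  Q w (\sum_(i <- r | P i) F i) = \sum_(i <- r | P i) Q w (F i).
Proof. by rewrite Qsym form_suml; apply: eq_bigr => i _; rewrite Qsym. Qed.

Lemma formDD u v : Q (u + v) (u + v) = Q u u + 2 * Q u v + Q v v.
Proof. by rewrite formDl !formDr (Qsym v u); ring. Qed.

Lemma formBB u v : Q (u - v) (u - v) = Q u u - 2 * Q u v + Q v v.
Proof. by rewrite formBl !formBr (Qsym v u); ring. Qed.

Lemma form_parallelogram u v :
  Q (u - v) (u - v) = 2 * Q u u + 2 * Q v v - Q (u + v) (u + v).
Proof. by rewrite formBB formDD; ring. Qed.

Context (Q0 : forall u, 0 <= Q u u).

(** The usual discriminant argument on t -> Q (u + t v) (u + t v). Since Q is only semidefinite, Q v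
    v may be 0; the function is then affine in t, and staying nonnegative forces Q u v = 0. *)
Lemma form_cauchy_schwarz u v : `|Q u v| <= Num.sqrt (Q u u) * Num.sqrt (Q v v).
Proof.
rewrite -sqrtrM// -sqrtr_sqr ler_wsqrtr//.
have H t : 0 <= Q u u + 2 * t * Q u v + t ^+ 2 * Q v v.
  have := Q0 (u + t *: v); rewrite formDD !formZr formZl.
  by rewrite [X in 0 <= X -> _](_ : _ = Q u u + 2 * t * Q u v + t ^+ 2 * Q v v)//; ring.
have [v0|v0] := eqVneq (Q v v) 0.
  have [->|uv0] := eqVneq (Q u v) 0; first by rewrite v0 mulr0 expr0n.
  (* This t gives the affine function the value -1. *)
  have := H (- (Q u u + 1) / (2 * Q u v)); rewrite v0 mulr0 addr0.
  rewrite [X in 0 <= X -> _](_ : _ = -1); last by field.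
  by rewrite lerNr oppr0 ler10.
have v1 : 0 < Q v v by rewrite lt0r v0 Q0.
have := H (- Q u v / Q v v).
rewrite [X in 0 <= X -> _](_ : _ = (Q u u * Q v v - Q u v ^+ 2) / Q v v); last by field.
by rewrite pmulr_lge0 ?invr_gt0// subr_ge0.
Qed.

Lemma form_cvgl (u : nat -> V) v w :
  Q (u i - v) (u i - v) @[i --> \oo] --> 0 -> Q (u i) w @[i --> \oo] --> Q v w.
Proof.
move=> uv; apply/subr_cvg0; apply/norm_cvg0P.
apply: (@squeeze_cvgr _ _ _ _ (cst 0) (fun i => Num.sqrt (Q (u i - v) (u i - v)) * Num.sqrt (Q w w))).
- by near=> i => /=; rewrite normr_ge0 -formBl form_cauchy_schwarz.
- exact: cvg_cst.
rewrite -[X in _ --> X](mul0r (Num.sqrt (Q w w))); apply: cvgMr_tmp.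
rewrite -[X in _ --> X](@sqrtr0 R).
exact: (@continuous_cvg _ _ _ _ _ _ Num.sqrt _ (@sqrt_continuous R _) uv).
Unshelve. all: end_near. Qed.

Lemma form_cvg (u : nat -> V) v :
  Q (u i - v) (u i - v) @[i --> \oo] --> 0 -> Q (u i) (u i) @[i --> \oo] --> Q v v.
Proof.
move=> uv.
rewrite (_ : (fun i => _) = (fun i => Q (u i - v) (u i - v) + (2 * Q (u i) v - Q v v))); last first.
  by apply/funext => i; rewrite formBB; ring.
rewrite [X in _ --> X](_ : _ = 0 + (2 * Q v v - Q v v)); last by ring.
apply: cvgD => //; apply: cvgB; last exact: cvg_cst.
by apply: cvgMl_tmp; exact: form_cvgl.
Qed.

End symmetric_form.

(** Serves to apply the ultrafilter form of compactness of a segment to the values of a functional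
    along an ultrafilter on the indices. *)
Lemma ultra_fmap (T U : Type) (f : T -> U) (F : set_system T) :
  UltraFilter F -> UltraFilter (f @ F).
Proof.
move=> UF; have PF := ultra_proper; split; first exact: fmap_proper_filter.
move=> G PG FG; apply/seteqP; split=> // A GA.
have [//|FA] := in_ultra_setVsetC (f @^-1` A) UF.
have GA' : G (~` A) by apply: FG; rewrite /fmap/= preimage_setC.
have G0 : G set0 by rewrite -(setICr A); exact: filterI.
by have [] := filter_ex G0.
Qed.

Section spectral_theorem.
Context (R : realType) (V : lmodType R) (B D : V -> V -> R) (kappa : R).
Context (Bsym : forall u v, B u v = B v u) (Dsym : forall u v, D u v = D v u).
Context (Blin : forall a u v w, B (a *: u + v) w = a * B u w + B v w).
Context (Dlin : forall a u v w, D (a *: u + v) w = a * D u w + D v w).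

Definition shifted_form u v := B u v + kappa * D u v.
Local Notation A := shifted_form.

Context (D0 : forall u, 0 <= D u u) (A0 : forall u, 0 <= A u u).
Context (complete : forall u : nat -> V,
  (forall eps : R, 0 < eps -> exists N, forall i j, (N <= i)%N -> (N <= j)%N ->
     A (u i - u j) (u i - u j) + D (u i - u j) (u i - u j) < eps) ->
  exists v, A (u i - v) (u i - v) + D (u i - v) (u i - v) @[i --> \oo] --> 0).
(* Ehrling-type inequality expressing that (V, A + D) embeds compactly into
   (V, D). *)
Context (compact_embedding : forall eps : R, 0 < eps ->
  exists (I : finType) (l : I -> V -> R) (C : R),
  [/\ forall q u v, l q (u - v) = l q u - l q v,
      forall q u, l q u ^+ 2 <= C * D u u
    & forall u, D u u <= eps * A u u + \sum_q l q u ^+ 2]).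
Context (orthonormal : exists e : nat -> V, forall i j, D (e i) (e j) = (i == j)%:R).

Let Asym u v : A u v = A v u.
Proof. by rewrite /A Bsym Dsym. Qed.

Let Alin a u v w : A (a *: u + v) w = a * A u w + A v w.
Proof. by rewrite /A Blin Dlin; ring. Qed.

Let form_sub_le Q (Qsym : forall u v, Q u v = Q v u)
  (Qlin : forall a u v w, Q (a *: u + v) w = a * Q u w + Q v w)
  (Q0 : forall u : V, 0 <= Q u u) u v : Q (u - v) (u - v) <= 2 * Q u u + 2 * Q v v.
Proof. by rewrite (form_parallelogram Qsym Qlin)// lerBlDr lerDl. Qed.

(* Along an ultrafilter all the bounded functionals l converge at once, which
   avoids extracting subsequences. *)
Lemma precompact_ultra (G : set_system nat) (u : nat -> V) (M eps : R) :
  UltraFilter G -> (forall i, A (u i) (u i) <= M) -> (forall i, D (u i) (u i) <= M) ->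
  0 < eps ->
  exists2 S, G S & forall i j, S i -> S j -> D (u i - u j) (u i - u j) <= eps.
Proof.
move=> GU AM DM eps0.
have M0 : 0 <= M by apply: le_trans (DM 0%N).
(* A is at most 4 M on u i - u j, so its share is at most eps / 2. The radius [d] below makes the
   sum of the squared functionals at most eps / 2 as well. *)
pose eps' := eps / (8 * (M + 1)).
have eps'0 : 0 < eps' by rewrite divr_gt0// mulr_gt0// ltr_wpDl.
have [I [l [C [lB lC lD]]]] := compact_embedding eps'0.
pose d := Num.sqrt (eps / (8 * (#|I|%:R + 1))).
have d0 : 0 < d by rewrite sqrtr_gt0 divr_gt0// mulr_gt0// ltr_wpDl.
have cv q : exists a : R, l q (u i) @[i --> G] --> a.
  (* Adding 1 gives K <= K^2, so that the bound on the square of [l q] yields one on [l q]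
     itself. *)
  pose K := `|C| * M + 1.
  have lK i : l q (u i) \in `[- K, K].
    have K1 : 1 <= K by rewrite lerDr mulr_ge0.
    rewrite in_itv/= -ler_norml -[leRHS]ger0_norm ?(le_trans _ K1)//.
    rewrite -ler_sqr ?nnegrE// !real_normK ?num_real//.
    apply: (le_trans (lC _ _)); apply: (@le_trans _ _ (`|C| * M)).
      by apply: (le_trans (ler_wpM2r (D0 _) (ler_norm C))); rewrite ler_wpM2l.
    apply: (@le_trans _ _ K); first by rewrite lerDl.
    by rewrite expr2 ler_peMl// (le_trans _ K1).
  have := @segment_compact R (- K) K.
  rewrite compact_ultra => /(_ (l q \o u @ G) _) H.
  have GK : (l q \o u @ G) [set` `[- K, K]].
    have E : (l q \o u) @^-1` [set` `[- K, K]] = setT.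
      by apply/seteqP; split => // i _; exact: lK.
    by rewrite /fmap/= E; exact: filterT.
  by case: (H (ultra_fmap (l q \o u) GU) GK) => a [_ al]; exists a.
have [a al] := choice cv.
have S q : G [set i | `|a q - l q (u i)| <= d].
  by have /cvgrPdist_le := al q; exact.
exists [set i | forall q, `|a q - l q (u i)| <= d].
  exact: (@filter_forall _ _ (fun q => [set i | `|a q - l q (u i)| <= d])).
move=> i j Si Sj; apply: (le_trans (lD _)).
have -> : eps = eps / 2 + eps / 2 by field.
apply: lerD.
  apply: (@le_trans _ _ (eps' * (4 * M))).
    apply: ler_wpM2l; [exact: ltW|apply: (le_trans (form_sub_le Asym Alin A0 _ _));
    by have := AM i; have := AM j; lra].
  rewrite [leLHS](_ : _ = eps / 2 * (M / (M + 1))); last first.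
    by rewrite /eps'; field; rewrite gt_eqF// ltr_wpDl.
  by apply: ler_piMr; [rewrite ltW// divr_gt0|rewrite ler_pdivrMr ?ltr_wpDl// mul1r lerDl].
apply: (@le_trans _ _ (\sum_(q : I) 4 * d ^+ 2)).
  apply: ler_sum => q _; rewrite lB.
  have : `|l q (u i) - l q (u j)| <= 2 * d.
    have := ler_distD (a q) (l q (u i)) (l q (u j)).
    by have := Si q; have := Sj q; rewrite (distrC (l q (u i)) (a q)); lra.
  by rewrite ler_norml => /andP[]; nra.
rewrite sumr_const -mulr_natl /d sqr_sqrtr; last first.
  by rewrite ltW// divr_gt0// mulr_gt0// ltr_wpDl.
rewrite [leLHS](_ : _ = eps / 2 * (#|I|%:R / (#|I|%:R + 1))); last first.
  by field; rewrite gt_eqF// ltr_wpDl.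
by apply: ler_piMr; [rewrite ltW// divr_gt0|rewrite ler_pdivrMr ?ltr_wpDl// mul1r lerDl].
Qed.

(** An ultrafilter finer than the tails of nat has a small set S k for every k; S 0, ..., S k and
    the tail from k have a common point, taken as f k. Beyond N all values of f lie in S N. The map
    f need not increase: k <= f k suffices for limits. *)
Lemma precompact (u : nat -> V) (M : R) :
  (forall i, A (u i) (u i) <= M) -> (forall i, D (u i) (u i) <= M) ->
  exists2 f : nat -> nat, forall i, (i <= f i)%N &
  forall eps : R, 0 < eps -> exists N, forall i j, (N <= i)%N -> (N <= j)%N ->
    D (u (f i) - u (f j)) (u (f i) - u (f j)) < eps.
Proof.
move=> AM DM.
have [G [GU subG]] := @ultraFilterLemma nat \oo _.
have H k : exists S, G S /\ forall i j, S i -> S j -> D (u i - u j) (u i - u j) <= k.+1%:R^-1.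
  have [|S ? ?] := @precompact_ultra G u M (k.+1%:R^-1) GU AM DM; first by rewrite invr_gt0.
  by exists S.
have [S SP] := choice H.
have F k : exists i, (k <= i)%N /\ forall j, (j <= k)%N -> S j i.
  have : G ([set i | (k <= i)%N] `&` [set i | forall j : 'I_k.+1, S j i]).
    apply: filterI; first by apply: subG; exists k.
    by apply: (@filter_forall _ _ (fun j : 'I_k.+1 => S j)) => j; case: (SP j).
  move=> /filter_ex [i [ki Si]]; exists i; split => // j jk.
  by have := Si (Ordinal (jk : (j < k.+1)%N)).
have [f fP] := choice F.
exists f => [i|eps eps0]; first by case: (fP i).
have [N _ NP] := near_infty_natSinv_lt (PosNum eps0).
exists N => i j Ni Nj; apply: le_lt_trans (NP N (leqnn N)).
by apply: (SP N).2; [apply: (fP i).2|apply: (fP j).2].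
Qed.

(** Direct method with strong convergence. Compactness makes a minimizing sequence Cauchy for D; the
    sum of two terms still satisfies the constraints, so B is bounded below on it, and the
    parallelogram identity bounds B on the difference. The sequence is thus Cauchy for A + D, and
    completeness gives the minimizer. *)
Lemma exists_minimizer (l : seq V) :
  exists p : R * V, [/\ forall i, (i < size l)%N -> D p.2 l`_i = 0,
    D p.2 p.2 = 1, B p.2 p.2 = p.1 &
    forall w, (forall i, (i < size l)%N -> D w l`_i = 0) -> p.1 * D w w <= B w w].
Proof.
pose S := [set u | forall i, (i < size l)%N -> D u l`_i = 0].
have Slin a u v : S u -> S v -> S (a *: u + v).
  by move=> Su Sv i il; rewrite Dlin Su// Sv// mulr0 addr0.
have SZ a u : S u -> S (a *: u).
  by move=> Su i il; rewrite (formZl Dlin) Su// mulr0.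
have [e0 Se0 De0] : exists2 w, S w & 0 < D w w.
  have [e eP] := orthonormal; set k := size l.
  (* With k constraints and k + 1 orthonormal vectors, this matrix has a nonzero vector in its left
     kernel; its entries are the coefficients of a nonzero combination satisfying all
     constraints. *)
  pose Mx := \matrix_(j < k.+1, i < k) D (e j) l`_i.
  have /rowV0Pn[v vM v0] : kermx Mx != 0.
    by rewrite kermx_eq0 /row_free ltn_eqF// (leq_ltn_trans (rank_leq_col Mx)).
  exists (\sum_j v 0 j *: e j).
    move=> i il; rewrite (form_suml Dlin).
    move/sub_kermxP : vM => /matrixP/(_ 0 (Ordinal il)); rewrite !mxE => {2}<-.
    by apply: eq_bigr => j _; rewrite (formZl Dlin) !mxE.
  have -> : D (\sum_j v 0 j *: e j) (\sum_j v 0 j *: e j) = \sum_j v 0 j ^+ 2.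
    rewrite (form_suml Dlin); apply: eq_bigr => j _.
    rewrite (form_sumr Dsym Dlin) (bigD1 j)//= big1 => [|i ij].
      by rewrite (formZl Dlin) (formZr Dsym Dlin) eP eqxx mulr1 addr0 expr2.
    by rewrite (formZl Dlin) (formZr Dsym Dlin) eP eq_sym val_eqE (negbTE ij) !mulr0.
  rewrite lt0r sumr_ge0 ?andbT => [|i _]; last exact: sqr_ge0.
  apply: contra_neq v0 => /eqP; rewrite psumr_eq0 => [/allP v0|i _]; last exact: sqr_ge0.
  apply/rowP => j; rewrite mxE; apply/eqP; rewrite -sqrf_eq0.
  by apply: v0; rewrite mem_index_enum.
pose E := [set B w w | w in [set w | S w /\ D w w = 1]].
have normalize w : S w -> 0 < D w w -> S ((Num.sqrt (D w w))^-1 *: w) /\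
    D ((Num.sqrt (D w w))^-1 *: w) ((Num.sqrt (D w w))^-1 *: w) = 1.
  move=> Sw Dw; split; first exact: SZ.
  rewrite (formZl Dlin) (formZr Dsym Dlin) mulrA -expr2 exprVn sqr_sqrtr ?(ltW Dw)//.
  by rewrite mulVf// gt_eqF.
have Einf : has_inf E.
  split; first by have [? ?] := normalize _ Se0 De0; eexists; eexists; first split; eauto.
  exists (- kappa) => _ [w [_ Dw] <-].
  by have := A0 w; rewrite /shifted_form Dw mulr1 -lerBlDr sub0r.
pose m := inf E.
have mP w : S w -> m * D w w <= B w w.
  (* When D w w = 0, w cannot be normalized, but A w w >= 0 then reads B w w >= 0. *)
  move=> Sw; have := D0 w; rewrite le0r => /orP[/eqP Dw|Dw].
    by have := A0 w; rewrite /shifted_form Dw !mulr0 addr0.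
  have [Sw' Dw'] := normalize _ Sw Dw.
  have := ge_inf Einf.2 (ex_intro2 _ _ _ (conj Sw' Dw') erefl).
  rewrite (formZl Blin) (formZr Bsym Blin) mulrA -expr2 exprVn sqr_sqrtr ?(ltW Dw)//.
  by rewrite ler_pdivlMl// mulrC.
have H k : exists w, [/\ S w, D w w = 1 & B w w < m + k.+1%:R^-1].
  have [|_ [w [Sw Dw] <-] wm] := @inf_adherent _ E k.+1%:R^-1 _ Einf.
    by rewrite invr_gt0.
  by exists w.
have [w wP] := choice H.
have inv1 k : (k.+1%:R : R)^-1 <= 1 by rewrite invf_le1// ler1n.
have [i|i|f fi fD] := @precompact w (`|m + 1 + kappa| + 1).
- have [_ Dw Bw] := wP i; rewrite /shifted_form Dw mulr1.
  have := ler_norm (m + 1 + kappa); have := inv1 i.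
  set x := (_^-1) in Bw *; set y := `|_|; lra.
- by have [_ -> _] := wP i; rewrite lerDr.
pose u i := w (f i).
have uB i : B (u i) (u i) < m + i.+1%:R^-1.
  have [_ _] := wP (f i) => /lt_le_trans; apply; rewrite lerD2l lef_pV2 ?posrE//.
  by rewrite ler_nat ltnS.
have uD i : D (u i) (u i) = 1 by case: (wP (f i)).
have [v vP] : exists v, A (u i - v) (u i - v) + D (u i - v) (u i - v) @[i --> \oo] --> 0.
  apply: complete => eps eps0.
  (* Let x be D of the difference. D of the sum is 4 - x and B of the sum is at least m (4 - x),
     hence A + D of the difference is at most 2 / (i + 1) + 2 / (j + 1) + (m + kappa + 1) x. *)
  pose K := `|m| + `|kappa| + 1.
  have K0 : 0 < K by rewrite ltr_wpDl// addr_ge0.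
  have eK : 0 < eps / (2 * K) by rewrite divr_gt0// mulr_gt0.
  have [N1 N1P] := fD _ eK.
  have e8 : 0 < eps / 8 by rewrite divr_gt0.
  have [N2 _ /= N2P] := near_infty_natSinv_lt (PosNum e8).
  exists (maxn N1 N2) => i j; rewrite !geq_max => /andP[i1 i2] /andP[j1 j2].
  have := N1P i j i1 j1; rewrite ltr_pdivlMr ?mulr_gt0// -/(u i) -/(u j).
  have := N2P i i2; have := N2P j j2; rewrite /= => dj di Dij.
  have SD : S (u i + u j).
    rewrite -[u i]scale1r; apply: Slin; [by case: (wP (f i))|by case: (wP (f j))].
  have := mP _ SD; have := form_parallelogram Dsym Dlin (u i) (u j).
  rewrite /shifted_form (form_parallelogram Bsym Blin) !uD.
  have := uB i; have := uB j; have := D0 (u i - u j).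
  set x := D (u i - u j) _ in Dij *; set y := D (u i + u j) _.
  set z := B (u i + u j) _; set bi := B (u i) _; set bj := B (u j) _.
  move=> x0 hj hi hy; have -> : y = 4 - x by lra.
  move=> hm.
  have : m * x <= `|m| * x by rewrite ler_wpM2r// ler_norm.
  have : kappa * x <= `|kappa| * x by rewrite ler_wpM2r// ler_norm.
  rewrite /K in Dij; move: Dij dj di hi hj.
  set p := (j.+1%:R^-1); set q := (i.+1%:R^-1).
  by move=> *; lra.
have Av : A (u i - v) (u i - v) @[i --> \oo] --> 0.
  apply: squeeze_cvgr (cvg_cst 0) vP.
  by near=> i; rewrite /= A0 lerDl D0.
have Dv : D (u i - v) (u i - v) @[i --> \oo] --> 0.
  apply: squeeze_cvgr (cvg_cst 0) vP.
  by near=> i; rewrite /= D0 lerDr A0.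
have Sv : S v.
  move=> i il; have := @form_cvgl _ _ _ Dsym Dlin D0 _ _ l`_i Dv.
  rewrite (_ : (fun i0 => _) = cst 0); last first.
    by apply/funext => j; case: (wP (f j)) => Sw _ _; rewrite /= Sw.
  by move=> /cvg_unique; apply; [exact: Rhausdorff|exact: cvg_cst].
have Dv1 : D v v = 1.
  have := form_cvg Dsym Dlin D0 Dv.
  rewrite (_ : (fun i0 => _) = cst 1); last by apply/funext => j; rewrite uD.
  by move=> /cvg_unique; apply; [exact: Rhausdorff|exact: cvg_cst].
exists (m, v); split => //=; apply/eqP; rewrite eq_le; apply/andP; split; last first.
  by have := mP _ Sv; rewrite Dv1 mulr1.
suff : A v v <= m + kappa by rewrite /shifted_form Dv1 mulr1 lerD2r.
have h1 : m + i.+1%:R^-1 + kappa @[i --> \oo] --> m + kappa.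
  rewrite -[X in X + kappa]addr0; apply: cvgD; last exact: cvg_cst.
  by apply: cvgD; [exact: cvg_cst|exact: cvg_harmonic].
have h2 := form_cvg Asym Alin A0 Av.
apply: (ler_cvg_to h2 h1); near=> i.
by rewrite /shifted_form uD mulr1 lerD2r ltW.
Unshelve. all: end_near. Qed.

(** The caller supplies the first minimizer; the others come from [exists_minimizer]. The
    eigenvalues are unbounded because an orthonormal sequence is not precompact. For the expansion,
    the remainder after m terms has A-energy at most A f f, but at least lam m + kappa times its D,
    which forces it to 0 in D. *)
Lemma spectral_decomposition u0 : D u0 u0 = 1 ->
  (forall w, B u0 u0 * D w w <= B w w) ->
  exists (lam : nat -> R) (xi : nat -> V),
    [/\ xi 0%N = u0, forall i j, D (xi i) (xi j) = (i == j)%:R,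
        forall k, B (xi k) (xi k) = lam k /\
          forall w, (forall i, (i < k)%N -> D w (xi i) = 0) -> lam k * D w w <= B w w,
        nondecreasing_seq lam &
    [/\ forall k w, B (xi k) w = lam k * D (xi k) w,
        lam k @[k --> \oo] --> +oo &
        forall f (eps : R), 0 < eps -> exists m (a : nat -> R),
          D (f - \sum_(i < m) a i *: xi i) (f - \sum_(i < m) a i *: xi i) < eps]].
Proof.
move=> Du0 Bu0; have [st stP] := choice exists_minimizer.
(* The chosen minimizer for the empty list of constraints is overridden by u0. *)
pose st' l := if l is [::] then (B u0 u0, u0) else st l.
have st'P l : [/\ forall i, (i < size l)%N -> D (st' l).2 l`_i = 0,
    D (st' l).2 (st' l).2 = 1, B (st' l).2 (st' l).2 = (st' l).1 &
    forall w, (forall i, (i < size l)%N -> D w l`_i = 0) -> (st' l).1 * D w w <= B w w].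
  by case: l => [|x l]; [split|exact: stP].
(* [L k] lists the first k eigenvectors, which are the constraints for the next one. *)
pose L := fix L k := if k is k'.+1 then rcons (L k') (st' (L k')).2 else [::].
pose xi k := (st' (L k)).2; pose lam k := (st' (L k)).1.
have Lsz k : size (L k) = k by elim: k => //= k IH; rewrite size_rcons IH.
have Lnth k i : (i < k)%N -> (L k)`_i = xi i.
  elim: k => //= k IH; rewrite nth_rcons Lsz ltnS leq_eqVlt => /predU1P[->|ik].
    by rewrite ltnn eqxx.
  by rewrite ik IH.
have xio k i : (i < k)%N -> D (xi k) (xi i) = 0.
  by move=> ik; have [H _ _ _] := st'P (L k); rewrite -(Lnth k i)//; apply: H; rewrite Lsz.
have xi1 k : D (xi k) (xi k) = 1 by case: (st'P (L k)).
have xiD i j : D (xi i) (xi j) = (i == j)%:R.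
  by have [ij|ji|->] := ltngtP i j; [rewrite Dsym xio|rewrite xio|rewrite xi1].
have Bxi k : B (xi k) (xi k) = lam k by case: (st'P (L k)).
have min k w : (forall i, (i < k)%N -> D w (xi i) = 0) -> lam k * D w w <= B w w.
  move=> H; have [_ _ _] := st'P (L k); apply => i; rewrite Lsz => ik.
  by rewrite Lnth// H.
have mono : nondecreasing_seq lam.
  move=> i j ij; have := min i (xi j); rewrite xi1 mulr1 Bxi; apply => k ki.
  by rewrite xio// (leq_trans ki).
have proj k f i : (i < k)%N ->
    D (f - \sum_(j < k) D f (xi j) *: xi j) (xi i) = 0.
  move=> ik; rewrite (formBl Dlin) (form_suml Dlin) (bigD1 (Ordinal ik))//= big1 => [|j ji].
    by rewrite (formZl Dlin) xi1 mulr1 addr0 subrr.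
  by rewrite (formZl Dlin) xiD (negbTE (_ : (j : nat) != i)) ?mulr0// ; apply: contra ji => /eqP ji; apply/eqP/val_inj.
have eigen k w : B (xi k) w = lam k * D (xi k) w.
  elim/ltn_ind: k w => k IH w.
  (* First variation: xi k + t v is a competitor for every t. Vectors not orthogonal to the earlier
     xi i are reduced to this case by projection and the induction hypothesis. *)
  have orth v : (forall i, (i < k)%N -> D v (xi i) = 0) -> B (xi k) v = lam k * D (xi k) v.
    move=> vo; apply/eqP; rewrite -subr_eq0.
    pose p := B (xi k) v - lam k * D (xi k) v; pose q := B v v - lam k * D v v.
    have H t : 0 <= 2 * t * p + t ^+ 2 * q.
      have := min k (xi k + t *: v); rewrite (formDD Bsym Blin) (formDD Dsym Dlin).
      rewrite !(formZl Blin, formZl Dlin) !(formZr Bsym Blin, formZr Dsym Dlin) Bxi xi1.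
      move=> H; rewrite -subr_ge0 in H.
      rewrite [leRHS](_ : _ = lam k + 2 * (t * B (xi k) v) + t * (t * B v v) -
        lam k * (1 + 2 * (t * D (xi k) v) + t * (t * D v v))); last by rewrite /p /q; ring.
      apply: H => i ik; rewrite (formDl Dlin) (formZl Dlin) xio// vo//.
      by rewrite mulr0 addr0.
    have q0 : 0 <= q by rewrite subr_ge0 min.
    (* The minimizing t would be - p / q, but q may be 0. This t gives - p^2 (q + 2) / (q + 1)^2,
       which is negative unless p = 0. *)
    have := H (- p / (q + 1)).
    rewrite (_ : _ + _ = - (p ^+ 2 * ((q + 2) / (q + 1) ^+ 2))); last first.
      by field; rewrite gt_eqF// ltr_wpDl.
    rewrite oppr_ge0 => H1; apply/contraT => p0.
    suff : 0 < p ^+ 2 * ((q + 2) / (q + 1) ^+ 2) by rewrite ltNge H1.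
    by apply: mulr_gt0; [rewrite lt0r sqrf_eq0 p0 sqr_ge0|rewrite divr_gt0 ?exprn_gt0 ?ltr_wpDl].
  have := orth _ (proj k w); rewrite (formBr Bsym Blin) (formBr Dsym Dlin).
  rewrite (form_sumr Bsym Blin) (form_sumr Dsym Dlin).
  rewrite [X in _ - X = _ -> _]big1 => [|i _]; last first.
    by rewrite (formZr Bsym Blin) Bsym IH// (Dsym (xi i) (xi k)) xio ?mulr0.
  rewrite [X in _ = _ * (_ - X) -> _]big1 ?subr0// => i _.
  by rewrite (formZr Dsym Dlin) xio ?mulr0.
have lamk k : - kappa <= lam k.
  by have := A0 (xi k); rewrite /shifted_form Bxi xi1 mulr1 -lerBlDr sub0r.
have lamoo : lam k @[k --> \oo] --> +oo.
  apply/cvgryPge => M; apply: contrapT => notM.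
  have lamM k : lam k <= M.
    rewrite leNgt; apply/negP => kM; apply: notM; exists k => // i /= ki.
    exact: (le_trans (ltW kM) (mono _ _ ki)).
  have [i|i|f fi fD] := @precompact xi (`|M + kappa| + 1).
  - rewrite /shifted_form Bxi xi1 mulr1; have := ler_norm (M + kappa).
    by have := lamM i; lra.
  - by rewrite xi1 lerDr.
  have [N NP] := fD 1 ltr01.
  (* The second index is mapped by f beyond f N, so the two eigenvectors are distinct and their
     squared distance is 2, not less than 1. *)
  have := NP N (f N).+1 (leqnn _); rewrite (leq_trans (fi N))// => /(_ isT).
  rewrite (formBB Dsym Dlin) !xiD !eqxx (_ : (f N == _) = false) ?mulr1n ?mulr0n; first by lra.
  by apply/negbTE; rewrite neq_ltn (leq_trans _ (fi (f N).+1)).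
exists lam, xi; split => //; first by move=> k; split => // w; exact: min.
split => // f eps eps0.
have [m _ /= mP] := (cvgryPge _).1 lamoo (`|A f f / eps| + 1 + `|kappa|).
exists m, (fun i => D f (xi i)).
set fm := f - _.
have Axi i w : A (xi i) w = (lam i + kappa) * D (xi i) w.
  by rewrite /shifted_form eigen mulrDl.
(* The xi i are orthogonal for A too, with squares lam i + kappa >= 0, so removing components does
   not increase A. *)
have Afm : A fm fm <= A f f.
  rewrite (formBB Asym Alin) (form_sumr Asym Alin) (form_suml Alin).
  set s1 := \sum_(i < m) _; set s2 := \sum_(i < m) _.
  have s10 : 0 <= s1.
    apply: sumr_ge0 => i _; rewrite (formZr Asym Alin) Asym Axi (Dsym (xi i) f).
    by rewrite mulrCA -expr2 mulr_ge0 ?sqr_ge0// -lerBlDr sub0r.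
  have -> : s2 = s1; last by lra.
  apply: eq_bigr => i _; rewrite (formZl Alin) (formZr Asym Alin) (Asym f) !Axi.
  rewrite (form_sumr Dsym Dlin) (bigD1 i)//= big1 => [|j ji].
    by rewrite (formZr Dsym Dlin) xi1 mulr1 addr0 (Dsym (xi i) f).
  by rewrite (formZr Dsym Dlin) xiD eq_sym val_eqE (negbTE ji) mulr0.
have : (lam m + kappa) * D fm fm <= A f f.
  apply: le_trans Afm; rewrite /shifted_form mulrDl lerD2r.
  by apply: min => i im; exact: proj.
have h1 : A f f / eps + 1 <= lam m + kappa.
  have := mP m (leqnn m); have := ler_norm (A f f / eps); have := ler_norm (- kappa).
  by rewrite normrN; lra.
move=> /(le_trans (ler_wpM2r (D0 fm) h1)) H.
have a0 : 0 <= A f f / eps by rewrite divr_ge0// ltW.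
have E : A f f = A f f / eps * eps by rewrite divfK// gt_eqF.
rewrite {2}E in H; move: H a0; set a := A f f / eps; set d := D fm fm => H a0.
by rewrite -(@ltr_pM2l _ (a + 1)) ?ltr_wpDl//; lra.
Qed.

End spectral_theorem.

(** * Affine changes of variables *)

Section scaled_pushforward.
Context d d' (T1 : measurableType d) (T2 : measurableType d') (R : realType).
Context (m : {measure set T1 -> \bar R}) (f : T1 -> T2).

(** Packaged as a measure, so that uniqueness theorems can identify it with Lebesgue measure. *)
Definition scaled_pushforward (mf : measurable_fun [set: T1] f) (r : {nonneg R})
  (A : set T2) : \bar R := mscale r m (f @^-1` A).

Context (mf : measurable_fun [set: T1] f) (r : {nonneg R}).
Local Notation push := (scaled_pushforward mf r).

Let push0 : push set0 = 0%E.
Proof. by rewrite /push preimage_set0 measure0. Qed.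

Let push_ge0 A : (0 <= push A)%E.
Proof. exact: measure_ge0. Qed.

Let push_sigma_additive : semi_sigma_additive push.
Proof.
move=> F mF tF mUF; rewrite /push preimage_bigcup.
apply: measure_semi_sigma_additive.
- by move=> k; rewrite -[X in measurable X]setTI; exact: mf.
- apply/trivIsetP => /= i j _ _ ij; rewrite -preimage_setI.
  by move/trivIsetP : tF => /(_ _ _ _ _ ij) ->//; rewrite preimage_set0.
- by rewrite -preimage_bigcup -[X in measurable X]setTI; exact: mf.
Qed.

HB.instance Definition _ := isMeasure.Build _ _ _ push push0 push_ge0 push_sigma_additive.

End scaled_pushforward.

Lemma measurable_affine (R : realType) (a r : R) : measurable_fun [set: R] (fun x => a + r * x).
Proof. by apply: measurable_funD => //; exact: measurable_funM. Qed.

(** By uniqueness of Lebesgue measure it is enough to treat intervals ]x, y]. A negative r exchanges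
    the ends, so the preimage is closed on the left and open on the right. *)
Lemma lebesgue_measure_affine (R : realType) (a r : R) (A : set R) : r != 0 ->
  measurable A ->
  (`|r|%:E * lebesgue_measure ((fun x => (a + r * x)%R) @^-1` A) = lebesgue_measure A)%E.
Proof.
move=> r0 mA; pose phi := (fun x => a + r * x) : R -> measurableTypeR R.
have mphi : measurable_fun [set: R] phi by exact: measurable_affine.
pose m := scaled_pushforward (@lebesgue_measure R) mphi (NngNum (normr_ge0 r)).
suff mE X : ocitv X -> lebesgue_measure X = m X by rewrite [RHS](lebesgue_measure_unique mE mA).
move=> [[x y] _ <-] /=; rewrite /m /scaled_pushforward /mscale /=.
have [rp|rn] := ltrP 0 r.
  rewrite gtr0_norm// (_ : _ @^-1` _ = `](x - a) / r, (y - a) / r]%classic); last first.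
    by apply/seteqP; split=> z /=; rewrite !in_itv/= /phi ltr_pdivrMr// ler_pdivlMr// ltrBlDl lerBrDl mulrC.
  rewrite !lebesgue_measure_itv/= !lte_fin ltr_pM2r ?invr_gt0// ltrD2r.
  case: ifPn => _; last by rewrite mule0.
  by rewrite -!EFinB -EFinM; congr (_%:E); field.
have {r0}rn : r < 0 by rewrite lt_neqAle r0.
rewrite ltr0_norm// (_ : _ @^-1` _ = `[(y - a) / r, (x - a) / r[%classic); last first.
  by apply/seteqP; split=> z /=; rewrite !in_itv/= /phi ler_ndivrMr// ltr_ndivlMr// ltrBlDl lerBrDl mulrC andbC.
rewrite !lebesgue_measure_itv/= !lte_fin ltr_nM2r ?invr_lt0// ltrD2r.
case: ifPn => _; last by rewrite mule0.
by rewrite -!EFinB -EFinM; congr (_%:E); field; rewrite lt_eqF.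
Qed.

Section lebesgue_rV_affine.
Context (R : realType).

Definition affine_rV n (a : 'rV[R]_n) (r : R) (x : 'rV[R]_n) := a + r *: x.

Lemma measurable_affine_rV n (a : 'rV[R]_n) r : measurable_fun [set: 'rV[R]_n] (affine_rV a r).
Proof.
apply: measurable_fun_rVP => i.
rewrite (_ : _ \o _ = fun x => a ord0 i + r * rV_coord i x); last first.
  by apply/funext => x /=; rewrite /rV_coord /affine_rV !mxE.
apply: measurable_funD => //; apply: measurable_funM => //.
exact: measurable_rV_coord.
Qed.

(** Induction on the dimension: through [rV_cons] the map splits into an affine map of the line and
    one of the remaining coordinates, and the product measure is determined by rectangles. *)
Lemma lebesgue_rV_affine n (a : 'rV[R]_n) r A : r != 0 -> measurable A ->
  ((`|r| ^+ n)%:E * lebesgue_rV R n (affine_rV a r @^-1` A) = lebesgue_rV R n A)%E.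
Proof.
move=> r0; elim: n a A => [|n IH] a A mA.
  rewrite expr0 mul1e; congr (lebesgue_rV R 0 _).
  by apply/seteqP; split => x /=; rewrite (thinmx0 (affine_rV a r x)) (thinmx0 x).
pose psi (p : measurableTypeR R * 'rV[R]_n) : measurableTypeR R * 'rV[R]_n :=
  (a ord0 ord0 + r * p.1, affine_rV (@rsubmx R 1 1 n a) r p.2).
have mpsi : measurable_fun [set: measurableTypeR R * 'rV[R]_n] psi.
  apply/measurable_fun_pairP; split.
    apply: (@measurable_funD _ _ _ _ (cst (a ord0 ord0)) (fun p => r * p.1)) => //.
    by apply: (@measurable_funM _ _ _ _ (cst r) fst) => //; exact: measurable_fst.
  exact: (measurableT_comp (measurable_affine_rV (@rsubmx R 1 1 n a) r) measurable_snd).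
have r1 : 0 <= `|r| ^+ n.+1 by rewrite exprn_ge0.
pose m : {measure set (measurableTypeR R * 'rV[R]_n) -> \bar R} := scaled_pushforward (@lebesgue_measure R \x lebesgue_rV R n)%E mpsi (NngNum r1).
have mE B C : measurable B -> measurable C -> (m (B `*` C) = lebesgue_measure B * lebesgue_rV R n C)%E.
  move=> mB mC; change (m (B `*` C)) with ((`|r| ^+ n.+1)%:E * (@lebesgue_measure R \x lebesgue_rV R n)
    (((fun x => a ord0 ord0 + r * x)%R @^-1` B) `*` (affine_rV (@rsubmx R 1 1 n a) r @^-1` C)))%E.
  rewrite product_measure1E; last 2 first.
  - by rewrite -[X in measurable X]setTI; exact: (measurable_affine (a ord0 ord0) r measurableT mB).
  - by rewrite -[X in measurable X]setTI; exact: measurable_affine_rV.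
  by rewrite -(IH (@rsubmx R 1 1 n a) C mC) -(lebesgue_measure_affine (a ord0 ord0) r0 mB) exprS EFinM muleACA.
rewrite /= /lebesgue_rV_step /pushforward.
have mcA : measurable (@rV_cons R n @^-1` A).
  by rewrite -[X in measurable X]setTI; exact: measurable_rV_cons.
rewrite [RHS](@product_measure_unique _ _ _ _ R (@lebesgue_measure R) (lebesgue_rV R n) m mE _ mcA).
rewrite /m /scaled_pushforward /mscale /=; congr (_ * _)%E; congr (_ _).
apply/seteqP.
have E p : affine_rV a r (rV_cons p) = rV_cons (psi p).
  apply/rowP => i; rewrite /affine_rV /rV_cons !mxE.
  case: (@split_ordP 1 n i) => j ->; rewrite ?(unsplitK (inl j)) ?(unsplitK (inr j)) !mxE.
    by congr (a _ _ + _); apply/val_inj; rewrite /= ord1.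
  by [].
by split => p; rewrite /preimage /mkset E.
Qed.

End lebesgue_rV_affine.

(** Translations and the reflection r = -1 serve for convolutions, dilations for the scaling
    argument on kernel tails. *)
Lemma integral_rV_affine (R : realType) n (a : 'rV[R]_n) (r : R) (f : 'rV[R]_n -> \bar R) :
  r != 0 -> measurable_fun [set: 'rV[R]_n] f -> (forall x, 0 <= f x)%E ->
  (\int[lebesgue_rV R n]_x f (affine_rV a r x) =
   ((`|r| ^+ n)^-1)%:E * \int[lebesgue_rV R n]_x f x)%E.
Proof.
move=> r0 mf f0; have k0 : 0 <= (`|r| ^+ n)^-1 by rewrite invr_ge0 exprn_ge0.
rewrite -(ge0_integral_mscale (lebesgue_rV R n) measurableT (NngNum k0) mf)//.
transitivity (\int[pushforward (lebesgue_rV R n) (affine_rV a r)]_x f x)%E.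
  by rewrite (ge0_integral_pushforward (measurable_affine_rV a r)).
apply: eq_measure_integral => [|mphi A mA _]; first exact: measurable_affine_rV.
change (lebesgue_rV R n (affine_rV a r @^-1` A) = ((`|r| ^+ n)^-1)%:E * lebesgue_rV R n A)%E.
rewrite -(lebesgue_rV_affine a r0 mA).
rewrite muleA -EFinM mulVf ?mul1e// expf_neq0// normr_eq0//.
Qed.

Section rV_sets.
Context (R : realType) (n : nat).
Implicit Types (x y : 'rV[R]_n).

Lemma measurable_rV_box (A : 'I_n -> set R) : (forall i, measurable (A i)) ->
  measurable [set x : 'rV[R]_n | forall i, A i (x ord0 i)].
Proof.
move=> mA; rewrite (_ : [set _ | _] = \bigcap_(i in [set: 'I_n]) (@rV_coord R n i @^-1` A i)).
  apply: fin_bigcap_measurable => // i _.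
  by rewrite -[X in measurable X]setTI; exact: measurable_rV_coord.
by apply/seteqP; split=> [x H i _|x H i]; [exact: H|exact: (H i I)].
Qed.

(** The sigma-algebra is generated by coordinates, so an open set is written as a countable union of
    boxes with rational centres and radii 1 / (k + 1). *)
Lemma open_rV_measurable (U : set 'rV[R]_n) : open U -> measurable U.
Proof.
move=> oU; pose box (p : {ffun 'I_n -> rat} * nat) :=
  [set x : 'rV[R]_n | forall i, ball (ratr (p.1 i) : R) (p.2.+1%:R^-1) (x ord0 i)].
have -> : U = \bigcup_(p in [set p | box p `<=` U]) box p.
  apply/seteqP; split=> [x Ux|x [p pU /pU//]].
  have /nbhs_ballP[e /= e0 eU] : nbhs x U by apply: open_nbhs_nbhs.
  (* A box of radius below e / 2 that contains x lies in the ball of radius e around x. *)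
  have e2 : 0 < e / 2 by rewrite divr_gt0.
  have [k _ /(_ k (leqnn k)) /= ke] := near_infty_natSinv_lt (PosNum e2).
  have H i : exists q : rat, ball (ratr q : R) k.+1%:R^-1 (x ord0 i).
    have /rat_in_itvoo[q] : x ord0 i - k.+1%:R^-1 < x ord0 i + k.+1%:R^-1.
      by rewrite ltrBlDr -addrA ltrDl addr_gt0// invr_gt0.
    rewrite in_itv/= => /andP[q1 q2]; exists q.
    move: q1 q2; rewrite /ball/= ltr_norml; set e1 := (k.+1%:R^-1) => q1 q2.
    by apply/andP; split; lra.
  have [q qP] := choice H.
  exists ([ffun i => q i], k); last by move=> i; rewrite ffunE.
  move=> y /= yb; apply: eU; split => // i j; rewrite (ord1 i).
  have := qP j; have := yb j; rewrite ffunE /ball/= !ltr_norml.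
  move: ke; set e1 := (k.+1%:R^-1) => ke /andP[a1 a2] /andP[b1 b2].
  by apply/andP; split; lra.
rewrite bigcup_mkcond; apply: countable_bigcupT_measurable => [|p].
  by exact: countableP.
case: ifP => // _; exact: (measurable_rV_box (fun i => measurable_ball (ratr (p.1 i) : R) p.2.+1%:R^-1)).
Qed.

End rV_sets.

Lemma lebesgue_rV_box (R : realType) m (A : 'I_m -> set R) (h : R) :
  (forall i, measurable (A i)) -> (forall i, lebesgue_measure (A i) = h%:E) ->
  lebesgue_rV R m [set x | forall i, A i (x ord0 i)] = (h ^+ m)%:E.
Proof.
elim: m A => [|m IH] A mA Ah.
  rewrite (_ : [set _ | _] = setT) /= ?diracT//.
  by apply/seteqP; split => // x _ [].
pose B : set 'rV[R]_m := [set y | forall i, A (lift ord0 i) (y ord0 i)].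
have mB : measurable B by apply: (measurable_rV_box (A := fun i => A (lift ord0 i))).
have E : lebesgue_rV R m B = (h ^+ m)%:E by apply: (IH (fun i => A (lift ord0 i))).
rewrite exprS EFinM -E -(Ah ord0) -lebesgue_rVS//; congr (lebesgue_rV R m.+1 _).
apply/seteqP; split=> x /=.
  move=> H; split; first exact: H.
  by move=> i; rewrite mxE; have := H (lift ord0 i); congr (A _ (x _ _)); exact/val_inj.
move=> [H0 H] i; have [j ->|->] := unliftP ord0 i; last exact: H0.
by have := H j; rewrite mxE; congr (A _ (x _ _)); exact/val_inj.
Qed.

(** * Integrals of powers of the norm *)

Lemma nneseries_geometric_le (R : realType) (K q : R) : 0 <= K -> 0 <= q -> q < 1 ->
  (\sum_(0 <= j <oo) (K * q ^+ j)%:E <= (K / (1 - q))%:E)%E.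
Proof.
move=> K0 q0 q1; have q10 : 0 < 1 - q by rewrite subr_gt0.
apply: lime_le.
  by apply: is_cvg_nneseries => j _ _; rewrite lee_fin mulr_ge0 ?exprn_ge0.
near=> k; rewrite sumEFin lee_fin.
have -> : \sum_(0 <= j < k) K * q ^+ j = K * (1 - q ^+ k) / (1 - q).
  by have := @geometric_seriesE R K q; rewrite lt_eqF// => /(_ isT) /(congr1 (@^~ k)).
rewrite ler_wpM2r ?invr_ge0 ?(ltW q10)//.
by rewrite ler_piMr// gerBl exprn_ge0.
Unshelve. all: end_near. Qed.

Lemma nneseries_term_le (R : realType) (u : nat -> \bar R) k : (forall j, 0 <= u j)%E ->
  (u k <= \sum_(0 <= j <oo) u j)%E.
Proof.
move=> u0; apply: (@le_trans _ _ (\sum_(0 <= j < k.+1) u j)%E).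
  by rewrite big_nat_recr//= leeDr// sume_ge0.
exact: nneseries_lim_ge.
Qed.

(** The logarithms of x and c differ by at most ln 2; the absolute value in the constant covers both
    signs of p. *)
Lemma dyadic_le_powR (R : realType) (x c p : R) : 0 < c -> c / 2 <= x <= 2 * c ->
  x `^ p <= 2 `^ `|p| * c `^ p.
Proof.
move=> c0 /andP[x1 x2]; have x0 : 0 < x by apply: lt_le_trans x1; rewrite divr_gt0.
rewrite /powR !gt_eqF// -expRD ler_expR.
have -> : p * ln x = p * (ln x - ln c) + p * ln c by rewrite mulrBr subrK.
rewrite lerD2r; apply: (le_trans (ler_norm _)); rewrite normrM ler_wpM2l//.
have h1 : ln (c / 2) <= ln x by rewrite ler_ln ?posrE ?divr_gt0.
have h2 : ln x <= ln (2 * c) by rewrite ler_ln ?posrE ?mulr_gt0.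
rewrite ln_div ?posrE// in h1; rewrite lnM ?posrE// in h2.
by rewrite ler_norml; apply/andP; split; lra.
Qed.

Lemma exists_dyadic (R : realType) (x : R) : 1 <= x -> exists j, 2 ^+ j <= x < 2 ^+ j.+1.
Proof.
move=> x1; have ex : exists j, x < 2 ^+ j.
  exists (Num.truncn x).+1; have := truncnS_gt x => /lt_trans; apply.
  by rewrite -natrX ltr_nat ltn_expl.
have [j xj jmin] := ex_minnP ex; case: j => [|j] in xj jmin *.
  by rewrite expr0 ltNge x1 in xj.
by exists j; rewrite xj andbT leNgt; apply/negP => /jmin; rewrite ltnn.
Qed.

Section dyadic_layers.
Context d (T : measurableType d) (R : realType) (m : {measure set T -> \bar R}).
Context (rho : T -> R) (mrho : measurable_fun [set: T] rho) (C N : R).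
Context (C0 : 0 <= C) (mlt : forall r, 0 < r -> (m [set x | (rho x < r)%R] <= (C * r `^ N)%:E)%E).

(* On the layer rho ~ b^j the integrand is of size b^(j p) and the layer has
   measure at most of size b^(j N). *)
Lemma integral_layers_lty (b p : R) (S : set T) : measurable S -> 0 < b -> b `^ (p + N) < 1 ->
  (forall x, S x -> exists j, b ^+ j / 2 <= rho x < 2 * b ^+ j) ->
  (\int[m]_(x in S) (rho x `^ p)%:E < +oo)%E.
Proof.
move=> mS b0 q1 Sj.
pose a j := 2 `^ `|p| * (b ^+ j) `^ p.
pose A j := [set x | rho x < 2 * b ^+ j].
have bj j : 0 < b ^+ j by rewrite exprn_gt0.
have a0 j : 0 <= a j by rewrite mulr_ge0// powR_ge0.
have mA j : measurable (A j).
  rewrite (_ : A j = rho @^-1` `]-oo, 2 * b ^+ j[%classic).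
    by rewrite -[X in measurable X]setTI; exact: mrho.
  by apply/seteqP; split => x; rewrite /A /= in_itv.
have mf : measurable_fun S (fun x => (rho x `^ p)%:E).
  apply: measurable_funTS; apply/measurable_EFinP.
  exact: (measurableT_comp (measurable_powR p) mrho).
have mg j : measurable_fun S (fun x => ((a j)%:E * (\1_(A j) x)%:E)%E).
  by apply: measurable_funTS; apply/measurable_EFinP; apply: measurable_funM => //; exact: measurable_indic.
have g0 j x : (0 <= (a j)%:E * (\1_(A j) x)%:E)%E.
  by rewrite -EFinM lee_fin mulr_ge0// indicE ler0n.
apply: (@le_lt_trans _ _ (\int[m]_(x in S) \sum_(0 <= j <oo) ((a j)%:E * (\1_(A j) x)%:E))%E).
  apply: ge0_le_integral => //.
  - by move=> x _; rewrite lee_fin powR_ge0.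
  - by apply: ge0_emeasurable_sum => // j x _ _.
  move=> x Sx; have [j /andP[j1 j2]] := Sj x Sx.
  apply: le_trans (nneseries_term_le j (g0 ^~ x)).
  rewrite -EFinM lee_fin indicE mem_set// mulr1.
  by apply: dyadic_le_powR => //; rewrite j1 ltW.
rewrite integral_nneseries//.
apply: (@le_lt_trans _ _ (\sum_(0 <= j <oo) (2 `^ `|p| * C * 2 `^ N * (b `^ (p + N)) ^+ j)%:E)%E).
  apply: lee_nneseries => j _; first by move=> _; exact: integral_ge0.
  rewrite ge0_integralZl_EFin//; last first.
    by apply: measurable_funTS; apply/measurable_EFinP; exact: measurable_indic.
  rewrite integral_indic//.
  apply: (@le_trans _ _ ((a j)%:E * (C * (2 * b ^+ j) `^ N)%:E)%E).
    apply: lee_wpmul2l; first by rewrite lee_fin.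
    apply: le_trans (mlt _ ); last by rewrite mulr_gt0.
    by apply: le_measure; rewrite ?inE; [exact: measurableI|exact: mA|exact: subIsetl].
  rewrite -EFinM lee_fin powRM ?(ltW (bj j))// /a powRD; last by apply/implyP => _; rewrite gt_eqF.
  rewrite exprMn -!powR_mulrn ?powR_ge0 ?(ltW b0)// -!powRrM (mulrC j%:R p) (mulrC j%:R N).
  by rewrite le_eqVlt; apply/orP; left; apply/eqP; ring.
apply: le_lt_trans (nneseries_geometric_le _ _ q1) (ltry _).
  by rewrite !mulr_ge0 ?powR_ge0.
exact: powR_ge0.
Qed.

(** Layers of base 1/2 shrinking to 0: the ratio of the geometric series is 2^(-e). At infinity,
    layers of base 2 give the same ratio. *)
Lemma integral_powR_near0_lty (e : R) : 0 < e ->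
  (\int[m]_(x in [set x | (0 < rho x < 1)%R]) (rho x `^ (e - N))%:E < +oo)%E.
Proof.
move=> e0; apply: (@integral_layers_lty 2^-1).
- rewrite (_ : [set _ | _] = rho @^-1` `]0, 1[%classic).
    by rewrite -[X in measurable X]setTI; exact: mrho.
  by apply/seteqP; split => x; rewrite /= in_itv.
- by rewrite invr_gt0.
- rewrite subrK /powR gt_eqF ?invr_gt0// -[ltRHS]expR0 ltr_expR lnV ?posrE// pmulr_rlt0//.
  by rewrite oppr_lt0 ln_gt0// ltr1n.
move=> x /= /andP[x0 x1]; have [j /andP[j1 j2]] : exists j, 2 ^+ j <= (rho x)^-1 < 2 ^+ j.+1.
  by apply: exists_dyadic; rewrite invf_ge1// ltW.
exists j; rewrite exprVn; apply/andP; split.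
  by rewrite -invfM -exprSr -[leRHS]invrK lef_pV2 ?posrE ?exprn_gt0 ?invr_gt0// ltW.
rewrite (@le_lt_trans _ _ (2 ^- j))// ?ltr_pMl ?ltr1n ?invr_gt0 ?exprn_gt0//.
by rewrite -[leLHS]invrK lef_pV2 ?posrE ?exprn_gt0 ?invr_gt0.
Qed.

Lemma integral_powR_far_lty (e : R) : 0 < e ->
  (\int[m]_(x in [set x | (1 <= rho x)%R]) (rho x `^ (- e - N))%:E < +oo)%E.
Proof.
move=> e0; apply: (@integral_layers_lty 2).
- rewrite (_ : [set _ | _] = rho @^-1` `[1, +oo[%classic).
    by rewrite -[X in measurable X]setTI; exact: mrho.
  by apply/seteqP; split => x; rewrite /= in_itv /= andbT.
- by [].
- rewrite subrK /powR gt_eqF// -[ltRHS]expR0 ltr_expR mulNr oppr_lt0 mulr_gt0//.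
  by rewrite ln_gt0// ltr1n.
move=> x /= x1; have [j /andP[j1 j2]] := exists_dyadic x1.
exists j; rewrite -exprS j2 andbT; apply: le_trans j1.
by rewrite ler_pdivrMr// ler_peMr ?exprn_ge0// ler1n.
Qed.

End dyadic_layers.

Section enorm_theory.
Context (R : realType) (n : nat).
Implicit Types x y : 'rV[R]_n.

Lemma enorm_ge0 x : 0 <= enorm x.
Proof. exact: sqrtr_ge0. Qed.

Lemma enormZ a x : enorm (a *: x) = `|a| * enorm x.
Proof.
rewrite /enorm -sqrtr_sqr -sqrtrM ?sqr_ge0//; congr Num.sqrt.
by rewrite /dotv mulr_sumr; apply: eq_bigr => i _; rewrite mxE; ring.
Qed.

Lemma coord_le_enorm x i : `|x ord0 i| <= enorm x.
Proof.
rewrite -sqrtr_sqr ler_wsqrtr// /dotv (bigD1 i)//= -expr2 lerDl.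
by apply: sumr_ge0 => j _; rewrite -expr2 sqr_ge0.
Qed.

Lemma normr_le_enorm x : `|x| <= enorm x.
Proof.
have [x0|x0] := eqVneq (mx_norm x) 0; first by rewrite [leLHS]x0 enorm_ge0.
have [[i j] E] := mx_norm_neq0 x0; rewrite [leLHS]E /= (ord1 i); exact: coord_le_enorm.
Qed.

Lemma enorm_le x h : (forall i, `|x ord0 i| <= h) -> 0 <= h -> enorm x <= n%:R * h.
Proof.
move=> xh h0; have nh0 : 0 <= n%:R * h by rewrite mulr_ge0.
rewrite -[leRHS]ger0_norm// -sqrtr_sqr ler_wsqrtr//.
apply: (@le_trans _ _ (\sum_(i < n) h ^+ 2)).
  apply: ler_sum => i _; rewrite -expr2 -real_normK ?num_real//.
  by rewrite ler_sqr ?nnegrE.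
rewrite sumr_const card_ord exprMn -[leLHS]mulr_natl ler_wpM2r ?sqr_ge0//.
by rewrite -natrX ler_nat; case: (n) => // k; rewrite leq_pmulr.
Qed.

Lemma measurable_enorm : measurable_fun [set: 'rV[R]_n] (@enorm R n).
Proof.
have ms : measurable_fun [set: R] (@Num.sqrt R).
  by apply: continuous_measurable_fun => x; exact: sqrt_continuous.
apply: (measurableT_comp ms); rewrite /dotv; apply: measurable_sum => i.
by apply: measurable_funM; exact: measurable_rV_coord.
Qed.

Lemma lebesgue_rV_ball_le (r : R) : 0 < r ->
  (lebesgue_rV R n [set x | (enorm x < r)%R] <= (2 ^+ n * r `^ n%:R)%:E)%E.
Proof.
move=> r0; rewrite powR_mulrn ?(ltW r0)// -exprMn.
have E : forall i : 'I_n, lebesgue_measure (`[- r, r] : set R) = (2 * r)%:E.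
  move=> _; rewrite lebesgue_measure_itv/= lte_fin ifT; last by lra.
  by rewrite -EFinB; congr EFin; ring.
have mI : forall i : 'I_n, measurable (`[- r, r] : set R) by [].
rewrite -(lebesgue_rV_box mI E); apply: le_measure; rewrite ?inE.
- rewrite (_ : [set _ | _] = @enorm R n @^-1` `]-oo, r[%classic).
    by rewrite -[X in measurable X]setTI; exact: measurable_enorm.
  by apply/seteqP; split => x; rewrite /= in_itv.
- exact: (measurable_rV_box mI).
move=> x /= xr i; rewrite in_itv/= -ler_norml.
by rewrite (le_trans (coord_le_enorm x i))// ltW.
Qed.

End enorm_theory.

(** * Convolution with a nonnegative kernel *)

Section convolution.
Context (R : realType) (n : nat).
Local Notation mu := (lebesgue_rV R n).
Local Open Scope ereal_scope.

Lemma measurable_rV_sub : measurable_fun [set: 'rV[R]_n * 'rV[R]_n] (fun p => (p.1 - p.2)%R).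
Proof.
apply: measurable_fun_rVP => i.
rewrite (_ : _ \o _ = ((@rV_coord R n i \o fst) \- (@rV_coord R n i \o snd))%R); last first.
  by apply/funext => p; rewrite /rV_coord /= !mxE.
by apply: measurable_funB; apply: (measurableT_comp (@measurable_rV_coord R n i));
  [exact: measurable_fst|exact: measurable_snd].
Qed.

Context (a g : 'rV[R]_n -> \bar R).
Context (ma : measurable_fun [set: 'rV[R]_n] a) (mg : measurable_fun [set: 'rV[R]_n] g).
Context (a0 : forall x, 0 <= a x) (g0 : forall x, 0 <= g x).

(** Tonelli: for fixed x the integral of g (x - y) over y is that of g, by reflection and
    translation. With a built from u^2, this turns the form of an integrable kernel into its mass
    times an L^2 norm. *)
Lemma integral_conv1 :
  \int[mu \x mu]_p (a p.1 * g (p.1 - p.2)%R) = (\int[mu]_x a x) * (\int[mu]_x g x).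
Proof.
rewrite fubini_tonelli1 => [||p]; last by rewrite mule_ge0.
- rewrite /fubini_F /= -ge0_integralZr//; last exact: integral_ge0.
  apply: eq_integral => x _; rewrite ge0_integralZl//; last first.
    apply: (measurableT_comp mg).
    rewrite (_ : (fun y => _) = affine_rV x (-1)); first exact: measurable_affine_rV.
    by apply/funext => y; rewrite /affine_rV scaleN1r.
  rewrite (_ : \int[mu]_y g (x - y)%R = \int[mu]_y g (affine_rV x (-1) y)).
    by rewrite integral_rV_affine// ?oppr_eq0 ?oner_eq0// normrN1 expr1n invr1 mul1e.
  by apply: eq_integral => y _; rewrite /affine_rV scaleN1r.
- apply: emeasurable_funM; first exact: (measurableT_comp ma measurable_fst).
  exact: (measurableT_comp mg measurable_rV_sub).
Qed.

Lemma integral_conv2 :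
  \int[mu \x mu]_p (a p.2 * g (p.1 - p.2)%R) = (\int[mu]_x a x) * (\int[mu]_x g x).
Proof.
have mf : measurable_fun [set: 'rV[R]_n * 'rV[R]_n] (fun p => a p.2 * g (p.1 - p.2)%R).
  apply: emeasurable_funM; first exact: (measurableT_comp ma measurable_snd).
  exact: (measurableT_comp mg measurable_rV_sub).
rewrite fubini_tonelli1 => [||p]//; last by rewrite mule_ge0.
rewrite /fubini_F (fubini_tonelli (fun p : 'rV[R]_n * 'rV[R]_n => a p.2 * g (p.1 - p.2)%R))//=; last by move=> p; rewrite mule_ge0.
rewrite -ge0_integralZr//; last exact: integral_ge0.
apply: eq_integral => y _; rewrite ge0_integralZl//; last first.
  apply: (measurableT_comp mg).
  rewrite (_ : (fun x => _) = affine_rV (- y)%R 1); first exact: measurable_affine_rV.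
  by apply/funext => x; rewrite /affine_rV scale1r addrC.
rewrite (_ : \int[mu]_x g (x - y)%R = \int[mu]_x g (affine_rV (- y)%R 1 x)).
  by rewrite integral_rV_affine// ?oner_eq0// normr1 expr1n invr1 mul1e.
by apply: eq_integral => x _; rewrite /affine_rV scale1r addrC.
Qed.

End convolution.

(** * Square-integrable functions *)

Lemma cvg_of_summable_increments (R : realType) (w : nat -> R) :
  (\sum_(0 <= k <oo) `|w k.+1 - w k|%:E < +oo)%E -> cvgn w.
Proof.
move=> wy; have H : cvgn [normed series (telescope w)].
  apply: nondecreasing_is_cvgn; first by apply: nondecreasing_series => *; exact: normr_ge0.
  exists (fine (\sum_(0 <= k <oo) `|w k.+1 - w k|%:E)) => _ [k _ <-].
  rewrite -lee_fin fineK; last first.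
    by rewrite ge0_fin_numE//; apply: nneseries_ge0 => j _ _; rewrite lee_fin.
  rewrite /series /= -sumEFin.
  by apply: (nneseries_lim_ge (u_ := fun j => `|w j.+1 - w j|%:E)) => j _ _; rewrite lee_fin.
have := normed_cvg H; rewrite telescopeK => H1.
have -> : w = (fun k => (w k - w 0%N) + w 0%N) by apply/funext => k; rewrite subrK.
by apply: is_cvgD => //; exact: is_cvg_cst.
Qed.

Section square_integrable.
Context d (T : measurableType d) (R : realType) (m : {measure set T -> \bar R}).
Implicit Types f g h : T -> R.

Definition L2 f := measurable_fun [set: T] f /\ (\int[m]_x (f x ^+ 2)%:E < +oo)%E.

(** Meaningful on [L2], where the integral is finite ([EFin_ip]); an infinite integral is read as
    0. *)
Definition ip f g : R := fine (\int[m]_x (f x * g x)%:E)%E.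

Lemma L2_integrable_sqr f : L2 f -> m.-integrable [set: T] (fun x => (f x ^+ 2)%:E).
Proof.
move=> [mf fy]; apply/integrableP; split; first exact/measurable_EFinP/measurable_funX.
by under eq_integral do rewrite abse_EFin ger0_norm ?sqr_ge0//.
Qed.

Lemma L2_integrable_mul f g : L2 f -> L2 g -> m.-integrable [set: T] (fun x => (f x * g x)%:E).
Proof.
move=> Lf Lg; have [mf _] := Lf; have [mg _] := Lg.
apply: (@le_integrable _ _ _ _ _ _ _ (fun x => ((f x ^+ 2)%:E + (g x ^+ 2)%:E)%E)) => //.
- exact/measurable_EFinP/measurable_funM.
- move=> x _; rewrite -EFinD !abse_EFin lee_fin [leRHS]ger0_norm ?addr_ge0 ?sqr_ge0//.
  rewrite normrM -(real_normK (num_real (f x))) -(real_normK (num_real (g x))).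
  have := sqr_ge0 (`|f x| - `|g x|); have := mulr_ge0 (normr_ge0 (f x)) (normr_ge0 (g x)).
  by rewrite sqrrB; lra.
- by apply: integrableD => //; exact: L2_integrable_sqr.
Qed.

Lemma EFin_ip f g : L2 f -> L2 g -> (\int[m]_x (f x * g x)%:E = (ip f g)%:E)%E.
Proof.
by move=> Lf Lg; rewrite /ip fineK//; apply: integrable_fin_num => //; exact: L2_integrable_mul.
Qed.

Lemma EFin_ip_sqr f : L2 f -> (\int[m]_x (f x ^+ 2)%:E = (ip f f)%:E)%E.
Proof. by move=> Lf; rewrite -EFin_ip//; under eq_integral do rewrite expr2. Qed.

Lemma ipC f g : ip f g = ip g f.
Proof. by rewrite /ip; congr fine; apply: eq_integral => x _; rewrite mulrC. Qed.

Lemma ip_ge0 f : 0 <= ip f f.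
Proof. by apply/fine_ge0/integral_ge0 => x _; rewrite lee_fin -expr2 sqr_ge0. Qed.

Lemma L2_lin a f g : L2 f -> L2 g -> L2 (fun x => a * f x + g x).
Proof.
move=> Lf Lg; have [mf _] := Lf; have [mg _] := Lg.
have mafg : measurable_fun [set: T] (fun x => a * f x + g x).
  by apply: measurable_funD => //; apply: measurable_funM.
split=> //.
have -> : (\int[m]_x ((a * f x + g x) ^+ 2)%:E =
  \int[m]_x (((a ^+ 2)%:E * (f x ^+ 2)%:E + (2 * a)%:E * (f x * g x)%:E) + (g x ^+ 2)%:E))%E.
  by apply: eq_integral => x _; rewrite -!EFinM -!EFinD; congr EFin; ring.
have i1 := integrableZl measurableT (a ^+ 2) (L2_integrable_sqr Lf).
have i2 := integrableZl measurableT (2 * a) (L2_integrable_mul Lf Lg).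
apply: integrable_lty => //; apply: integrableD => //; last exact: L2_integrable_sqr.
exact: integrableD.
Qed.

Lemma L2_0 : L2 (fun=> 0).
Proof. by split; rewrite // expr0n/= integral0. Qed.

Lemma ip_lin a f g h : L2 f -> L2 g -> L2 h ->
  ip (fun x => a * f x + g x) h = a * ip f h + ip g h.
Proof.
move=> Lf Lg Lh; apply: EFin_inj.
rewrite -EFin_ip//; last exact: L2_lin.
rewrite EFinD EFinM -!EFin_ip// -integralZl//; last exact: L2_integrable_mul.
rewrite -integralD//; last 2 first.
- by apply: integrableZl => //; exact: L2_integrable_mul.
- exact: L2_integrable_mul.
by apply: eq_integral => x _; rewrite -!EFinM -EFinD; congr EFin; ring.
Qed.

Lemma L2_le f g : measurable_fun [set: T] f -> L2 g ->
  {ae m, forall x, `|f x| <= `|g x|} -> L2 f /\ ip f f <= ip g g.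
Proof.
move=> mf Lg fg; have [mg gy] := Lg.
have le : (\int[m]_x (f x ^+ 2)%:E <= \int[m]_x (g x ^+ 2)%:E)%E.
  apply: ae_ge0_le_integral => //.
  - by move=> x _; rewrite lee_fin sqr_ge0.
  - exact/measurable_EFinP/measurable_funX.
  - by move=> x _; rewrite lee_fin sqr_ge0.
  - exact/measurable_EFinP/measurable_funX.
  apply: filterS fg => x fg _; rewrite lee_fin.
  by rewrite -(real_normK (num_real (f x))) -(real_normK (num_real (g x))) ler_sqr ?nnegrE.
have Lf : L2 f by split=> //; exact: le_lt_trans le gy.
by split=> //; rewrite -lee_fin -!EFin_ip_sqr.
Qed.

Lemma ip_ae_eq f f' g g' : measurable_fun [set: T] f -> measurable_fun [set: T] f' ->
  measurable_fun [set: T] g -> measurable_fun [set: T] g' ->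
  {ae m, forall x, f x = f' x} -> {ae m, forall x, g x = g' x} -> ip f g = ip f' g'.
Proof.
move=> mf mf' mg mg' ff' gg'; congr fine; apply: ae_eq_integral => //.
- exact/measurable_EFinP/measurable_funM.
- exact/measurable_EFinP/measurable_funM.
by apply: filterS2 ff' gg' => x -> -> _.
Qed.

Lemma ip_eq0 f : L2 f -> ip f f = 0 -> {ae m, forall x, f x = 0}.
Proof.
move=> Lf f0; have [mf _] := Lf.
have := EFin_ip_sqr Lf; rewrite f0 => H.
have mf2 : measurable_fun [set: T] (fun x => (f x ^+ 2)%:E) by exact/measurable_EFinP/measurable_funX.
have : (\int[m]_x `|(f x ^+ 2)%:E| = 0)%E.
  by under eq_integral do rewrite abse_EFin ger0_norm ?sqr_ge0//.
move/(ae_eq_integral_abs m measurableT mf2); apply: filterS => x /(_ I) [] /eqP.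
by rewrite sqrf_eq0 => /eqP.
Qed.

Lemma fatou_ip (f : nat -> T -> R) g M : (forall k, L2 (f k)) -> measurable_fun [set: T] g ->
  {ae m, forall x, f k x @[k --> \oo] --> g x} ->
  (\forall k \near \oo, ip (f k) (f k) <= M) -> L2 g /\ ip g g <= M.
Proof.
move=> Lf mg fg fM.
have mf2 k : measurable_fun [set: T] (fun x => (f k x ^+ 2)%:E).
  by apply/measurable_EFinP/measurable_funX; case: (Lf k).
have le : (\int[m]_x (g x ^+ 2)%:E <= M%:E)%E.
  apply: (@le_trans _ _ (\int[m]_x limn_einf (fun k => (f k x ^+ 2)%:E))%E).
    apply: ae_ge0_le_integral => //.
    - by move=> x _; rewrite lee_fin sqr_ge0.
    - exact/measurable_EFinP/measurable_funX.
    - move=> x _; rewrite limn_einf_lim; apply: lime_ge; first exact: is_cvg_einfs.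
      by apply: nearW => k; apply: le_ereal_inf_tmp => _ [j /= _ <-]; rewrite lee_fin sqr_ge0.
    - apply: (@measurableT_comp _ _ _ _ _ _ oppe _ (fun x => limn_esup (fun k => - (f k x ^+ 2)%:E)%E)) => //.
      apply: (measurable_fun_limn_esup (f := fun k x => (- (f k x ^+ 2)%:E)%E)) => k.
      exact: (@measurableT_comp _ _ _ _ _ _ oppe _ (fun x => (f k x ^+ 2)%:E)).
    apply: filterS fg => x fgx _.
    have cv : (f k x ^+ 2)%:E @[k --> \oo] --> (g x ^+ 2)%:E.
      apply: cvg_EFin; first exact: nearW.
      rewrite (_ : _ \o _ = fun k => f k x * f k x); last by apply/funext => k; rewrite /= expr2.
      by rewrite expr2; apply: cvgM.
    by rewrite is_cvg_limn_einfE ?(cvg_lim _ cv)//; apply/cvg_ex; exists (g x ^+ 2)%:E.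
  have f20 k x : [set: T] x -> (0 <= (f k x ^+ 2)%:E)%E by rewrite lee_fin sqr_ge0.
  have /le_trans := fatou m measurableT mf2 f20; apply.
  rewrite limn_einf_lim; apply: lime_le; first exact: is_cvg_einfs.
  move: fM => [N _ /= NP]; near=> k.
  apply: (@le_trans _ _ (ip (f (maxn k N)) (f (maxn k N)))%:E).
    rewrite -EFin_ip_sqr//; apply: ereal_inf_lbound; exists (maxn k N) => //=.
    exact: leq_maxl.
  by rewrite lee_fin NP//= leq_maxr.
have Lg : L2 g by split=> //; exact: le_lt_trans le (ltry _).
by split=> //; rewrite -lee_fin -EFin_ip_sqr.
Unshelve. all: end_near. Qed.

(** The a.e. half of the Riesz-Fischer theorem. Along f the squared norms of the increments are
    below 4^(-k); on a set of finite measure their L^1 norms are then summable, so almost everywhere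
    the increments sum absolutely. The limit v vanishes at every point outside Om, not only almost
    everywhere. *)
Lemma L2_cauchy_cvg (Om : set T) (u : nat -> T -> R) : measurable Om -> (m Om < +oo)%E ->
  (forall k, L2 (u k)) -> (forall k, {ae m, forall x, ~ Om x -> u k x = 0}) ->
  (forall eps : R, 0 < eps -> exists N, forall i j, (N <= i)%N -> (N <= j)%N ->
     ip (fun x => u i x - u j x) (fun x => u i x - u j x) < eps) ->
  exists (v : T -> R) (f : nat -> nat), [/\ measurable_fun [set: T] v,
    forall x, ~ Om x -> v x = 0, forall k, (k <= f k)%N &
    {ae m, forall x, u (f k) x @[k --> \oo] --> v x}].
Proof.
move=> mOm Omy Lu u0 cau.
have /choice[N NP] k : exists N, forall i j, (N <= i)%N -> (N <= j)%N ->
     ip (fun x => u i x - u j x) (fun x => u i x - u j x) < 4^-1 ^+ k.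
  by apply: cau; rewrite exprn_gt0.
(* The sum dominates N 0, ..., N k, so consecutive values f k and f (k + 1) both lie beyond N k. *)
pose f k := (\sum_(j < k.+1) N j + k)%N.
have fk k : (k <= f k)%N by rewrite leq_addl.
have fN j k : (j <= k)%N -> (N j <= f k)%N.
  move=> jk; rewrite /f (bigD1 (Ordinal (jk : (j < k.+1)%N)))//= -!addnA leq_addr//.
have mu_ k : measurable_fun [set: T] (u k) by case: (Lu k).
pose dd k x := u (f k.+1) x - u (f k) x.
have Ldd k : L2 (dd k).
  rewrite (_ : dd k = fun x => -1 * u (f k) x + u (f k.+1) x); first exact: L2_lin.
  by apply/funext => x; rewrite /dd mulN1r addrC.
have mdd k : measurable_fun [set: T] (fun x => `|dd k x|%:E).
  by apply/measurable_EFinP/measurableT_comp => //; case: (Ldd k).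
have dd0 k x : (0 <= `|dd k x|%:E)%E by rewrite lee_fin.
pose c := fine (m Om).
have cE : m Om = c%:E by rewrite /c fineK// ge0_fin_numE.
have c0 : 0 <= c by rewrite fine_ge0.
have int_dd k : (\int[m]_(x in Om) `|dd k x|%:E <= ((1 + c) * 2^-1 ^+ k)%:E)%E.
  (* Pointwise a <= 2^k a^2 + 2^(-k); the first term integrates to at most 2^k 4^(-k), the second to
     c 2^(-k). *)
  apply: (@le_trans _ _ (\int[m]_(x in Om) ((2 ^+ k)%:E * (dd k x ^+ 2)%:E + (2^-1 ^+ k)%:E))%E).
    apply: ge0_le_integral => //.
    - by apply: measurable_funTS; exact: mdd.
    - apply: measurable_funTS; apply/measurable_EFinP; apply: measurable_funD => //.
      by apply: measurable_funM => //; apply: measurable_funX; case: (Ldd k).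
    move=> x _; rewrite -EFinM -EFinD lee_fin -(real_normK (num_real (dd k x))).
    have k2 : 0 < (2 : R) ^+ k by rewrite exprn_gt0.
    set a := `|_|; rewrite exprVn.
    have : 0 <= 2 ^+ k * (a - (2 ^+ k)^-1 / 2) ^+ 2 by rewrite mulr_ge0 ?sqr_ge0// ltW.
    have -> : 2 ^+ k * (a - (2 ^+ k)^-1 / 2) ^+ 2 = 2 ^+ k * a ^+ 2 - a + (2 ^+ k)^-1 / 4.
      by field; rewrite gt_eqF.
    have : 0 < ((2 : R) ^+ k)^-1 by rewrite invr_gt0.
    lra.
  rewrite ge0_integralD//; last 2 first.
  - by move=> x _; rewrite -EFinM lee_fin mulr_ge0 ?sqr_ge0// exprn_ge0.
  - apply: measurable_funTS; apply/measurable_EFinP.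
    by apply: measurable_funM => //; apply: measurable_funX; case: (Ldd k).
  rewrite ge0_integralZl_EFin//; last 2 first.
  - by move=> x _; rewrite lee_fin sqr_ge0.
  - apply: measurable_funTS; apply/measurable_EFinP.
    by apply: measurable_funX; case: (Ldd k).
  rewrite (_ : (fun=> (2^-1 ^+ k)%:E) = cst (2^-1 ^+ k)%:E)// integral_cst// cE.
  rewrite mulrDl EFinD; apply: leeD; last by rewrite -EFinM mulrC.
  apply: (@le_trans _ _ ((2 ^+ k)%:E * (4^-1 ^+ k)%:E)%E).
    apply: lee_wpmul2l; first by rewrite lee_fin exprn_ge0.
    apply: (@le_trans _ _ (\int[m]_x (dd k x ^+ 2)%:E)%E).
      apply: ge0_subset_integral => //.
      by apply/measurable_EFinP; apply: measurable_funX; case: (Ldd k).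
      by move=> x _; rewrite lee_fin sqr_ge0.
    rewrite EFin_ip_sqr// lee_fin; apply/ltW/NP; apply: fN => //.
  rewrite -EFinM lee_fin mul1r -exprMn (_ : 2 * 4^-1 = 2^-1)//; by field.
pose S x := (\sum_(0 <= k <oo) `|dd k x|%:E)%E.
have mS : measurable_fun Om S.
  by apply: ge0_emeasurable_sum => // k _; apply: measurable_funTS; exact: mdd.
have S0 x : (0 <= S x)%E by apply: nneseries_ge0.
have intS : (\int[m]_(x in Om) S x < +oo)%E.
  rewrite integral_nneseries//; last by move=> k; apply: measurable_funTS.
  apply: (@le_lt_trans _ _ (\sum_(0 <= k <oo) ((1 + c) * 2^-1 ^+ k)%:E)%E).
    by apply: lee_nneseries => [k _ _|k _]; [exact: integral_ge0|exact: int_dd].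
  apply: le_lt_trans (nneseries_geometric_le _ _ _) (ltry _); rewrite ?addr_ge0//.
  by rewrite invf_lt1// ltr1n.
have iS : m.-integrable Om S.
  apply/integrableP; split => //.
  by under eq_integral do rewrite gee0_abs//.
have aeS := integrable_ae mOm iS.
pose G := Om `&` [set x | (S x < +oo)%E].
have mG : measurable G by exact: emeasurable_fun_infty_o.
have Gcvg x : G x -> cvgn (fun k => u (f k) x).
  by move=> [_ Sx]; exact: (@cvg_of_summable_increments R (fun k => u (f k) x)).
pose v := (fun x => limn (fun k => u (f k) x)) \_ G.
exists v, f; split => //.
- apply: (measurable_fun_cvg (h := fun k => (u (f k)) \_ G)) => [k|x _].
    by apply/(measurable_restrictT _ mG); apply: measurable_funTS; exact: mu_.
  rewrite /v /patch; case: ifPn => xG; last exact: cvg_cst.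
  by rewrite inE in xG; exact: Gcvg.
- by move=> x Omx; rewrite /v /patch memNset// => -[].
have := ae_foralln u0.
apply: filterS2 aeS => x Sx ux.
have [Omx|Omx] := pselect (Om x).
  have Gx : G x by split => //=; rewrite -ge0_fin_numE//; exact: Sx.
  by rewrite /v /patch mem_set//; exact: Gcvg.
rewrite /v /patch memNset; last by case.
rewrite (_ : (fun k => _) = cst 0); first exact: cvg_cst.
by apply/funext => k; rewrite ux.
Qed.

Lemma L2_sub f g : L2 f -> L2 g -> L2 (fun x => f x - g x).
Proof.
move=> Lf Lg; rewrite (_ : (fun x => _) = fun x => -1 * g x + f x); first exact: L2_lin.
by apply/funext => x; rewrite mulN1r addrC.
Qed.

(** Fatou's lemma applied to u i - u (f k) as k grows: the Cauchy bound passes to the a.e. limit of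
    the subsequence. Applied to functions on R^n and to their lifts on R^n x R^n. *)
Lemma L2_ae_limit (u : nat -> T -> R) (v : T -> R) (f : nat -> nat) :
  (forall k, L2 (u k)) -> measurable_fun [set: T] v -> (forall k, (k <= f k)%N) ->
  {ae m, forall x, u (f k) x @[k --> \oo] --> v x} ->
  (forall eps : R, 0 < eps -> exists N, forall i j, (N <= i)%N -> (N <= j)%N ->
     ip (fun x => u i x - u j x) (fun x => u i x - u j x) < eps) ->
  L2 v /\ forall eps : R, 0 < eps -> exists N, forall i, (N <= i)%N ->
     ip (fun x => u i x - v x) (fun x => u i x - v x) <= eps.
Proof.
move=> Lu mv fk uv cau.
have key eps : 0 < eps -> exists N, forall i, (N <= i)%N ->
    L2 (fun x => u i x - v x) /\ ip (fun x => u i x - v x) (fun x => u i x - v x) <= eps.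
  move=> /cau[N NP]; exists N => i Ni.
  apply: (fatou_ip (f := fun k x => u i x - u (f k) x)).
  - by move=> k; exact: L2_sub.
  - by apply: measurable_funB => //; case: (Lu i).
  - by apply: filterS uv => x uvx; apply: cvgB => //; exact: cvg_cst.
  by exists N => // k /= Nk; rewrite ltW// NP// (leq_trans Nk).
split; last by move=> eps /key[N NP]; exists N => i /NP[].
have [N NP] := key 1 ltr01; have [H _] := NP N (leqnn N).
rewrite (_ : v = fun x => u N x - (u N x - v x)); first exact: L2_sub.
by apply/funext => x; rewrite subKr.
Qed.

End square_integrable.

Section radial_integrability.
Context (R : realType) (n : nat).
Local Notation mu := (lebesgue_rV R n).
Implicit Types (g : 'rV[R]_n -> R).

(** The power bounds concern 0 < |z| < 1 and 1 <= |z|; the origin is in neither range, and there g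
    is assumed to vanish. *)
Lemma radial_integral_lty g (C1 C2 e1 e2 : R) : measurable_fun [set: 'rV[R]_n] g ->
  (forall z, 0 <= g z) -> 0 < e1 -> 0 < e2 -> 0 <= C1 -> 0 <= C2 ->
  (forall z, enorm z = 0 -> g z = 0) ->
  (forall z, 0 < enorm z < 1 -> g z <= C1 * enorm z `^ (e1 - n%:R)) ->
  (forall z, 1 <= enorm z -> g z <= C2 * enorm z `^ (- e2 - n%:R)) ->
  (\int[mu]_z (g z)%:E < +oo)%E.
Proof.
move=> mg g0 e10 e20 C10 C20 gz gnear gfar.
have mI (i : interval R) : measurable [set z : 'rV[R]_n | enorm z \in i].
  rewrite (_ : [set _ | _] = @enorm R n @^-1` [set` i])//.
  by rewrite -[X in measurable X]setTI; exact: measurable_enorm.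
pose N0 := [set z : 'rV[R]_n | enorm z \in `]0, 1[].
pose N1 := [set z : 'rV[R]_n | enorm z \in `[1, +oo[].
have mgE : measurable_fun [set: 'rV[R]_n] (EFin \o g) by exact/measurable_EFinP.
have mpR p : measurable_fun [set: 'rV[R]_n] (fun z => enorm z `^ p).
  exact: (measurableT_comp (measurable_powR p) (@measurable_enorm R n)).
have mp p : measurable_fun [set: 'rV[R]_n] (fun z => (enorm z `^ p)%:E) by exact/measurable_EFinP.
have sub : (\int[mu]_z (g z)%:E = \int[mu]_(z in N0 `|` N1) (g z)%:E)%E.
  rewrite [RHS]integral_mkcond; apply: eq_integral => z _; rewrite /patch.
  case: ifPn => //; rewrite notin_setE /N0 /N1 /= !in_itv /= andbT => H.
  rewrite gz//; apply/eqP; apply/contraT => z0.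
  exfalso; apply: H; have [z1|z1] := ltP (enorm z) 1; last by right.
  by left; rewrite lt0r z0 enorm_ge0.
have m01 : measurable (N0 `|` N1) by apply: measurableU; exact: mI.
rewrite sub ge0_integral_setU//=; last 5 first.
- exact: mI.
- exact: mI.
- exact: measurable_funTS.
- by move=> z _; rewrite lee_fin.
- by apply/disj_setPS => z; rewrite /N0 /N1 /= !in_itv/= andbT => -[/andP[_ z1]]; rewrite leNgt z1.
apply: lte_add_pinfty.
- apply: (@le_lt_trans _ _ (\int[mu]_(z in N0) (C1%:E * (enorm z `^ (e1 - n%:R))%:E))%E).
    apply: ge0_le_integral => //.
    + exact: mI.
    + by move=> z _; rewrite lee_fin.
    + by apply: measurable_funTS; exact: mgE.
    + apply: measurable_funTS; apply/measurable_EFinP; exact: measurable_funM.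
  rewrite ge0_integralZl_EFin//; last 3 first.
  - exact: mI.
  - by move=> z _; rewrite lee_fin powR_ge0.
  - by apply: measurable_funTS; exact: (mp (e1 - n%:R)).
  rewrite lte_mul_pinfty//.
  rewrite (_ : N0 = [set z | 0 < enorm z < 1]); last by apply/seteqP; split => z; rewrite /N0/= in_itv.
  have c0 : 0 <= (2 : R) ^+ n by rewrite exprn_ge0.
  exact: (integral_powR_near0_lty (@measurable_enorm R n) c0 (@lebesgue_rV_ball_le R n)).
- apply: (@le_lt_trans _ _ (\int[mu]_(z in N1) (C2%:E * (enorm z `^ (- e2 - n%:R))%:E))%E).
    apply: ge0_le_integral => //.
    + exact: mI.
    + by move=> z _; rewrite lee_fin.
    + by apply: measurable_funTS; exact: mgE.
    + apply: measurable_funTS; apply/measurable_EFinP; exact: measurable_funM.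
    + by move=> z /andP[z1 _]; rewrite -EFinM lee_fin; exact: gfar.
  rewrite ge0_integralZl_EFin//; last 3 first.
  - exact: mI.
  - by move=> z _; rewrite lee_fin powR_ge0.
  - by apply: measurable_funTS; exact: (mp (- e2 - n%:R)).
  rewrite lte_mul_pinfty//.
  rewrite (_ : N1 = [set z | 1 <= enorm z]); last by apply/seteqP; split => z; rewrite /N1/= in_itv/= andbT.
  have c0 : 0 <= (2 : R) ^+ n by rewrite exprn_ge0.
  exact: (integral_powR_far_lty (@measurable_enorm R n) c0 (@lebesgue_rV_ball_le R n)).
Qed.

End radial_integrability.

(** This is 1 + x <= exp x at x = e ln t. It trades each logarithm in a kernel for an arbitrarily
    small power. *)
Lemma ln_le_powR (R : realType) (t e : R) : 0 < t -> 0 < e -> ln t <= t `^ e / e.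
Proof.
move=> t0 e0; rewrite ler_pdivlMr// mulrC /powR gt_eqF//.
by apply: le_trans (expR_ge1Dx _); rewrite lerDr.
Qed.

(** * Positivity of the normalizing constant *)

Lemma pos_integral_gt0 d (T : measurableType d) (R : realType) (m : {measure set T -> \bar R})
  (D : set T) (f : T -> \bar R) : measurable D -> (0 < m D)%E -> measurable_fun D f ->
  (forall x, D x -> (0 < f x)%E) -> (0 < \int[m]_(x in D) f x)%E.
Proof.
move=> mD mD0 mf f0; rewrite lt0e integral_ge0 ?andbT; last by move=> x Dx; exact/ltW/f0.
apply/eqP => I0.
have : (\int[m]_(x in D) `|f x| = 0)%E.
  rewrite -I0; apply: eq_integral => x; rewrite inE => Dx.
  by rewrite gee0_abs//; exact/ltW/f0.
move/(ae_eq_integral_abs m mD mf) => ae.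
suff : m.-negligible D by move=> /negligibleP -/(_ mD) H; rewrite H ltxx in mD0.
move: ae; rewrite /ae_eq /almost_everywhere /=; apply: negligibleS => x Dx /= H.
by have := f0 x Dx; rewrite (H Dx) ltxx.
Qed.

Section Gamma_pos.
Context (R : realType).
Local Notation mu := (@lebesgue_measure R).
Local Notation I01 := (`]0, 1[%classic : set R).
Local Notation I1oo := (`[1, +oo[%classic : set R).
Local Notation Roo := (`]0, +oo[%classic : set R).

Lemma powR_le_expR (p t : R) : 0 < p -> 0 < t -> t `^ p <= p `^ p * expR t.
Proof.
move=> p0 t0; rewrite /powR !gt_eqF// -expRD ler_expR.
have : ln (t / p) <= t / p by have := ln_le_powR (divr_gt0 t0 p0) ltr01; rewrite powRr1 ?divr1// divr_ge0 ?ltW.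
rewrite ln_div ?posrE// lerBlDr -(ler_pM2l p0) mulrDr mulrC mulrCA divff ?gt_eqF// mulr1 mulrC.
by rewrite addrC.
Qed.

(** [Gamma] is a real-valued integral and would be 0 if the integral diverged, so its positivity
    depends on this finiteness. *)
Lemma Gamma_integral_lty (x : R) : 0 < x ->
  (\int[mu]_(t in Roo) (t `^ (x - 1) * expR (- t))%:E < +oo)%E.
Proof.
move=> x0.
have C0 : (0 : R) <= 2 by [].
have mr : measurable_fun [set: measurableTypeR R] (fun t : measurableTypeR R => `|t|).
  exact: normr_measurable.
have mball r : 0 < r -> (mu [set t : measurableTypeR R | (`|t| < r)%R] <= (2 * r `^ 1)%:E)%E.
  move=> r0; rewrite powRr1 ?(ltW r0)//.
  rewrite (_ : [set t | _] = `]- r, r[%classic); last first.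
    by apply/seteqP; split => t; rewrite /= in_itv/= ltr_norml.
  rewrite lebesgue_measure_itv/= lte_fin; case: ifP => _; last by rewrite lee_fin mulr_ge0// ltW.
  by rewrite -EFinB lee_fin; lra.
have near := integral_powR_near0_lty mr C0 mball x0.
have far := integral_powR_far_lty mr C0 mball (ltr01 : 0 < 1 :> R).
have mf : measurable_fun [set: R] (fun t : R => (t `^ (x - 1) * expR (- t))%:E).
  apply/measurable_EFinP; apply: measurable_funM; first exact: measurable_powR.
  by apply: (measurableT_comp (@measurable_expR R)); exact: oppr_measurable.
have mp p : measurable_fun [set: R] (fun t : R => (`|t| `^ p)%:E).
  by apply/measurable_EFinP; exact: (measurableT_comp (measurable_powR p) mr).
have f0 (t : R) : (0 <= (t `^ (x - 1) * expR (- t))%:E)%E.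
  by rewrite lee_fin mulr_ge0 ?powR_ge0 ?expR_ge0.
have RooE : Roo = I01 `|` I1oo.
  apply/seteqP; split => t; rewrite /= !in_itv/= !andbT.
    by move=> t0; have [t1|t1] := ltP t 1; [left|right] => //; rewrite t0.
  by move=> [/andP[]//|]; apply: lt_le_trans.
rewrite RooE ge0_integral_setU//=; last 2 first.
- by apply: measurable_funTS.
- by apply/disj_setPS => t; rewrite /= !in_itv/= andbT => -[/andP[_ t1]]; rewrite leNgt t1.
have mset (a : itv_bound R) (b : itv_bound R) : measurable [set t : measurableTypeR R | `|t| \in Interval a b].
  by have := mr measurableT _ (measurable_itv (Interval a b)); rewrite setTI.
apply: lte_add_pinfty.
- have near' : (\int[mu]_(t in I01) (`|t| `^ (x - 1))%:E < +oo)%E.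
    apply: le_lt_trans near; apply: ge0_subset_integral => //.
    + by have := mset (BRight 0) (BLeft 1); congr measurable; apply/seteqP; split => t; rewrite /= in_itv.
    + by apply: measurable_funTS; exact: (mp (x - 1)).
    by move=> t; rewrite /= in_itv/= => /andP[t0 t1]; rewrite gtr0_norm// t0.
  apply: le_lt_trans near'; apply: ge0_le_integral => //.
  + by apply: measurable_funTS; exact: mf.
  + by apply: measurable_funTS; exact: (mp (x - 1)).
  move=> t; rewrite /= in_itv/= => /andP[t0 t1]; rewrite lee_fin gtr0_norm//.
  by rewrite ler_piMr ?powR_ge0// -[leRHS]expR0 ler_expR oppr_le0 ltW.
(* From t^(x + 1) <= K e^t: the integrand t^(x + 1) t^(-2) e^(-t) is at most K t^(-2). *)
- pose K := (x + 1) `^ (x + 1).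
  have K0 : 0 <= K by exact: powR_ge0.
  have x10 : 0 < x + 1 by rewrite addr_gt0.
  have far' : (\int[mu]_(t in I1oo) (`|t| `^ (- 1 - 1))%:E < +oo)%E.
    apply: le_lt_trans far; apply: ge0_subset_integral => //.
    + by have := mset (BLeft 1) +oo%O; congr measurable; apply/seteqP; split => t; rewrite /= in_itv/= andbT.
    + by apply: measurable_funTS; exact: (mp (- 1 - 1)).
    by move=> t; rewrite /= in_itv/= andbT => t1; rewrite ger0_norm// (le_trans _ t1).
  have Kfar : (\int[mu]_(t in I1oo) (K%:E * (`|t| `^ (- 1 - 1))%:E) < +oo)%E.
    rewrite ge0_integralZl_EFin//; last by apply: measurable_funTS; exact: (mp (- 1 - 1)).
    by rewrite lte_mul_pinfty.
  apply: le_lt_trans Kfar; apply: ge0_le_integral => //.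
  + by apply: measurable_funTS; exact: mf.
  + by apply: measurable_funTS; exact: (measurable_funeM _ (mp (- 1 - 1))).
  move=> t; rewrite /= in_itv/= andbT => t1; have t0 : 0 < t by apply: lt_le_trans t1.
  rewrite -EFinM lee_fin gtr0_norm// expRN ler_pdivrMr ?expR_gt0//.
  have -> : x - 1 = (x + 1) + (- 1 - 1) by ring.
  rewrite powRD; last by apply/implyP => _; rewrite gt_eqF.
  by rewrite mulrAC ler_wpM2r ?powR_ge0// powR_le_expR.
Qed.

Lemma Gamma_gt0 (x : R) : 0 < x -> 0 < Gamma x.
Proof.
move=> x0; apply: fine_gt0; rewrite Gamma_integral_lty// andbT.
have D0 : (0 < mu Roo)%E by rewrite lebesgue_measure_itv/= ltry sube0 ltry.
have mf : measurable_fun [set: R] (fun t : R => (t `^ (x - 1) * expR (- t))%:E).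
  apply/measurable_EFinP; apply: measurable_funM; first exact: measurable_powR.
  by apply: (measurableT_comp (@measurable_expR R)); exact: oppr_measurable.
apply: (pos_integral_gt0 _ D0) => //; first by apply: measurable_funTS; exact: mf.
by move=> t; rewrite /= in_itv/= andbT => t0; rewrite lte_fin mulr_gt0 ?powR_gt0 ?expR_gt0.
Qed.

End Gamma_pos.

Lemma c_ns_gt0 (R : realType) n (s : R) : 0 < s < 1 -> 0 < c_ns n s.
Proof.
move=> /andP[s0 s1]; rewrite /c_ns !mulr_gt0 ?powR_gt0 ?pi_gt0//.
- by rewrite Gamma_gt0// divr_gt0// ltr_wpDl// mulr_gt0.
- by rewrite invr_gt0 Gamma_gt0// subr_gt0.
Qed.

(** * Kernels and the form domain *)

Section lift.
Context (R : realType) (n : nat).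
Local Notation mu := (lebesgue_rV R n).
Local Notation mu2 := (mu \x mu)%E.
Implicit Types (k g h u w : 'rV[R]_n -> R).

(* The form of a nonnegative kernel is an L^2 inner product on R^n x R^n. *)
Definition lift k u (p : 'rV[R]_n * 'rV[R]_n) : R :=
  (u p.1 - u p.2) * Num.sqrt (k (p.1 - p.2)).

Lemma lift_lin k a u w :
  lift k (fun x => a * u x + w x) = (fun p => a * lift k u p + lift k w p).
Proof. by apply/funext => p; rewrite /lift; ring. Qed.

Lemma liftB k u w : lift k (fun x => u x - w x) = (fun p => lift k u p - lift k w p).
Proof. by apply/funext => p; rewrite /lift; ring. Qed.

Lemma lift_mul k u w p : 0 <= k (p.1 - p.2) ->
  lift k u p * lift k w p = (u p.1 - u p.2) * (w p.1 - w p.2) * k (p.1 - p.2).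
Proof. by move=> k0; rewrite /lift mulrACA -expr2 sqr_sqrtr. Qed.

Lemma kernel_formE k u w : (forall z, 0 <= k z) ->
  kernel_form k u w = (\int[mu2]_p (lift k u p * lift k w p)%:E)%E.
Proof. by move=> k0; apply: eq_integral => p _; rewrite lift_mul. Qed.

Lemma measurable_diff u : measurable_fun [set: 'rV[R]_n] u ->
  measurable_fun [set: 'rV[R]_n * 'rV[R]_n] (fun p => u p.1 - u p.2).
Proof.
move=> mu_; apply: measurable_funB.
  exact: (measurableT_comp mu_ measurable_fst).
exact: (measurableT_comp mu_ measurable_snd).
Qed.

Lemma measurable_lift k u : measurable_fun [set: 'rV[R]_n] k ->
  measurable_fun [set: 'rV[R]_n] u -> measurable_fun [set: 'rV[R]_n * 'rV[R]_n] (lift k u).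
Proof.
move=> mk mu_; apply: measurable_funM; first exact: measurable_diff.
have ms : measurable_fun [set: R] (@Num.sqrt R).
  by apply: continuous_measurable_fun => x; exact: sqrt_continuous.
exact: (measurableT_comp ms (measurableT_comp mk (@measurable_rV_sub R n))).
Qed.

(** From (u(x) - u(y))^2 <= 2 u(x)^2 + 2 u(y)^2; each of the two terms contributes 2 times the mass
    of g times the squared norm of u. *)
Lemma lift_conv_le g u : measurable_fun [set: 'rV[R]_n] g -> (forall z, 0 <= g z) ->
  (\int[mu]_z (g z)%:E < +oo)%E -> L2 mu u ->
  L2 mu2 (lift g u) /\ ip mu2 (lift g u) (lift g u) <= 4 * fine (\int[mu]_z (g z)%:E) * ip mu u u.
Proof.
move=> mg g0 gy Lu; have [mu_ _] := Lu.
set G := fine _; have GE : (\int[mu]_z (g z)%:E = G%:E)%E.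
  by rewrite /G fineK// ge0_fin_numE// integral_ge0// => z _; rewrite lee_fin.
pose a x := (2 * u x ^+ 2)%:E.
have ma : measurable_fun [set: 'rV[R]_n] a.
  by apply/measurable_EFinP; apply: measurable_funM => //; exact: measurable_funX.
have a0 x : (0 <= a x)%E by rewrite lee_fin mulr_ge0 ?sqr_ge0.
have mgE : measurable_fun [set: 'rV[R]_n] (EFin \o g) by exact/measurable_EFinP.
have gE0 z : (0 <= (g z)%:E)%E by rewrite lee_fin.
have aE : (\int[mu]_x a x = (2 * ip mu u u)%:E)%E.
  rewrite EFinM -EFin_ip_sqr// -ge0_integralZl_EFin//.
  - by move=> x _; rewrite lee_fin sqr_ge0.
  - by apply/measurable_EFinP; exact: measurable_funX.
have le : (\int[mu2]_p (lift g u p ^+ 2)%:E <= (4 * G * ip mu u u)%:E)%E.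
  apply: (@le_trans _ _ (\int[mu2]_p (a p.1 * (g (p.1 - p.2))%:E + a p.2 * (g (p.1 - p.2))%:E))%E).
    apply: ge0_le_integral => //.
    - by move=> p _; rewrite lee_fin sqr_ge0.
    - by apply/measurable_EFinP/measurable_funX; exact: measurable_lift.
    - apply: emeasurable_funD; apply: emeasurable_funM.
      + exact: (measurableT_comp ma measurable_fst).
      + exact: (measurableT_comp mgE (@measurable_rV_sub R n)).
      + exact: (measurableT_comp ma measurable_snd).
      + exact: (measurableT_comp mgE (@measurable_rV_sub R n)).
    move=> p _; rewrite -!EFinM -EFinD lee_fin expr2 lift_mul// -mulrDl ler_wpM2r//.
    by have := sqr_ge0 (u p.1 + u p.2); rewrite sqrrD -expr2 sqrrB; lra.
  rewrite ge0_integralD//; last 4 first.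
  - by move=> p _; rewrite mule_ge0.
  - apply: emeasurable_funM; first exact: (measurableT_comp ma measurable_fst).
    exact: (measurableT_comp mgE (@measurable_rV_sub R n)).
  - by move=> p _; rewrite mule_ge0.
  - apply: emeasurable_funM; first exact: (measurableT_comp ma measurable_snd).
    exact: (measurableT_comp mgE (@measurable_rV_sub R n)).
  rewrite (integral_conv1 ma mgE a0 gE0) (integral_conv2 ma mgE a0 gE0) aE.
  rewrite (_ : \int[mu]_x (EFin \o g) x = G%:E)%E//.
  by rewrite -EFinM -EFinD lee_fin; lra.
have L : L2 mu2 (lift g u).
  by split; [exact: measurable_lift|exact: le_lt_trans le (ltry _)].
by split=> //; rewrite -lee_fin -EFin_ip_sqr.
Qed.

(** A pointwise inequality between kernels passes to their forms, the integrable part being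
    estimated by [lift_conv_le]. *)
Lemma lift_le_comb k h g u (a : R) : measurable_fun [set: 'rV[R]_n] k ->
  measurable_fun [set: 'rV[R]_n] h -> measurable_fun [set: 'rV[R]_n] g ->
  (forall z, 0 <= k z) -> (forall z, 0 <= h z) -> (forall z, 0 <= g z) -> 0 <= a ->
  (forall z, k z <= a * h z + g z) -> (\int[mu]_z (g z)%:E < +oo)%E ->
  L2 mu u -> L2 mu2 (lift h u) ->
  L2 mu2 (lift k u) /\ ip mu2 (lift k u) (lift k u) <=
    a * ip mu2 (lift h u) (lift h u) + 4 * fine (\int[mu]_z (g z)%:E) * ip mu u u.
Proof.
move=> mk mh mg k0 h0 g0 a0 khg gy Lu Lh; have [mu_ _] := Lu.
have [Lg leg] := lift_conv_le mg g0 gy Lu.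
have le : (\int[mu2]_p (lift k u p ^+ 2)%:E <= (a * ip mu2 (lift h u) (lift h u) +
    ip mu2 (lift g u) (lift g u))%:E)%E.
  rewrite EFinD EFinM -!EFin_ip_sqr// -ge0_integralZl_EFin//; last 2 first.
  - by move=> p _; rewrite lee_fin sqr_ge0.
  - by apply/measurable_EFinP/measurable_funX; exact: measurable_lift.
  rewrite -ge0_integralD//; last 4 first.
  - by move=> p _; rewrite -EFinM lee_fin mulr_ge0 ?sqr_ge0.
  - apply/measurable_EFinP; apply: measurable_funM => //; apply: measurable_funX.
    exact: measurable_lift.
  - by move=> p _; rewrite lee_fin sqr_ge0.
  - by apply/measurable_EFinP/measurable_funX; exact: measurable_lift.
  apply: ge0_le_integral => //.
  - by move=> p _; rewrite lee_fin sqr_ge0.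
  - by apply/measurable_EFinP/measurable_funX; exact: measurable_lift.
  - apply: emeasurable_funD.
      apply/measurable_EFinP; apply: measurable_funM => //; apply: measurable_funX.
      exact: measurable_lift.
    by apply/measurable_EFinP/measurable_funX; exact: measurable_lift.
  move=> p _; rewrite -EFinM -EFinD lee_fin !expr2 !lift_mul//.
  have := khg (p.1 - p.2); set q := (u p.1 - u p.2) * (u p.1 - u p.2) => H.
  have q0 : 0 <= q by rewrite /q -expr2 sqr_ge0.
  by have := ler_wpM2l q0 H; lra.
have L : L2 mu2 (lift k u).
  by split; [exact: measurable_lift|exact: le_lt_trans le (ltry _)].
split=> //; rewrite -lee_fin -EFin_ip_sqr//; apply: le_trans le _.
by rewrite lee_fin lerD2l.
Qed.

End lift.

Section kernels.
Context (R : realType) (n : nat) (s : R) (s01 : 0 < s < 1).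
Local Notation mu := (lebesgue_rV R n).
Local Notation c := (c_ns n s).
Implicit Types z : 'rV[R]_n.

Let s0 : 0 < s. Proof. by case/andP: s01. Qed.
Let s1 : s < 1. Proof. by case/andP: s01. Qed.
Let c0 : 0 < c. Proof. exact: c_ns_gt0. Qed.

Lemma frac_kernel_ge0 z : 0 <= frac_kernel s z.
Proof. exact: powR_ge0. Qed.

Lemma k_plus_ge0 z : 0 <= k_plus s z.
Proof. by rewrite mulr_ge0 ?(mulr_ge0 (ltW c0)) ?powR_ge0// le_max lexx. Qed.

Lemma k_minus_ge0 z : 0 <= k_minus s z.
Proof. by rewrite mulr_ge0 ?(mulr_ge0 (ltW c0)) ?powR_ge0// le_max lexx. Qed.

Lemma measurable_frac_kernel : measurable_fun [set: 'rV[R]_n] (frac_kernel s).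
Proof. exact: (measurableT_comp (measurable_powR _) (@measurable_enorm R n)). Qed.

Let measurable_ln_enorm : measurable_fun [set: 'rV[R]_n] (fun z => ln (enorm z)).
Proof. exact: (measurableT_comp (@measurable_ln R) (@measurable_enorm R n)). Qed.

Lemma measurable_k_plus : measurable_fun [set: 'rV[R]_n] (k_plus s).
Proof.
apply: measurable_funM; first by apply: measurable_funM => //; exact: measurable_frac_kernel.
by apply: measurable_maxr => //; exact: measurable_funN.
Qed.

Lemma measurable_k_minus : measurable_fun [set: 'rV[R]_n] (k_minus s).
Proof.
apply: measurable_funM; first by apply: measurable_funM => //; exact: measurable_frac_kernel.
by apply: measurable_maxr => //; apply: measurable_funN; exact: measurable_funN.
Qed.

(** A nonzero power of 0 is 0 by convention, and -n - 2s is nonzero; so all kernels vanish at the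
    origin. *)
Lemma frac_kernel0 z : enorm z = 0 -> frac_kernel s z = 0.
Proof.
move=> z0; rewrite /frac_kernel z0 powR0//.
by rewrite lt_eqF// -opprD oppr_lt0 ltr_wpDl// mulr_gt0.
Qed.

(** The kernel is 0 for |z| < 1. Beyond, ln |z| <= |z|^s / s leaves the integrable power
    |z|^(-n-s). *)
Lemma k_minus_lty : (\int[mu]_z (k_minus s z)%:E < +oo)%E.
Proof.
apply: (@radial_integral_lty _ _ _ 0 (c / s) 1 s) => //.
- exact: measurable_k_minus.
- exact: k_minus_ge0.
- by rewrite divr_ge0// ltW.
- by move=> z z0; rewrite /k_minus frac_kernel0// mulr0 mul0r.
- move=> z /andP[z0 z1]; rewrite mul0r /k_minus /negpart opprK max_l ?mulr0//.
  by rewrite ln_le0// ltW.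
move=> z z1; have z0 : 0 < enorm z by apply: lt_le_trans z1.
rewrite /k_minus /negpart opprK max_r ?ln_ge0//.
have -> : - s - n%:R = s + (- n%:R - 2 * s) by ring.
rewrite powRD; last by apply/implyP => _; rewrite gt_eqF.
have cf : 0 <= c * frac_kernel s z by rewrite mulr_ge0 ?frac_kernel_ge0// ltW.
apply: (le_trans (ler_wpM2l cf (ln_le_powR z0 s0))).
rewrite -/(frac_kernel s z) le_eqVlt; apply/orP; left; apply/eqP.
by field; rewrite gt_eqF.
Qed.

(** This second moment is what makes Lipschitz functions have finite energy. Near 0 the logarithm is
    at most |z|^(s-1) / (1 - s), which leaves the power |z|^(1-s-n); here s < 1 is decisive. *)
Lemma sqr_k_plus_lty : (\int[mu]_z (enorm z ^+ 2 * k_plus s z)%:E < +oo)%E.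
Proof.
have s1' : 0 < 1 - s by rewrite subr_gt0.
apply: (@radial_integral_lty _ _ _ (c / (1 - s)) 0 (1 - s) 1) => //.
- by apply: measurable_funM; [apply: measurable_funX; exact: measurable_enorm|exact: measurable_k_plus].
- by move=> z; rewrite mulr_ge0 ?sqr_ge0 ?k_plus_ge0.
- by rewrite divr_ge0// ltW.
- by move=> z z0; rewrite /k_plus frac_kernel0// mulr0 mul0r mulr0.
- move=> z /andP[z0 z1]; rewrite /k_plus /pospart max_r; last by rewrite oppr_ge0 ln_le0// ltW.
  have -> : 1 - s - n%:R = 2%:R - (1 - s) + (- n%:R - 2 * s) by ring.
  rewrite powRD; last by apply/implyP => _; rewrite gt_eqF.
  rewrite powRD; last by apply/implyP => _; rewrite gt_eqF.
  rewrite powR_mulrn ?enorm_ge0// -/(frac_kernel s z).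
  have := ln_le_powR (_ : 0 < (enorm z)^-1) s1'; rewrite invr_gt0 => /(_ z0).
  rewrite lnV ?posrE// -powR_inv1 ?enorm_ge0// -powRrM mulN1r => H.
  have f0 : 0 <= c * (enorm z ^+ 2 * frac_kernel s z).
    by apply: mulr_ge0; [exact: ltW|rewrite mulr_ge0 ?sqr_ge0 ?frac_kernel_ge0].
  have := ler_wpM2l f0 H.
  set L := ln _; set x := _ `^ _; set k := frac_kernel s z; set e := enorm z.
  move=> H1; rewrite [leLHS](_ : _ = c * (e ^+ 2 * k) * - L); last by ring.
  by apply: (le_trans H1); rewrite le_eqVlt; apply/orP; left; apply/eqP; ring.
move=> z z1; rewrite mul0r /k_plus /pospart max_l ?mulr0//.
by rewrite oppr_le0 ln_ge0.
Qed.

Lemma k_plus_lb z (r : R) : 0 < r < 1 -> 0 < enorm z <= r ->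
  c * r `^ (- n%:R - 2 * s) * - ln r <= k_plus s z.
Proof.
move=> /andP[r0 r1] /andP[z0 zr]; rewrite /k_plus /pospart.
have p0 : 0 <= n%:R + 2 * s by rewrite addr_ge0// mulr_ge0// ltW.
apply: ler_pM.
- by rewrite mulr_ge0 ?powR_ge0 ?ltW.
- by rewrite oppr_ge0 ln_le0 ?ltW.
- rewrite ler_wpM2l ?(ltW c0)// /frac_kernel -opprD !powRN lef_pV2 ?posrE ?powR_gt0//.
  by rewrite ge0_ler_powR// ?nnegrE ltW.
by rewrite le_max lerN2 ler_ln ?posrE// zr orbT.
Qed.

Definition frac_tail (d : R) z := frac_kernel s z * \1_[set z | d <= enorm z] z.

Lemma measurable_frac_tail d : measurable_fun [set: 'rV[R]_n] (frac_tail d).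
Proof.
apply: measurable_funM; first exact: measurable_frac_kernel.
apply: measurable_indic; rewrite (_ : [set _ | _] = @enorm R n @^-1` `[d, +oo[%classic).
  by rewrite -[X in measurable X]setTI; exact: measurable_enorm.
by apply/seteqP; split => z; rewrite /= in_itv/= andbT.
Qed.

Lemma frac_tail_ge0 d z : 0 <= frac_tail d z.
Proof. by rewrite mulr_ge0 ?frac_kernel_ge0// indicE ler0n. Qed.

Lemma frac_tail_in d z : d <= enorm z -> frac_tail d z = frac_kernel s z.
Proof. by move=> dz; rewrite /frac_tail indicE mem_set// mulr1. Qed.

Lemma frac_tail_out d z : enorm z < d -> frac_tail d z = 0.
Proof. by move=> zd; rewrite /frac_tail indicE memNset/= ?mulr0// leNgt zd. Qed.

(** Between d and 1 the factor |z|^(-1-2s) is at most its value at d, which leaves the integrable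
    |z|^(1-n); beyond 1 the kernel is itself integrable. *)
Lemma frac_tail_lty d : 0 < d -> (\int[mu]_z (frac_tail d z)%:E < +oo)%E.
Proof.
move=> d0; apply: (@radial_integral_lty _ _ _ (d `^ (- 1 - 2 * s)) 1 1 (2 * s)) => //.
- exact: measurable_frac_tail.
- exact: frac_tail_ge0.
- by rewrite mulr_gt0.
- exact: powR_ge0.
- by move=> z z0; rewrite /frac_tail frac_kernel0// mul0r.
- move=> z /andP[z0 z1]; have [dz|dz] := leP d (enorm z); last first.
    by rewrite frac_tail_out// mulr_ge0 ?powR_ge0.
  rewrite frac_tail_in// /frac_kernel.
  have -> : - n%:R - 2 * s = (- 1 - 2 * s) + (1 - n%:R) by ring.
  rewrite (@powRD _ (enorm z) (- 1 - 2 * s)); last by apply/implyP => _; rewrite gt_eqF.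
  rewrite ler_wpM2r ?powR_ge0// -opprD !powRN lef_pV2 ?posrE ?powR_gt0//.
  by rewrite ge0_ler_powR// ?nnegrE ?addr_ge0 ?mulr_ge0 ?(ltW s0) ?(ltW d0) ?(ltW z0).
move=> z z1; rewrite mul1r /frac_tail /frac_kernel (addrC (- _)) indicE.
by case: (_ \in _); rewrite ?mulr1// mulr0 powR_ge0.
Qed.

Lemma frac_kernel_le_comb (e : R) : 0 < e -> exists g : 'rV[R]_n -> R,
  [/\ measurable_fun [set: 'rV[R]_n] g, forall z, 0 <= g z,
      (\int[mu]_z (g z)%:E < +oo)%E & forall z, frac_kernel s z <= e * k_plus s z + g z].
Proof.
(* For |z| < d the logarithm - ln |z| exceeds 1 / (e c), so e times [k_plus] already dominates the
   fractional kernel; only the tail beyond d is left to g. *)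
move=> e0; pose d := expR (- (e * c)^-1).
have d0 : 0 < d by exact: expR_gt0.
exists (frac_tail d); split.
- exact: measurable_frac_tail.
- exact: frac_tail_ge0.
- exact: frac_tail_lty.
move=> z; have [z0|z0] := eqVneq (enorm z) 0.
  by rewrite frac_kernel0// addr_ge0 ?frac_tail_ge0// mulr_ge0 ?k_plus_ge0// ltW.
have {}z0 : 0 < enorm z by rewrite lt0r z0 enorm_ge0.
have [dz|zd] := leP d (enorm z).
  by rewrite frac_tail_in// lerDr mulr_ge0 ?k_plus_ge0// ltW.
rewrite frac_tail_out// addr0.
rewrite /k_plus /pospart mulrA -[leLHS]mulr1.
have -> : e * (c * frac_kernel s z) * Num.max 0 (- ln (enorm z)) =
  frac_kernel s z * (e * c * Num.max 0 (- ln (enorm z))) by ring.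
rewrite ler_wpM2l ?frac_kernel_ge0//; have ec0 : 0 < e * c by rewrite mulr_gt0.
suff H : (e * c)^-1 <= Num.max 0 (- ln (enorm z)).
  by rewrite -[leLHS](mulfV (lt0r_neq0 ec0)); apply: ler_wpM2l => //; exact: ltW.
rewrite le_max lerNr; apply/orP; right.
by rewrite -ler_expR lnK ?posrE// ltW.
Qed.

End kernels.

Lemma Lfun2P d (T : measurableType d) (R : realType) (m : {measure set T -> \bar R}) (f : T -> R) :
  f \in Lfun m 2%:E <-> L2 m f.
Proof.
have E : ('N[m]_2%:E[EFin \o f] `^ 2 = \int[m]_x (f x ^+ 2)%:E)%E.
  rewrite poweR_Lnorm//; apply: eq_integral => x _ /=.
  by rewrite powR_mulrn// real_normK ?num_real.
split.
  move=> /andP[]; rewrite !inE/= => mf ff; split => //.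
  by rewrite -E poweR_lty.
move=> [mf fy]; apply/andP; split; rewrite inE//=.
rewrite /finite_norm (@lty_poweRy _ _ 2)// ?E ?pnatr_eq0//.
Qed.

Section admissible.
Context (R : realType) (n : nat) (s : R) (s01 : 0 < s < 1) (Om : set 'rV[R]_n).
Local Notation mu := (lebesgue_rV R n).
Local Notation mu2 := (mu \x mu)%E.
Local Notation W := ('rV[R]_n -> R).

Definition admissible (u : W) : Prop := [/\ L2 mu u, L2 mu2 (lift (k_plus s) u)
  & {ae mu, forall x, ~ Om x -> u x = 0}].

Lemma H0P u : H0 s Om u <-> admissible u.
Proof.
have mk := @measurable_k_plus R n s.
have k0 := @k_plus_ge0 R n s s01.
have EE : E_plus s u u = (\int[mu2]_p (lift (k_plus s) u p ^+ 2)%:E)%E.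
  by rewrite /E_plus kernel_formE//; apply: eq_integral => p _; rewrite expr2.
split=> [[/Lfun2P Lu Eu u0]|[Lu [_ Eu] u0]]; split => //.
- split; first by apply: measurable_lift => //; case: Lu.
  by rewrite -EE.
- exact/Lfun2P.
- by rewrite EE.
Qed.

Lemma admissible_lin a u w : admissible u -> admissible w ->
  admissible (fun x => a * u x + w x).
Proof.
move=> [Lu Eu u0] [Lw Ew w0]; split; first exact: L2_lin.
  by rewrite lift_lin; exact: L2_lin.
by apply: filterS2 u0 w0 => x ux wx Omx; rewrite ux// wx// mulr0 addr0.
Qed.

Lemma admissible0 : admissible (fun=> 0).
Proof.
split; first exact: L2_0.
  rewrite (_ : lift _ _ = fun=> 0); first exact: L2_0.
  by apply/funext => p; rewrite /lift subrr mul0r.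
exact: nearW.
Qed.

End admissible.

Section form_domain.
Context (R : realType) (n : nat) (s : R) (s01 : 0 < s < 1) (Om : set 'rV[R]_n).
Local Notation W := ('rV[R]_n -> R).

(* The unused proof argument makes s01 a parameter of the type form_domain, so
   that its lmodType structure can be inferred. *)
Definition form_domain_pred (_ : 0 < s < 1) : {pred W} := fun u => `[< admissible s Om u >].

Lemma form_domain_submod : submod_closed (form_domain_pred s01).
Proof.
split; first by apply/asboolP; exact: admissible0.
by move=> a u v /asboolP Lu /asboolP Lv; apply/asboolP; exact: admissible_lin.
Qed.

HB.instance Definition _ := GRing.isSubmodClosed.Build R W (form_domain_pred s01) form_domain_submod.

Record form_domain := FormDomain { form_val :> W; form_valP : form_val \in form_domain_pred s01 }.

HB.instance Definition _ := [isSub for form_val].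
HB.instance Definition _ := [Choice of form_domain by <:].
HB.instance Definition _ := [SubChoice_isSubLmodule of form_domain by <:].

Lemma form_domainP (u : form_domain) : admissible s Om u.
Proof. by case: u => u /= /asboolP. Qed.

Definition to_domain u (Hu : admissible s Om u) : form_domain :=
  @FormDomain u (introT (asboolP _) Hu).

Lemma form_val_lin a (u v : form_domain) : form_val (a *: u + v) = (fun x => a * u x + v x).
Proof. by []. Qed.

Lemma form_val_sum I (r : seq I) (P : pred I) (F : I -> form_domain) :
  form_val (\sum_(i <- r | P i) F i) = \sum_(i <- r | P i) form_val (F i).
Proof. exact: (big_morph form_val). Qed.

End form_domain.

Lemma negligible_prodT d1 d2 (T1 : measurableType d1) (T2 : measurableType d2) (R : realType)
  (m1 : {sigma_finite_measure set T1 -> \bar R}) (m2 : {sigma_finite_measure set T2 -> \bar R})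
  (A : set T1) : m1.-negligible A -> (m1 \x m2)%E.-negligible (A `*` setT).
Proof.
move=> [B [mB B0 AB]]; exists (B `*` setT); split.
- exact: measurableX.
- by rewrite product_measure1E// [X in (X * _)%E](B0 : m1 B = 0%E) mul0e.
- by move=> p [/AB].
Qed.

Lemma negligible_prodTl d1 d2 (T1 : measurableType d1) (T2 : measurableType d2) (R : realType)
  (m1 : {sigma_finite_measure set T1 -> \bar R}) (m2 : {sigma_finite_measure set T2 -> \bar R})
  (A : set T2) : m2.-negligible A -> (m1 \x m2)%E.-negligible (setT `*` A).
Proof.
move=> [B [mB B0 AB]]; exists (setT `*` B); split.
- exact: measurableX.
- by rewrite product_measure1E// [X in (_ * X)%E](B0 : m2 B = 0%E) mule0.
- by move=> p [_ /AB].
Qed.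

Lemma ae_prod d (T : measurableType d) (R : realType)
  (m : {sigma_finite_measure set T -> \bar R}) (P : T -> Prop) :
  {ae m, forall x, P x} -> {ae (m \x m)%E, forall p, P p.1 /\ P p.2}.
Proof.
move=> aeP; have h1 := negligible_prodT m aeP; have h2 := negligible_prodTl m aeP.
apply: negligibleS (negligibleU h1 h2) => p /= /not_andP[Pp|Pp]; [by left|by right].
Qed.

Section form.
Context (R : realType) (n : nat) (s : R) (s01 : 0 < s < 1) (Om : set 'rV[R]_n).
Local Notation mu := (lebesgue_rV R n).
Local Notation mu2 := (mu \x mu)%E.
Local Notation dom := (@form_domain R n s s01 Om).
Local Notation beta := (b_ns n s * c_ns n s / 2).
Implicit Types u v w : dom.

Definition form_D u w : R := ip mu u w.
Definition form_plus u w : R := ip mu2 (lift (k_plus s) u) (lift (k_plus s) w).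
Definition form_minus u w : R := ip mu2 (lift (k_minus s) u) (lift (k_minus s) w).
Definition form_frac u w : R := ip mu2 (lift (frac_kernel s) u) (lift (frac_kernel s) w).
Definition form_B u w : R := form_plus u w - form_minus u w + beta * form_frac u w.

Lemma domain_L2 u : L2 mu u.
Proof. by case: (form_domainP u). Qed.

Lemma domain_L2_plus u : L2 mu2 (lift (k_plus s) u).
Proof. by case: (form_domainP u). Qed.

Lemma domain_ae0 u : {ae mu, forall x, ~ Om x -> u x = 0}.
Proof. by case: (form_domainP u). Qed.

Lemma domain_minus u : L2 mu2 (lift (k_minus s) u) /\
  form_minus u u <= 4 * fine (\int[mu]_z (k_minus s z)%:E)%E * form_D u u.
Proof.
apply: lift_conv_le; [exact: measurable_k_minus|exact: k_minus_ge0|exact: k_minus_lty|exact: domain_L2].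
Qed.

Lemma domain_frac (e : R) : 0 < e -> exists2 C, 0 <= C & forall u, L2 mu2 (lift (frac_kernel s) u) /\
  form_frac u u <= e * form_plus u u + C * form_D u u.
Proof.
move=> e0; have [g [mg g0 gy kg]] := @frac_kernel_le_comb R n s s01 e e0.
exists (4 * fine (\int[mu]_z (g z)%:E)%E).
  by rewrite mulr_ge0// fine_ge0// integral_ge0// => z _; rewrite lee_fin.
move=> u; apply: (@lift_le_comb _ _ (frac_kernel s) (k_plus s) g) => //; rewrite ?ltW//.
- exact: measurable_frac_kernel.
- exact: measurable_k_plus.
- exact: frac_kernel_ge0.
- exact: k_plus_ge0.
- exact: domain_L2.
- exact: domain_L2_plus.
Qed.

Lemma domain_L2_frac u : L2 mu2 (lift (frac_kernel s) u).
Proof. by have [C _ /(_ u)[]] := domain_frac ltr01. Qed.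

Lemma domain_L2_minus u : L2 mu2 (lift (k_minus s) u).
Proof. by case: (domain_minus u). Qed.

Lemma form_D_sym u w : form_D u w = form_D w u. Proof. exact: ipC. Qed.

Lemma form_B_sym u w : form_B u w = form_B w u.
Proof. by rewrite /form_B /form_plus /form_minus /form_frac ipC [ip _ (lift (k_minus s) _) _]ipC [ip _ (lift (frac_kernel s) _) _]ipC. Qed.

Lemma form_D_lin a u v w : form_D (a *: u + v) w = a * form_D u w + form_D v w.
Proof. by rewrite /form_D form_val_lin ip_lin//; exact: domain_L2. Qed.

Lemma form_plus_lin a u v w : form_plus (a *: u + v) w = a * form_plus u w + form_plus v w.
Proof. by rewrite /form_plus form_val_lin lift_lin ip_lin//; exact: domain_L2_plus. Qed.

Lemma form_B_lin a u v w : form_B (a *: u + v) w = a * form_B u w + form_B v w.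
Proof.
rewrite /form_B form_plus_lin /form_minus /form_frac form_val_lin !lift_lin.
rewrite !ip_lin; [ring|exact: domain_L2_frac..|exact: domain_L2_minus|exact: domain_L2_minus|exact: domain_L2_minus].
Qed.

Lemma form_D_ge0 u : 0 <= form_D u u. Proof. exact: ip_ge0. Qed.

Lemma form_plus_ge0 u : 0 <= form_plus u u. Proof. exact: ip_ge0. Qed.

Lemma E_sLogE u w : E_sLog s u w = (form_B u w)%:E.
Proof.
rewrite /E_sLog /E_plus /E_minus /E_s !kernel_formE; last 3 first.
- exact: frac_kernel_ge0.
- exact: k_minus_ge0.
- exact: k_plus_ge0.
rewrite !EFin_ip; [by []|exact: domain_L2_frac..|exact: domain_L2_minus|exact: domain_L2_minus|exact: domain_L2_plus|exact: domain_L2_plus].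
Qed.

(** The lower bound turns Cauchy sequences of the shifted form into Cauchy sequences for [form_plus]
    and [form_D]; the upper bound turns convergence for these back into convergence for the shifted
    form. *)
Lemma form_coercive : exists2 kappa : R, 0 <= kappa & exists2 C : R, 0 <= C &
  forall u, form_plus u u / 2 + form_D u u <= form_B u u + kappa * form_D u u /\
    form_B u u + kappa * form_D u u <= C * (form_plus u u + form_D u u).
Proof.
(* beta may have either sign, so the fractional form is absorbed through its absolute value; with
   this e it costs at most half of [form_plus]. *)
pose e := (2 * (`|beta| + 1))^-1.
have b1 : 0 < `|beta| + 1 by rewrite ltr_wpDl.
have e0 : 0 < e by rewrite invr_gt0 mulr_gt0.
have [C1 C10 HC1] := domain_frac e0.
pose C2 := 4 * fine (\int[mu]_z (@k_minus R n s z)%:E)%E.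
have C20 : 0 <= C2.
  by rewrite mulr_ge0// fine_ge0// integral_ge0// => z _; rewrite lee_fin k_minus_ge0.
(* C2 pays for [form_minus], the second term for the fractional form, and 1 leaves one copy of
   [form_D]. *)
pose kappa := C2 + `|beta| * C1 + 1.
have k0 : 0 <= kappa by rewrite !addr_ge0// mulr_ge0.
exists kappa => //; exists (2 + 2 * kappa); first by rewrite addr_ge0// mulr_ge0.
move=> u; have [_ Hm] := domain_minus u; have [_ Hf] := HC1 u.
rewrite -/C2 in Hm.
have f0 : 0 <= form_frac u u by exact: ip_ge0.
have m0 : 0 <= form_minus u u by exact: ip_ge0.
have p0 := form_plus_ge0 u; have d0 := form_D_ge0 u.
have Hb : `|beta * form_frac u u| <= form_plus u u / 2 + `|beta| * C1 * form_D u u.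
  rewrite normrM (ger0_norm f0); apply: (le_trans (ler_wpM2l (normr_ge0 _) Hf)).
  rewrite mulrDr [X in _ + X <= _]mulrA lerD2r mulrA [leRHS]mulrC ler_wpM2r//.
  by rewrite /e invfM mulrCA ler_piMr ?invr_ge0// ler_pdivrMr// mul1r lerDl.
have Cd : 0 <= `|beta| * C1 * form_D u u by rewrite !mulr_ge0.
have kd : 0 <= kappa * form_plus u u by rewrite mulr_ge0.
move: Hb; rewrite /form_B ler_norml => /andP[h1 h2].
split; first by rewrite /kappa; lra.
have c2d := mulr_ge0 C20 d0.
rewrite [leRHS](_ : _ = 2 * form_plus u u + 2 * form_D u u + 2 * (kappa * form_plus u u) + 2 * (kappa * form_D u u)); last by ring.
by rewrite /kappa in kd *; lra.
Qed.

End form.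

(** * Completeness of the form domain *)

Section domain_complete.
Context (R : realType) (n : nat) (s : R) (s01 : 0 < s < 1) (Om : set 'rV[R]_n).
Context (mOm : measurable Om) (Omy : (lebesgue_rV R n Om < +oo)%E).
Local Notation mu := (lebesgue_rV R n).
Local Notation mu2 := (mu \x mu)%E.
Local Notation dom := (@form_domain R n s s01 Om).

(** A.e. convergence of a subsequence on R^n gives a.e. convergence of the lifts on R^n x R^n, so
    one limit function serves both for the L^2 norm and for the energy. *)
Lemma domain_complete (u : nat -> dom) :
  (forall eps : R, 0 < eps -> exists N, forall i j, (N <= i)%N -> (N <= j)%N ->
     form_plus (u i - u j) (u i - u j) + form_D (u i - u j) (u i - u j) < eps) ->
  exists v : dom, forall eps : R, 0 < eps -> exists N, forall i, (N <= i)%N ->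
     form_plus (u i - v) (u i - v) <= eps /\ form_D (u i - v) (u i - v) <= eps.
Proof.
move=> cau.
have Lu k : L2 mu (u k) by exact: domain_L2.
have cauD eps : 0 < eps -> exists N, forall i j, (N <= i)%N -> (N <= j)%N ->
     ip mu (fun x => u i x - u j x) (fun x => u i x - u j x) < eps.
  move=> /cau[N NP]; exists N => i j Ni Nj; apply: le_lt_trans (NP i j Ni Nj).
  by rewrite lerDr form_plus_ge0.
have cauP eps : 0 < eps -> exists N, forall i j, (N <= i)%N -> (N <= j)%N ->
     ip mu2 (fun x => lift (k_plus s) (u i) x - lift (k_plus s) (u j) x)
            (fun x => lift (k_plus s) (u i) x - lift (k_plus s) (u j) x) < eps.
  move=> /cau[N NP]; exists N => i j Ni Nj; rewrite -liftB.
  apply: le_lt_trans (NP i j Ni Nj).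
  by rewrite lerDl form_D_ge0.
have [v0 [f [mv v00 fk uv]]] := L2_cauchy_cvg mOm Omy Lu (fun k => domain_ae0 (u k)) cauD.
have [Lv vD] := L2_ae_limit Lu mv fk uv cauD.
have mlv : measurable_fun [set: 'rV[R]_n * 'rV[R]_n] (lift (k_plus s) v0).
  by apply: measurable_lift => //; exact: measurable_k_plus.
have uv2 : {ae mu2, forall p, lift (k_plus s) (u (f k)) p @[k --> \oo] --> lift (k_plus s) v0 p}.
  apply: filterS (ae_prod uv) => p [p1 p2].
  by rewrite /lift; apply: cvgMr_tmp; apply: cvgB.
have [Llv vP] := L2_ae_limit (fun k => domain_L2_plus (u k)) mlv fk uv2 cauP.
have Hv : admissible s Om v0 by split => //; exact: nearW.
exists (to_domain s01 Hv) => eps eps0.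
have [N1 N1P] := vD _ eps0; have [N2 N2P] := vP _ eps0.
exists (maxn N1 N2) => i; rewrite geq_max => /andP[i1 i2]; split.
  by have := N2P i i2; rewrite -liftB.
exact: N1P.
Qed.

End domain_complete.

(** * Test functions *)

Section lipschitz.
Context (R : realType) (n : nat).
Local Notation mu := (lebesgue_rV R n).
Local Notation mu2 := (mu \x mu)%E.
Implicit Types (f : 'rV[R]_n -> R) (U : set 'rV[R]_n).

Lemma lipschitz_measurable f (L : R) : (forall x y, `|f x - f y| <= L * `|x - y|) ->
  measurable_fun [set: 'rV[R]_n] f.
Proof.
move=> fL; apply: (measurability _ (RGenOInfty.measurableE R)) => //.
move=> _ [_ [a ->] <-]; rewrite setTI; apply: open_rV_measurable.
rewrite openE => x; rewrite /= in_itv/= andbT => fxa.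
pose e := (f x - a) / (`|L| + 1).
have L0 : 0 < `|L| + 1 by rewrite ltr_wpDl.
have e0 : 0 < e by rewrite divr_gt0// subr_gt0.
rewrite /interior; apply/nbhs_ballP; exists e => //= y.
rewrite mx_norm_ball /ball_ /= => xy; rewrite in_itv/= andbT.
have : `|f x - f y| < f x - a.
  apply: (le_lt_trans (fL x y)); apply: (@le_lt_trans _ _ ((`|L| + 1) * `|x - y|)).
    by rewrite ler_wpM2r// (le_trans (ler_norm _))// lerDl.
  by rewrite mulrC -ltr_pdivlMr.
by rewrite ltr_norml => /andP[_]; lra.
Qed.

(** A distance in the sup norm, hence 1-Lipschitz for it; [normr_le_enorm] passes to the Euclidean
    norm. *)
Definition dist_compl U (x : 'rV[R]_n) : R := inf [set `|x - y| | y in ~` U].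

Section dist_compl_theory.
Context (U : set 'rV[R]_n) (U0 : exists y, ~ U y).

Let has_inf_dist x : has_inf [set `|x - y| | y in ~` U].
Proof.
split; first by have [y Uy] := U0; exists `|x - y|; exists y.
by exists 0 => _ [y _ <-].
Qed.

Lemma dist_compl_ge0 x : 0 <= dist_compl U x.
Proof. by apply: lb_le_inf; [case: (has_inf_dist x)|move=> _ [y _ <-]]. Qed.

Lemma dist_compl_out x : ~ U x -> dist_compl U x = 0.
Proof.
move=> Ux; apply/eqP; rewrite eq_le dist_compl_ge0 andbT.
apply: ge_inf; first by case: (has_inf_dist x).
by exists x => //; rewrite subrr normr0.
Qed.

Lemma dist_compl_gt0 x : open U -> U x -> 0 < dist_compl U x.
Proof.
move=> oU Ux; have /nbhs_ballP[e /= e0 eU] : nbhs x U by apply: open_nbhs_nbhs.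
apply: (lt_le_trans e0); apply: lb_le_inf; first by case: (has_inf_dist x).
move=> _ [y Uy <-]; rewrite leNgt; apply/negP => xy; apply: Uy; apply: eU.
by rewrite mx_norm_ball.
Qed.

Lemma dist_compl_lip x y : `|dist_compl U x - dist_compl U y| <= `|x - y|.
Proof.
have H a b : dist_compl U a - dist_compl U b <= `|a - b|.
  rewrite lerBlDr -lerBlDl; apply: lb_le_inf; first by case: (has_inf_dist b).
  move=> _ [z Uz <-]; rewrite lerBlDl; apply: (@le_trans _ _ `|a - z|).
    by apply: ge_inf; [case: (has_inf_dist a)|exists z].
  by rewrite (le_trans (ler_distD b _ _))// addrC.
by rewrite ler_norml H andbT lerNl opprB distrC H.
Qed.

End dist_compl_theory.

(** A j-Lipschitz cutoff; for open U it increases to the indicator of U as j grows. *)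
Definition bump U (j : nat) (x : 'rV[R]_n) : R := Num.min 1 (j%:R * dist_compl U x).

Context (U : set 'rV[R]_n) (U0 : exists y, ~ U y).

Lemma bump_ge0 j x : 0 <= bump U j x.
Proof. by rewrite le_min ler01 mulr_ge0// dist_compl_ge0. Qed.

Lemma bump_le1 j x : bump U j x <= 1.
Proof. by rewrite ge_min lexx. Qed.

Lemma bump_out j x : ~ U x -> bump U j x = 0.
Proof. by move=> Ux; rewrite /bump dist_compl_out// mulr0 min_r. Qed.

Lemma bump_gt0 j x : (0 < j)%N -> open U -> U x -> 0 < bump U j x.
Proof.
by move=> j0 oU Ux; rewrite lt_min ltr01 mulr_gt0 ?ltr0n// dist_compl_gt0.
Qed.

Lemma bump_lip j x y : `|bump U j x - bump U j y| <= j%:R * `|x - y|.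
Proof.
apply: (@le_trans _ _ `|j%:R * dist_compl U x - j%:R * dist_compl U y|).
  rewrite /bump; case: (leP 1 (j%:R * dist_compl U x)); case: (leP 1 (j%:R * dist_compl U y));
    move=> h1 h2; rewrite ?subrr ?normr0//.
  - rewrite ger0_norm; last by rewrite subr_ge0 ltW.
    by apply: le_trans (ler_norm _); rewrite lerD2r.
  - rewrite distrC ger0_norm; last by rewrite subr_ge0 ltW.
    by rewrite distrC; apply: le_trans (ler_norm _); rewrite lerD2r.
by rewrite -mulrBr normrM normr_nat ler_wpM2l// dist_compl_lip.
Qed.

Lemma bump_cvg x : open U -> bump U j x @[j --> \oo] --> (\1_U x : R).
Proof.
move=> oU; have [Ux|Ux] := pselect (U x); rewrite indicE; last first.
  rewrite memNset// (_ : (fun j => _) = cst 0); first exact: cvg_cst.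
  by apply/funext => j; rewrite bump_out.
rewrite mem_set//; apply: cvg_near_cst.
have d0 := dist_compl_gt0 U0 oU Ux.
exists (Num.truncn (dist_compl U x)^-1).+1 => // j /= jd.
rewrite /bump min_l// -ler_pdivrMr// div1r ltW//.
by apply: (lt_le_trans (truncnS_gt _)); rewrite ler_nat.
Qed.

Lemma measurable_bump j : measurable_fun [set: 'rV[R]_n] (bump U j).
Proof. exact: (lipschitz_measurable (bump_lip j)). Qed.

End lipschitz.

(** * Lipschitz functions in the form domain and their density *)

Section density.
Context (R : realType) (n : nat) (s : R) (s01 : 0 < s < 1) (Om : set 'rV[R]_n).
Context (oOm : open Om) (Omy : (lebesgue_rV R n Om < +oo)%E) (OmT : exists y, ~ Om y).
Local Notation mu := (lebesgue_rV R n).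
Local Notation mu2 := (mu \x mu)%E.
Local Notation dom := (@form_domain R n s s01 Om).

Let mOm : measurable Om. Proof. exact: open_rV_measurable. Qed.

Lemma L2_indic : L2 mu (\1_Om : 'rV[R]_n -> R).
Proof.
split; first exact: measurable_indic.
rewrite (_ : \int[mu]_x _ = \int[mu]_x (\1_Om x)%:E)%E.
  by rewrite integral_indic// setIT.
by apply: eq_integral => x _; rewrite indicE; case: (_ \in _); rewrite ?expr1n ?expr0n.
Qed.

(** The squared increment is at most L^2 |x - y|^2 and vanishes unless one of the points lies in Om;
    the energy is thus at most 2 L^2 times the measure of Om times the second moment of [k_plus]. *)
Lemma lipschitz_admissible (phi : 'rV[R]_n -> R) (L : R) : 0 <= L ->
  (forall x, `|phi x| <= 1) -> (forall x y, `|phi x - phi y| <= L * `|x - y|) ->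
  (forall x, ~ Om x -> phi x = 0) -> admissible s Om phi.
Proof.
move=> L0 phi1 phiL phi0; have mphi := lipschitz_measurable phiL.
split; last exact: nearW.
  apply: (proj1 (L2_le mphi L2_indic _)); apply: nearW => x.
  have [Ox|Ox] := pselect (Om x); last by rewrite phi0// normr0.
  by rewrite indicE mem_set// normr1.
have mk := @measurable_k_plus R n s; have k0 := @k_plus_ge0 R n s s01.
split; first exact: measurable_lift.
pose a x := ((L ^+ 2) * \1_Om x)%:E; pose g (z : 'rV[R]_n) := (enorm z ^+ 2 * k_plus s z)%:E.
have ma : measurable_fun [set: 'rV[R]_n] a.
  by apply/measurable_EFinP; apply: measurable_funM => //; exact: measurable_indic.
have a0 x : (0 <= a x)%E by rewrite lee_fin mulr_ge0 ?sqr_ge0// indicE ler0n.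
have mg : measurable_fun [set: 'rV[R]_n] g.
  apply/measurable_EFinP; apply: measurable_funM => //; apply: measurable_funX.
  exact: measurable_enorm.
have g0 z : (0 <= g z)%E by rewrite lee_fin mulr_ge0 ?sqr_ge0.
have ay : (\int[mu]_x a x < +oo)%E.
  rewrite /a; under eq_integral do rewrite EFinM.
  rewrite ge0_integralZl_EFin ?sqr_ge0//; last by apply/measurable_EFinP; exact: measurable_indic.
  by rewrite lte_mul_pinfty ?lee_fin ?sqr_ge0// integral_indic// setIT.
have gy : (\int[mu]_z g z < +oo)%E by exact: sqr_k_plus_lty.
have agy : ((\int[mu]_x a x) * (\int[mu]_z g z) < +oo)%E.
  apply: lte_mul_pinfty => //; first exact: integral_ge0.
  by rewrite ge0_fin_numE//; exact: integral_ge0.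
apply: (@le_lt_trans _ _ (\int[mu2]_p (a p.1 * g (p.1 - p.2)%R + a p.2 * g (p.1 - p.2)%R))%E).
  apply: ge0_le_integral => //.
  - by move=> p _; rewrite lee_fin sqr_ge0.
  - by apply/measurable_EFinP/measurable_funX; exact: measurable_lift.
  - apply: emeasurable_funD; apply: emeasurable_funM.
    + exact: (measurableT_comp ma measurable_fst).
    + exact: (measurableT_comp mg (@measurable_rV_sub R n)).
    + exact: (measurableT_comp ma measurable_snd).
    + exact: (measurableT_comp mg (@measurable_rV_sub R n)).
  move=> p _; rewrite -!EFinM -EFinD lee_fin expr2 lift_mul//.
  have kk0 := k0 (p.1 - p.2); move: (k_plus s (p.1 - p.2)) kk0 => kk kk0.
  rewrite [leRHS](_ : _ = L ^+ 2 * enorm (p.1 - p.2) ^+ 2 * (\1_Om p.1 + \1_Om p.2) * kk); last by ring.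
  rewrite ler_wpM2r//.
  have phiH : (phi p.1 - phi p.2) * (phi p.1 - phi p.2) <= L ^+ 2 * enorm (p.1 - p.2) ^+ 2.
    rewrite -expr2 -exprMn -(real_normK (num_real (_ - _))).
    rewrite ler_sqr ?nnegrE ?mulr_ge0 ?enorm_ge0//.
    by apply: (le_trans (phiL _ _)); rewrite ler_wpM2l// normr_le_enorm.
  have e0 : 0 <= L ^+ 2 * enorm (p.1 - p.2) ^+ 2 by rewrite mulr_ge0 ?sqr_ge0.
  rewrite !indicE.
  have [h1|h1] := pselect (Om p.1); have [h2|h2] := pselect (Om p.2).
  - by rewrite !mem_set// (_ : true%:R + true%:R = 2)//; lra.
  - by rewrite mem_set// memNset// addr0 mulr1.
  - by rewrite memNset// mem_set// add0r mulr1.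
  - by rewrite !memNset// !phi0// subrr mulr0 addr0 mulr0.
rewrite ge0_integralD//; last 4 first.
- by move=> p _; rewrite mule_ge0.
- apply: emeasurable_funM; first exact: (measurableT_comp ma measurable_fst).
  exact: (measurableT_comp mg (@measurable_rV_sub R n)).
- by move=> p _; rewrite mule_ge0.
- apply: emeasurable_funM; first exact: (measurableT_comp ma measurable_snd).
  exact: (measurableT_comp mg (@measurable_rV_sub R n)).
rewrite (integral_conv1 ma mg a0 g0) (integral_conv2 ma mg a0 g0).
exact: lte_add_pinfty.
Qed.

Lemma bump_admissible (U : set 'rV[R]_n) j : U `<=` Om -> admissible s Om (bump U j).
Proof.
move=> UO; have UT : exists y, ~ U y by have [y Oy] := OmT; exists y => /UO.
apply: (@lipschitz_admissible _ j%:R) => //.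
- by move=> x; rewrite ger0_norm ?bump_ge0// bump_le1.
- by move=> x y; exact: bump_lip.
- by move=> x Ox; apply: bump_out => // /UO.
Qed.

(* Testing with bumps increasing to the indicator of an open subset shows that g
   has integral 0 over every open set, hence over every Borel set. *)
Lemma orthogonal_ae0 (g : 'rV[R]_n -> R) : L2 mu g -> (forall x, ~ Om x -> g x = 0) ->
  (forall phi : dom, ip mu g phi = 0) -> {ae mu, forall x, g x = 0}.
Proof.
move=> Lg g0 gphi; have [mg _] := Lg.
have ig : mu.-integrable [set: 'rV[R]_n] (EFin \o g).
  rewrite (_ : EFin \o g = fun x => (g x * \1_Om x)%:E); first exact: (L2_integrable_mul Lg L2_indic).
  apply/funext => x /=; have [Ox|Ox] := pselect (Om x).
    by rewrite indicE mem_set// mulr1.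
  by rewrite g0// mul0r.
have igA A : measurable A -> mu.-integrable A (EFin \o g).
  by move=> mA; apply: integrableS ig.
have opn U : open U -> (\int[mu]_(x in U) (g x)%:E = 0)%E.
  move=> oU; pose U' := U `&` Om.
  have oU' : open U' by exact: openI.
  have UT : exists y, ~ U' y by have [y Oy] := OmT; exists y => -[].
  have -> : (\int[mu]_(x in U) (g x)%:E = \int[mu]_x (g x * \1_U' x)%:E)%E.
    rewrite integral_mkcond; apply: eq_integral => x _; rewrite /patch.
    rewrite indicE /U' in_setI; case: (x \in U) => //=; last by rewrite mulr0.
    have [Ox|Ox] := pselect (Om x); first by rewrite mem_set// mulr1.
    by rewrite memNset// g0// mul0r.
  have mbump j : measurable_fun [set: 'rV[R]_n] (fun x => (g x * bump U' j x)%:E).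
    by apply/measurable_EFinP; apply: measurable_funM => //; exact: measurable_bump.
  have mind : measurable_fun [set: 'rV[R]_n] (fun x => (g x * \1_U' x)%:E).
    apply/measurable_EFinP; apply: measurable_funM => //; apply: measurable_indic.
    exact: open_rV_measurable.
  have cv : {ae mu, forall x, [set: 'rV[R]_n] x ->
      (g x * bump U' j x)%:E @[j --> \oo] --> (g x * \1_U' x)%:E}.
    apply: nearW => x _; apply: cvg_EFin; first exact: nearW.
    by apply: cvgMl_tmp; exact: bump_cvg.
  have iabs : mu.-integrable [set: 'rV[R]_n] (fun x => `|g x|%:E) by exact: integrable_norm.
  have dom_ : {ae mu, forall x j, [set: 'rV[R]_n] x -> (`|(g x * bump U' j x)%:E| <= `|g x|%:E)%E}.
    apply: nearW => x j _; rewrite lee_fin normrM ler_piMr//.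
    by rewrite ger0_norm ?bump_ge0// bump_le1.
  have [_ _ ] := dominated_convergence measurableT mbump mind cv iabs dom_.
  rewrite (_ : [sequence _]_j = cst 0%E).
    by move=> cvI; have /cvg_lim <- // := cvI; rewrite lim_cst.
  apply/funext => j /=.
  have Hb : admissible s Om (bump U' j) by apply: bump_admissible; exact: subIsetr.
  have := gphi (to_domain s01 Hb); have := EFin_ip Lg (domain_L2 (to_domain s01 Hb)).
  by move=> /= -> ->.
have all A : measurable A -> (\int[mu]_(x in A) (g x)%:E = 0)%E.
  move=> mA.
  (* The coordinate sigma-algebra is generated by the open sets, which are stable under
     intersection, as Dynkin's induction requires. *)
  have gen : @measurable _ 'rV[R]_n = <<s [set U | open U] >>.
    apply/seteqP; split; last first.
      by apply: smallest_sub => [|U /open_rV_measurable//]; exact: sigma_algebra_measurable.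
    apply: smallest_sub; first exact: smallest_sigma_algebra.
    move=> B; rewrite -bigcup_seq /= => -[i _ [C mC <-]]; rewrite setTI.
    pose T' := g_sigma_algebraType [set U : set 'rV[R]_n | open U].
    have mc : measurable_fun [set: T'] (@rV_coord R n i : T' -> R).
      apply: (measurability _ (RGenOInfty.measurableE R)) => //.
      move=> _ [_ [a ->] <-]; rewrite setTI; apply: sub_sigma_algebra.
      apply: (@open_comp _ _ (fun x : 'rV[R]_n => x ord0 i)) => [x _|]; first exact: coord_continuous.
      exact: interval_open.
    by have := mc measurableT _ mC; rewrite setTI.
  apply: (dynkin_induction gen (P := fun A => (\int[mu]_(x in A) (g x)%:E = 0)%E)) => //.
  - by move=> U V; exact: openI.
  - exact/opn/openT.
  - move=> S mS S0; have := opn setT openT.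
    rewrite -(setUv S) integral_setU//=.
    + by rewrite S0 add0e.
    + exact: measurableC.
    + by apply: measurable_funTS; exact/measurable_EFinP.
    + by apply/disj_setPS; rewrite setICr.
  - move=> F mF tF F0; rewrite integral_bigcup//.
      by rewrite eseries0.
    by apply: igA; exact: bigcup_measurable.
  - by rewrite -gen.
have := @integral_ae_eq _ _ _ mu setT measurableT (cst 0%E) (EFin \o g) ig (measurable_cst _).
rewrite /ae_eq => H.
have {}H := H _; apply: filterS (H _); last by move=> E _ mE; rewrite all// integral0.
by move=> x /(_ I) [].
Qed.

End density.

Lemma open_lebesgue_rV_gt0 (R : realType) n (U : set 'rV[R]_n) : open U -> U !=set0 ->
  (0 < lebesgue_rV R n U)%E.
Proof.
move=> oU [x Ux]; have /nbhs_ballP[e /= e0 eU] : nbhs x U by apply: open_nbhs_nbhs.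
pose A i : set R := `](x ord0 i - e), (x ord0 i + e)[%classic.
have mA i : measurable (A i) by exact: measurable_itv.
have Ae i : lebesgue_measure (A i) = (2 * e)%:E.
  rewrite lebesgue_measure_itv/= lte_fin ifT; last by lra.
  by rewrite -EFinB; congr EFin; ring.
apply: (@lt_le_trans _ _ ((2 * e) ^+ n)%:E); first by rewrite lte_fin exprn_gt0// mulr_gt0.
rewrite -(lebesgue_rV_box mA Ae); apply: le_measure; rewrite ?inE.
- exact: (measurable_rV_box mA).
- exact: open_rV_measurable.
move=> y yA; apply: eU; split=> // i j; rewrite (ord1 i).
by have := yA j; rewrite /A /= in_itv/= /ball/= ltr_norml => /andP[h1 h2]; apply/andP; split; lra.
Qed.

(** Slices of Om by slabs in one coordinate: the intervals ]r / (i + 2), r / (i + 1)[ are disjoint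
    and, being within r of the centre of a ball in Om, each slab meets Om. *)
Lemma disjoint_open_subsets (R : realType) n (Om : set 'rV[R]_n) : (0 < n)%N -> open Om ->
  Om !=set0 -> exists U : nat -> set 'rV[R]_n, forall i,
  [/\ open (U i), U i !=set0, U i `<=` Om & forall j x, U i x -> U j x -> i = j].
Proof.
move=> n0 oO [x Ox]; have /nbhs_ballP[r /= r0 rO] : nbhs x Om by apply: open_nbhs_nbhs.
pose i0 := Ordinal n0.
pose I (i : nat) : set R := `](x ord0 i0 + r / i.+2%:R), (x ord0 i0 + r / i.+1%:R)[%classic.
exists (fun i => Om `&` [set y : 'rV[R]_n | I i (y ord0 i0)]) => i; split.
- apply: openI => //; apply: (@open_comp _ _ (fun y : 'rV[R]_n => y ord0 i0) (I i)).
    by move=> y _; exact: coord_continuous.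
  exact: interval_open.
- have [t [t1 t2 t0 tr]] : exists t : R, [/\ r / i.+2%:R < t, t < r / i.+1%:R, 0 < t & t < r].
    have h : r / i.+2%:R < r / i.+1%:R by rewrite ltr_pM2l// ltf_pV2 ?posrE// ltr_nat.
    have h0 : 0 < r / i.+2%:R by rewrite divr_gt0.
    have h1 : r / i.+1%:R <= r by rewrite ler_pdivrMr// ler_peMr ?ler1n// ltW.
    move: (r / i.+2%:R) (r / i.+1%:R) h h0 h1 => p q h h0 h1.
    by exists ((p + q) / 2); split; lra.
  exists (\row_j (x ord0 j + if j == i0 then t else 0)); split.
    apply: rO; split => // k j; rewrite (ord1 k) mxE /ball/= opprD addNKr normrN.
    by case: ifP => _; rewrite ?normr0// gtr0_norm.
  by rewrite /I /= in_itv/= mxE eqxx !ltrD2l t1.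
- by move=> y [].
move=> j y [_ yi] [_ yj]; move: yi yj; rewrite /I /= !in_itv/= => /andP[a1 a2] /andP[b1 b2].
have key k l : (k < l)%N -> r / l.+1%:R <= r / k.+2%:R.
  by move=> kl; rewrite ler_pM2l// lef_pV2 ?posrE// ler_nat.
have [ij|ji|//] := ltngtP i j.
  by have := lt_le_trans b2 (lerD (lexx _) (key _ _ ij)); rewrite ltNge (ltW a1).
by have := lt_le_trans a2 (lerD (lexx _) (key _ _ ji)); rewrite ltNge (ltW b1).
Qed.

Section orthonormal_system.
Context (R : realType) (n : nat) (s : R) (s01 : 0 < s < 1) (Om : set 'rV[R]_n).
Context (n0 : (0 < n)%N) (oOm : open Om) (Om0 : Om !=set0).
Context (Omy : (lebesgue_rV R n Om < +oo)%E) (OmT : exists y, ~ Om y).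
Local Notation mu := (lebesgue_rV R n).
Local Notation dom := (@form_domain R n s s01 Om).

(* Normalized bumps on disjoint open subsets of Om. *)
Lemma exists_orthonormal : exists e : nat -> dom, forall i j, form_D (e i) (e j) = (i == j)%:R.
Proof.
have [U UP] := disjoint_open_subsets n0 oOm Om0.
have Hb i : admissible s Om (bump (U i) 1).
  by apply: bump_admissible => //; case: (UP i).
pose b i : dom := to_domain s01 (Hb i).
have UT i : exists y, ~ U i y.
  by have [y Oy] := OmT; exists y => Uy; apply: Oy; have [_ _ UO _] := UP i; exact: UO.
have bij i j : i != j -> form_D (b i) (b j) = 0.
  move=> ij; rewrite /form_D /ip (_ : (\int[mu]_x _ = 0)%E)//.
  rewrite -[RHS](integral0 mu setT); apply: eq_integral => x _.
  have [Ui|Ui] := pselect (U i x); last by rewrite /b/= (bump_out (UT i) 1 Ui) mul0r.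
  have [Uj|Uj] := pselect (U j x); last by rewrite /b/= (bump_out (UT j) 1 Uj) mulr0.
  by have [_ _ _ H] := UP i; rewrite (H j x Ui Uj) eqxx in ij.
have bii i : 0 < form_D (b i) (b i).
  rewrite lt0r form_D_ge0 andbT; apply/eqP => H.
  have ae := ip_eq0 (domain_L2 (b i)) H.
  have [oU U0 _ _] := UP i.
  have := open_lebesgue_rV_gt0 oU U0.
  suff : mu.-negligible (U i).
    by move=> /negligibleP -/(_ (open_rV_measurable oU)) ->; rewrite ltxx.
  apply: negligibleS ae => x Ux /= bx.
  by have := bump_gt0 (UT i) (ltn0Sn 0) oU Ux; rewrite bx ltxx.
exists (fun i => (Num.sqrt (form_D (b i) (b i)))^-1 *: b i) => i j.
rewrite (formZl (@form_D_lin R n s s01 Om)) (formZr (@form_D_sym R n s s01 Om) (@form_D_lin R n s s01 Om)).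
have [<-|ij] := eqVneq i j; last by rewrite (bij _ _ ij) !mulr0.
rewrite mulrA -expr2 exprVn sqr_sqrtr ?(ltW (bii i))// mulVf// gt_eqF//.
Qed.

End orthonormal_system.

(** * Compact embedding *)

Section product_integral.
Context d (T : measurableType d) (R : realType) (m : {sigma_finite_measure set T -> \bar R}).
Local Notation m2 := (m \x m)%E.

Lemma L2_prod (f g : T -> R) : L2 m f -> L2 m g -> L2 m2 (fun p => f p.1 * g p.2).
Proof.
move=> Lf Lg; have [mf fy] := Lf; have [mg gy] := Lg.
have mfg : measurable_fun [set: T * T] (fun p => f p.1 * g p.2).
  apply: measurable_funM; first exact: (measurableT_comp mf measurable_fst).
  exact: (measurableT_comp mg measurable_snd).
split=> //; rewrite fubini_tonelli1; last 2 first.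
- by apply/measurable_EFinP; exact: measurable_funX.
- by move=> p; rewrite lee_fin sqr_ge0.
rewrite /fubini_F /=.
rewrite (_ : \int[m]_x _ = \int[m]_x ((f x ^+ 2)%:E * \int[m]_y (g y ^+ 2)%:E))%E; last first.
  apply: eq_integral => x _; rewrite -ge0_integralZl_EFin ?sqr_ge0//.
  - by apply: eq_integral => y _; rewrite -EFinM exprMn.
  - by move=> y _; rewrite lee_fin sqr_ge0.
  - by apply/measurable_EFinP; exact: measurable_funX.
have g0 : (0 <= \int[m]_y (g y ^+ 2)%:E)%E.
  by apply: integral_ge0 => y _; rewrite lee_fin sqr_ge0.
have f0 : (0 <= \int[m]_y (f y ^+ 2)%:E)%E.
  by apply: integral_ge0 => y _; rewrite lee_fin sqr_ge0.
rewrite ge0_integralZr//; last 2 first.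
- by apply/measurable_EFinP; exact: measurable_funX.
- by move=> y _; rewrite lee_fin sqr_ge0.
by apply: lte_mul_pinfty => //; rewrite ge0_fin_numE.
Qed.

Lemma ip_prod (f g f' g' : T -> R) : L2 m f -> L2 m g -> L2 m f' -> L2 m g' ->
  ip m2 (fun p => f p.1 * g p.2) (fun p => f' p.1 * g' p.2) = ip m f f' * ip m g g'.
Proof.
move=> Lf Lg Lf' Lg'; apply: EFin_inj.
rewrite -EFin_ip; [|exact: L2_prod|exact: L2_prod].
have i := L2_integrable_mul (L2_prod Lf Lg) (L2_prod Lf' Lg').
rewrite -(integral12_prod_meas1 i) /fubini_F /=.
rewrite (_ : \int[m]_x _ = \int[m]_x ((ip m g g')%:E * (f x * f' x)%:E))%E; last first.
  apply: eq_integral => x _; rewrite -(EFin_ip Lg Lg').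
  rewrite muleC -integralZl//; last exact: L2_integrable_mul.
  by apply: eq_integral => y _; rewrite -EFinM; congr EFin; ring.
rewrite integralZl//; last exact: L2_integrable_mul.
by rewrite EFin_ip// -EFinM mulrC.
Qed.

End product_integral.

Section variance.
Context (R : realType) (n : nat).
Local Notation mu := (lebesgue_rV R n).
Local Notation mu2 := (mu \x mu)%E.

Definition pair_diff (Q : set 'rV[R]_n) (u : 'rV[R]_n -> R) (p : 'rV[R]_n * 'rV[R]_n) : R :=
  \1_Q p.1 * \1_Q p.2 * (u p.1 - u p.2).

(** The lifted difference is a difference of two tensor products, whose inner products factor by
    Fubini; the right side is twice the measure of Q squared times the variance of u on Q. *)
Lemma variance_identity (Q : set 'rV[R]_n) (u : 'rV[R]_n -> R) :
  L2 mu (\1_Q : _ -> R) -> L2 mu u -> L2 mu (fun x => \1_Q x * u x) ->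
  L2 mu2 (pair_diff Q u) /\
  ip mu2 (pair_diff Q u) (pair_diff Q u) =
    2 * ip mu (\1_Q : _ -> R) (\1_Q : _ -> R) * ip mu (fun x => \1_Q x * u x) (fun x => \1_Q x * u x) -
    2 * ip mu u (\1_Q : _ -> R) ^+ 2.
Proof.
move=> LQ Lu LQu; set v := fun x => \1_Q x * u x in LQu *.
pose F (p : 'rV[R]_n * 'rV[R]_n) := v p.1 * \1_Q p.2.
pose G (p : 'rV[R]_n * 'rV[R]_n) := \1_Q p.1 * v p.2.
have LF : L2 mu2 F by exact: L2_prod.
have LG : L2 mu2 G by exact: L2_prod.
have E : pair_diff Q u = fun p => -1 * G p + F p.
  by apply/funext => p; rewrite /pair_diff /F /G /v; ring.
have vQ : ip mu v (\1_Q : _ -> R) = ip mu u (\1_Q : _ -> R).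
  congr fine; apply: eq_integral => x _; rewrite /v indicE.
  by case: (_ \in _); rewrite ?mul1r// !mulr0.
rewrite E; split; first exact: L2_lin.
rewrite ip_lin//; last exact: L2_lin.
rewrite ![ip _ _ (fun p => -1 * G p + F p)]ipC !ip_lin// (ipC _ G F).
by rewrite !ip_prod// (ipC _ (\1_Q) v) vQ; ring.
Qed.

End variance.

Section cubes.
Context (R : realType) (n : nat) (M h : R) (N : nat) (h0 : 0 < h) (MN : 2 * M <= N%:R * h).
Local Notation mu := (lebesgue_rV R n).

(** Half-open, so that no point belongs to two cubes; N of them per axis cover ]-M, M[ because N h
    >= 2 M. *)
Definition cube (q : {ffun 'I_n -> 'I_N}) : set 'rV[R]_n :=
  [set x | forall i, x ord0 i \in `[- M + (q i)%:R * h, - M + (q i)%:R * h + h[].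

Lemma measurable_cube q : measurable (cube q).
Proof.
exact: (measurable_rV_box (A := fun i => [set` `[- M + (q i)%:R * h, - M + (q i)%:R * h + h[])).
Qed.

Lemma lebesgue_cube q : mu (cube q) = (h ^+ n)%:E.
Proof.
apply: (lebesgue_rV_box (A := fun i => [set` `[- M + (q i)%:R * h, - M + (q i)%:R * h + h[])) => // i.
rewrite lebesgue_measure_itv/= lte_fin ifT ?ltrDl//.
by rewrite -EFinB; congr EFin; ring.
Qed.

Lemma cube_cover (x : 'rV[R]_n) : (forall i, `|x ord0 i| < M) -> exists q, cube q x.
Proof.
move=> xM.
have H i : (Num.truncn ((x ord0 i + M) / h) < N)%N.
  have := xM i; rewrite ltr_norml => /andP[x1 x2].
  rewrite truncn_lt_nat; last by rewrite divr_ge0 ?(ltW h0)//; lra.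
  by rewrite ltr_pdivrMr//; apply: lt_le_trans MN; rewrite mulr_natl mulr2n ltrD2r.
exists [ffun i => Ordinal (H i)] => i; rewrite ffunE /= in_itv/=.
have := xM i; rewrite ltr_norml => /andP[x1 x2].
have y0 : 0 <= (x ord0 i + M) / h by rewrite divr_ge0 ?(ltW h0)//; lra.
have /andP[t1 t2] := truncn_itv y0.
rewrite ler_pdivlMr// in t1; rewrite ltr_pdivrMr// -natr1 mulrDl mul1r in t2.
by apply/andP; split; lra.
Qed.

Lemma cube_inj q q' (x : 'rV[R]_n) : cube q x -> cube q' x -> q = q'.
Proof.
move=> qx q'x; apply/ffunP => i; apply/val_inj => /=.
have := qx i; have := q'x i; rewrite !in_itv/= => /andP[a1 a2] /andP[b1 b2].
have key (k l : nat) : - M + k%:R * h <= x ord0 i -> x ord0 i < - M + l%:R * h + h -> (k <= l)%N.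
  move=> c1 c2; rewrite -ltnS -(ltr_nat R) -(ltr_pM2r h0) -natr1 mulrDl mul1r.
  by lra.
by apply/eqP; rewrite eqn_leq (key _ _ b1 a2) (key _ _ a1 b2).
Qed.

Lemma cube_diam q (x y : 'rV[R]_n) : cube q x -> cube q y -> enorm (x - y) <= n%:R * h.
Proof.
move=> qx qy; apply: enorm_le; last exact: ltW.
move=> i; rewrite !mxE; have := qx i; have := qy i; rewrite !in_itv/= => /andP[a1 a2] /andP[b1 b2].
by rewrite ler_norml; apply/andP; split; lra.
Qed.

Lemma L2_cube q : L2 mu (\1_(cube q) : _ -> R).
Proof.
split; first by apply: measurable_indic; exact: measurable_cube.
rewrite (_ : \int[mu]_x _ = \int[mu]_x (\1_(cube q) x)%:E)%E.
  by rewrite integral_indic// ?setIT; [rewrite [X in (X < _)%E]lebesgue_cube ltry|exact: measurable_cube].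
by apply: eq_integral => x _; rewrite indicE; case: (_ \in _); rewrite ?expr1n ?expr0n.
Qed.

Lemma ip_cube q : ip mu (\1_(cube q) : _ -> R) (\1_(cube q) : _ -> R) = h ^+ n.
Proof.
rewrite /ip (_ : \int[mu]_x _ = \int[mu]_x (\1_(cube q) x)%:E)%E.
  by rewrite integral_indic// ?setIT; [rewrite [X in fine X]lebesgue_cube|exact: measurable_cube].
by apply: eq_integral => x _; rewrite indicE; case: (_ \in _); rewrite ?mulr1 ?mulr0.
Qed.

Lemma L2_cube_mul q (u : 'rV[R]_n -> R) : L2 mu u -> L2 mu (fun x => \1_(cube q) x * u x).
Proof.
move=> Lu; have [mu_ _] := Lu; apply: (proj1 (L2_le _ Lu _)).
  by apply: measurable_funM => //; apply: measurable_indic; exact: measurable_cube.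
by apply: nearW => x; rewrite indicE; case: (_ \in _); rewrite ?mul1r// mul0r normr0.
Qed.

Lemma ip_le_sum_cubes (u : 'rV[R]_n -> R) : L2 mu u ->
  {ae mu, forall x : 'rV[R]_n, ~ (forall i, `|x ord0 i| < M) -> u x = 0} ->
  ip mu u u <= \sum_q ip mu (fun x => \1_(cube q) x * u x) (fun x => \1_(cube q) x * u x).
Proof.
move=> Lu u0; have [mu_ _] := Lu.
rewrite -lee_fin -EFin_ip_sqr// -sumEFin.
rewrite [leRHS](eq_bigr (fun q => \int[mu]_x ((\1_(cube q) x * u x) ^+ 2)%:E)%E); last first.
  by move=> q _; rewrite EFin_ip_sqr//; exact: L2_cube_mul.
have mt q : measurable_fun [set: 'rV[R]_n] (fun x => ((\1_(cube q) x * u x) ^+ 2)%:E).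
  by apply/measurable_EFinP; apply: measurable_funX; case: (L2_cube_mul q Lu).
rewrite -ge0_integral_sum//; last by move=> q x _; rewrite lee_fin sqr_ge0.
apply: ae_ge0_le_integral => //.
- by move=> x _; rewrite lee_fin sqr_ge0.
- by apply/measurable_EFinP; exact: measurable_funX.
- by move=> x _; apply: sume_ge0 => q _; rewrite lee_fin sqr_ge0.
- exact: emeasurable_sum.
apply: filterS u0 => x ux _.
have [xM|/ux ->] := pselect (forall i, `|x ord0 i| < M); last first.
  by rewrite expr0n/=; apply: sume_ge0 => q _; rewrite lee_fin sqr_ge0.
have [q qx] := cube_cover xM.
rewrite sumEFin lee_fin (bigD1 q)//= indicE mem_set// mul1r lerDl.
by apply: sumr_ge0 => q' _; rewrite sqr_ge0.
Qed.

(** The products of a cube with itself are disjoint in R^n x R^n, so at each pair of points at most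
    one term is nonzero and the number of cubes does not enter the bound. *)
Lemma sum_pair_diff_le (u : 'rV[R]_n -> R) (g : 'rV[R]_n * 'rV[R]_n -> R) (K : R) : L2 mu u -> L2 (mu \x mu)%E g -> 0 < K ->
  (forall q p, cube q p.1 -> cube q p.2 -> K * (u p.1 - u p.2) ^+ 2 <= g p ^+ 2) ->
  \sum_q ip (mu \x mu)%E (pair_diff (cube q) u) (pair_diff (cube q) u) <=
    K^-1 * ip (mu \x mu)%E g g.
Proof.
move=> Lu Lg K0 Hg; have [mg _] := Lg.
have Lp q : L2 (mu \x mu)%E (pair_diff (cube q) u).
  by case: (variance_identity (L2_cube q) Lu (L2_cube_mul q Lu)).
rewrite -lee_fin EFinM -EFin_ip_sqr// -sumEFin.
rewrite [leLHS](eq_bigr (fun q => \int[mu \x mu]_p (pair_diff (cube q) u p ^+ 2)%:E)%E); last first.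
  by move=> q _; rewrite EFin_ip_sqr.
have mt q : measurable_fun [set: 'rV[R]_n * 'rV[R]_n] (fun p => (pair_diff (cube q) u p ^+ 2)%:E).
  by apply/measurable_EFinP; apply: measurable_funX; case: (Lp q).
have mg2 : measurable_fun [set: 'rV[R]_n * 'rV[R]_n] (fun p => (g p ^+ 2)%:E).
  by apply/measurable_EFinP; exact: measurable_funX.
rewrite -ge0_integral_sum//; last by move=> q x _; rewrite lee_fin sqr_ge0.
rewrite -ge0_integralZl_EFin//; last 2 first.
- by move=> p _; rewrite lee_fin sqr_ge0.
- by rewrite invr_ge0 ltW.
apply: ge0_le_integral => //.
- by move=> p _; apply: sume_ge0 => q _; rewrite lee_fin sqr_ge0.
- exact: emeasurable_sum.
- exact: measurable_funeM.
move=> p _; rewrite sumEFin -EFinM lee_fin.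
have [[q [q1 q2]]|nq] := pselect (exists q, cube q p.1 /\ cube q p.2).
  rewrite (bigD1 q)//= big1 => [|q' qq']; last first.
    rewrite /pair_diff !indicE [p.1 \in cube q']memNset ?mul0r ?expr0n// => q'1.
    by rewrite (cube_inj q1 q'1) eqxx in qq'.
  rewrite addr0 /pair_diff !indicE !mem_set// !mul1r ler_pdivlMl//.
  exact: Hg q1 q2.
rewrite big1 => [|q _]; first by rewrite mulr_ge0 ?sqr_ge0// invr_ge0 ltW.
rewrite /pair_diff !indicE.
have [h1|h1] := pselect (cube q p.1); last by rewrite memNset// mul0r mul0r expr0n.
have [h2|h2] := pselect (cube q p.2); last by rewrite [p.2 \in _]memNset// mulr0 mul0r expr0n.
by exfalso; apply: nq; exists q.
Qed.

End cubes.

Section compact_embedding.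
Context (R : realType) (n : nat) (s : R) (s01 : 0 < s < 1) (Om : set 'rV[R]_n).
Context (n0 : (0 < n)%N) (M : R) (OmM : forall x, Om x -> enorm x < M).
Local Notation mu := (lebesgue_rV R n).
Local Notation mu2 := (mu \x mu)%E.
Local Notation dom := (@form_domain R n s s01 Om).
Local Notation c := (c_ns n s).

(* (r / n)^n is the volume of a cube of side r / n, whose diameter is at most r,
   and the next factor bounds k_plus from below on differences of its points
   (k_plus_lb). The logarithm is not needed for the smallness: r^(2 s) suffices. *)
Lemma small_scale (eps : R) : 0 < eps -> exists r : R, [/\ 0 < r, r < 1 &
  (2 * (r / n%:R) ^+ n * (c * r `^ (- n%:R - 2 * s) * - ln r))^-1 <= eps].
Proof.
move=> eps0; have /andP[s0 s1] := s01; have c0 : 0 < c by exact: c_ns_gt0.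
have nn : 0 < (n%:R : R) ^+ n by rewrite exprn_gt0// ltr0n.
pose a := 2 * eps * c / n%:R ^+ n.
have a0 : 0 < a by apply: divr_gt0 => //; apply: mulr_gt0 => //; exact: mulr_gt0.
(* The first bound gives - ln r >= 1; the second gives r^(2 s) <= a, and a is chosen so that what
   remains is exactly eps. *)
pose r := Num.min (expR (-1)) (a `^ (2 * s)^-1).
have s20 : 0 < 2 * s by rewrite mulr_gt0.
have r0 : 0 < r by rewrite lt_min expR_gt0 (powR_gt0 _ a0).
have re : r <= expR (-1) by rewrite ge_min lexx.
have ra : r `^ (2 * s) <= a.
  have : r <= a `^ (2 * s)^-1 by rewrite ge_min lexx orbT.
  move=> /(ge0_ler_powR (ltW s20)); rewrite !nnegrE (ltW r0) powR_ge0 => /(_ isT isT).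
  by rewrite -powRrM mulVf ?gt_eqF// powRr1// ltW.
have lnr : 1 <= - ln r.
  by rewrite lerNr -[leRHS]expRK ler_ln ?posrE ?expR_gt0.
exists r; split => //.
  by apply: (le_lt_trans re); rewrite -[ltRHS]expR0 ltr_expR ltrN10.
rewrite -[leRHS]invrK lef_pV2 ?posrE ?invr_gt0//; last first.
  apply: mulr_gt0; first by rewrite mulr_gt0// exprn_gt0// divr_gt0// ltr0n.
  by apply: mulr_gt0; [rewrite mulr_gt0// powR_gt0|exact: lt_le_trans lnr].
have E : r ^+ n * r `^ (- n%:R - 2 * s) = (r `^ (2 * s))^-1.
  rewrite -powRN -powR_mulrn ?(ltW r0)// -powRD; first by congr (_ `^ _); ring.
  by apply/implyP => _; rewrite gt_eqF.
rewrite expr_div_n [leRHS](_ : _ = (r ^+ n * r `^ (- n%:R - 2 * s)) * (2 * c / n%:R ^+ n * - ln r)); last first.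
  by field; rewrite gt_eqF.
rewrite E; apply: (@le_trans _ _ (a^-1 * (2 * c / n%:R ^+ n))).
  rewrite /a le_eqVlt; apply/orP; left; apply/eqP; field.
  by rewrite !gt_eqF.
apply: ler_pM.
- by rewrite invr_ge0 ltW.
- by rewrite divr_ge0 ?(ltW nn)// mulr_ge0 ?(ltW c0).
- by rewrite lef_pV2 ?posrE ?powR_gt0.
- by rewrite ler_peMr// divr_ge0 ?(ltW nn)// mulr_ge0 ?(ltW c0).
Qed.

(* On each cube of a fine grid, variance_identity bounds the distance of u to its
   mean by a small multiple of form_plus; the l q are the rescaled means. *)
Lemma domain_compact_embedding (eps : R) : 0 < eps ->
  exists (I : finType) (l : I -> dom -> R) (C : R),
  [/\ forall q u v, l q (u - v) = l q u - l q v,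
      forall q u, l q u ^+ 2 <= C * form_D u u
    & forall u, form_D u u <= eps * form_plus u u + \sum_q l q u ^+ 2].
Proof.
move=> eps0; have /andP[s0 s1] := s01; have c0 : 0 < c by exact: c_ns_gt0.
have [r [r0 r1 rK]] := small_scale eps0.
have nr0 : 0 < n%:R :> R by rewrite ltr0n.
pose h := r / n%:R; have h0 : 0 < h by rewrite divr_gt0.
pose N := (Num.truncn (2 * M / h)).+1.
have MN : 2 * M <= N%:R * h by rewrite -ler_pdivrMr// ltW// truncnS_gt.
pose Q := @cube R n M h N.
pose w := h ^+ n; have w0 : 0 < w by rewrite exprn_gt0.
pose K := c * r `^ (- n%:R - 2 * s) * - ln r.
have K0 : 0 < K.
  by apply: mulr_gt0; [rewrite mulr_gt0// powR_gt0|rewrite oppr_gt0 ln_lt0// r0].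
have LQ q : L2 mu (\1_(Q q) : _ -> R) by exact: L2_cube.
(* The square of [l q u] is the squared L^2 norm, over the cube, of the mean of u on it. *)
pose l (q : {ffun 'I_n -> 'I_N}) (u : dom) : R := (Num.sqrt w)^-1 * ip mu u (\1_(Q q) : _ -> R).
have l2 q u : l q u ^+ 2 = w^-1 * ip mu u (\1_(Q q) : _ -> R) ^+ 2.
  by rewrite /l exprMn exprVn sqr_sqrtr// ltW.
have var q (u : dom) := variance_identity (LQ q) (domain_L2 u) (@L2_cube_mul R n M h N q _ (domain_L2 u)).
have ae0 (u : dom) : {ae mu, forall x : 'rV[R]_n, ~ (forall i, `|x ord0 i| < M) -> u x = 0}.
  apply: filterS (domain_ae0 u) => x ux xM; apply: ux => /OmM Ox; apply: xM => i.
  exact: le_lt_trans (coord_le_enorm x i) Ox.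
have Hvar q (u : dom) : ip mu (fun x => \1_(Q q) x * u x) (fun x => \1_(Q q) x * u x) =
    l q u ^+ 2 + (2 * w)^-1 * ip mu2 (pair_diff (Q q) u) (pair_diff (Q q) u).
  rewrite (var q u).2 ip_cube// -/w.
  set vv := ip _ _ _; set mm := ip _ _ _.
  apply: (@etrans _ _ (w^-1 * mm ^+ 2 + (2 * w)^-1 * (2 * w * vv - 2 * mm ^+ 2))).
    by field; rewrite gt_eqF.
  by congr (_ + _); exact/esym/l2.
exists ({ffun 'I_n -> 'I_N} : finType); exists l; exists 1; split.
- move=> q u v; rewrite /l -mulrBr; congr (_ * _).
  rewrite (_ : form_val (u - v) = fun x => -1 * form_val v x + form_val u x).
    by rewrite ip_lin ?mulN1r ?(addrC (- _))//; exact: domain_L2.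
  by apply/funext => x; rewrite mulN1r addrC.
- move=> q u; rewrite mul1r.
  apply: (@le_trans _ _ (ip mu (fun x => \1_(Q q) x * u x) (fun x => \1_(Q q) x * u x))).
    by rewrite Hvar lerDl mulr_ge0 ?ip_ge0// invr_ge0 mulr_ge0// ltW.
  apply: (proj2 (L2_le _ (domain_L2 u) _)); first by case: (@L2_cube_mul R n M h N q _ (domain_L2 u)).
  by apply: nearW => x; rewrite indicE; case: (_ \in _); rewrite ?mul1r// mul0r normr0.
move=> u; apply: (le_trans (ip_le_sum_cubes h0 MN (domain_L2 u) (ae0 u))).
rewrite (eq_bigr _ (fun q _ => Hvar q u)) big_split/= addrC lerD2r -mulr_sumr.
apply: (@le_trans _ _ ((2 * w)^-1 * (K^-1 * form_plus u u))).
  rewrite ler_wpM2l ?invr_ge0 ?mulr_ge0 ?(ltW w0)//.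
  apply: sum_pair_diff_le => //; [exact: domain_L2|exact: domain_L2_plus|].
  move=> q p q1 q2; rewrite expr2 [leRHS]expr2 lift_mul; last exact: k_plus_ge0.
  rewrite [leRHS]mulrC; have [e0|e0] := eqVneq (enorm (p.1 - p.2)) 0.
    have -> : p.1 = p.2.
      apply/eqP; rewrite -subr_eq0; apply/eqP/rowP => i; rewrite [RHS]mxE.
      by apply/eqP; rewrite -normr_le0 -[leRHS]e0 coord_le_enorm.
    by rewrite !subrr !mulr0.
  rewrite ler_wpM2r -?expr2 ?sqr_ge0//.
  apply: k_plus_lb => //; first by rewrite r0.
  rewrite lt0r e0 enorm_ge0 /= (le_trans (cube_diam h0 q1 q2))//.
  by rewrite /h mulrC divfK// gt_eqF.
by rewrite mulrA -invfM ler_wpM2r// form_plus_ge0.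
Qed.

End compact_embedding.

(** * Small diameter *)

Section small_diameter_kernels.
Context (R : realType) (n : nat) (s : R) (n0 : (0 < n)%N) (s01 : 0 < s < 1).
Context (d : R) (d01 : 0 < d < 1).
Local Notation mu := (lebesgue_rV R n).
Local Notation c := (c_ns n s).
Implicit Types z : 'rV[R]_n.

Let s0 : 0 < s. Proof. by case/andP: s01. Qed.
Let d0 : 0 < d. Proof. by case/andP: d01. Qed.
Let d1 : d < 1. Proof. by case/andP: d01. Qed.
Let c0 : 0 < c. Proof. exact: c_ns_gt0. Qed.

Definition log_tail (e : R) z := frac_tail s e z * ln (enorm z / e).

Lemma log_tail_ge0 e z : 0 < e -> 0 <= log_tail e z.
Proof.
move=> e0; have [ez|ze] := leP e (enorm z); last by rewrite /log_tail frac_tail_out// mul0r.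
by rewrite mulr_ge0 ?frac_tail_ge0// ln_ge0// ler_pdivlMr// mul1r.
Qed.

Lemma measurable_log_tail e : measurable_fun [set: 'rV[R]_n] (log_tail e).
Proof.
apply: measurable_funM; first exact: measurable_frac_tail.
apply: (measurableT_comp (@measurable_ln R)).
by apply: measurable_funM => //; exact: measurable_enorm.
Qed.

Let F := (\int[mu]_z (frac_tail s d z)%:E)%E.
Let G := (\int[mu]_z (log_tail d z)%:E)%E.
Let Km := (\int[mu]_z (k_minus s z)%:E)%E.

Definition k_plus_tail z := k_plus s z * \1_[set z | d <= enorm z] z.

Lemma k_plus_tail_ge0 z : 0 <= k_plus_tail z.
Proof. by rewrite mulr_ge0 ?k_plus_ge0// indicE ler0n. Qed.

Lemma k_plus_tail_le z : k_plus_tail z <= k_plus s z.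
Proof.
by rewrite /k_plus_tail ler_piMr ?k_plus_ge0// indicE; case: (_ \in _).
Qed.

Lemma k_plus_tail_out z : enorm z < d -> k_plus_tail z = 0.
Proof. by move=> zd; rewrite /k_plus_tail indicE memNset/= ?mulr0// leNgt zd. Qed.

Lemma measurable_k_plus_tail : measurable_fun [set: 'rV[R]_n] k_plus_tail.
Proof.
apply: measurable_funM; first exact: measurable_k_plus.
apply: measurable_indic; rewrite (_ : [set _ | _] = @enorm R n @^-1` `[d, +oo[%classic).
  by rewrite -[X in measurable X]setTI; exact: measurable_enorm.
by apply/seteqP; split => z; rewrite /= in_itv/= andbT.
Qed.

Lemma k_minus_small z : enorm z < 1 -> k_minus s z = 0.
Proof.
move=> z1; rewrite /k_minus /negpart opprK max_l ?mulr0//.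
by rewrite ln_le0// ltW.
Qed.

(** This is - ln |z| = - ln d - ln (|z| / d), with the negative terms moved across: all four terms
    are nonnegative, so the identity can be integrated before any finiteness is known. *)
Lemma kernel_tail_balance z :
  k_plus_tail z + c * log_tail d z = k_minus s z + c * (- ln d) * frac_tail s d z.
Proof.
have [dz|zd] := leP d (enorm z); last first.
  rewrite k_plus_tail_out// /log_tail frac_tail_out// k_minus_small ?(lt_trans zd)//.
  by rewrite mul0r !mulr0.
have z0 : 0 < enorm z by exact: lt_le_trans dz.
rewrite /log_tail frac_tail_in// /k_plus_tail indicE mem_set// mulr1.
rewrite ln_div ?posrE// /k_plus /k_minus /pospart /negpart opprK.
set f := frac_kernel _ _; set l := ln (enorm z).
have -> : Num.max 0 (- l) = Num.max 0 l - l.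
  by have [l0|l0] := leP l 0; [rewrite !max_r ?max_l ?oppr_ge0 ?sub0r//|rewrite max_l ?subrr// oppr_le0 ltW].
by ring.
Qed.

Let F_lty : (F < +oo)%E. Proof. exact: frac_tail_lty. Qed.
Let F_ge0 : (0 <= F)%E. Proof. by apply: integral_ge0 => z _; rewrite lee_fin frac_tail_ge0. Qed.
Let G_ge0 : (0 <= G)%E. Proof. by apply: integral_ge0 => z _; rewrite lee_fin log_tail_ge0. Qed.
Let Km_ge0 : (0 <= Km)%E. Proof. by apply: integral_ge0 => z _; rewrite lee_fin k_minus_ge0. Qed.
Let L0 : 0 <= - ln d. Proof. by rewrite oppr_ge0 ln_le0// ltW. Qed.

Let balance : ((\int[mu]_z (k_plus_tail z)%:E) + c%:E * G = Km + (c * (- ln d))%:E * F)%E.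
Proof.
have mkp := measurable_k_plus_tail.
have mlt := measurable_log_tail d.
have mkm := @measurable_k_minus R n s.
have mft := @measurable_frac_tail R n s d.
have cL : 0 <= c * (- ln d) by rewrite mulr_ge0// ltW.
rewrite -ge0_integralZl_EFin//; last 3 first.
- by move=> z _; rewrite lee_fin log_tail_ge0.
- exact/measurable_EFinP.
- exact: ltW.
rewrite -ge0_integralZl_EFin//; last 2 first.
- by move=> z _; rewrite lee_fin frac_tail_ge0.
- exact/measurable_EFinP.
rewrite -ge0_integralD//; last 4 first.
- by move=> z _; rewrite lee_fin k_plus_tail_ge0.
- exact/measurable_EFinP.
- by move=> z _; rewrite -EFinM lee_fin mulr_ge0 ?log_tail_ge0// ltW.
- by apply/measurable_EFinP; apply: measurable_funM.
rewrite -ge0_integralD//; last 4 first.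
- by move=> z _; rewrite lee_fin k_minus_ge0.
- exact/measurable_EFinP.
- by move=> z _; rewrite -EFinM lee_fin mulr_ge0 ?frac_tail_ge0.
- by apply/measurable_EFinP; apply: measurable_funM.
by apply: eq_integral => z _; rewrite -!EFinM -!EFinD kernel_tail_balance.
Qed.

Let total_lty : (Km + (c * (- ln d))%:E * F < +oo)%E.
Proof.
apply: lte_add_pinfty; first exact: k_minus_lty.
by apply: lte_mul_pinfty => //; rewrite lee_fin mulr_ge0// ltW.
Qed.

(** The right side of the integrated balance is finite, and the terms on its left are nonnegative,
    hence finite too. *)
Lemma k_plus_tail_lty : (\int[mu]_z (k_plus_tail z)%:E < +oo)%E.
Proof.
apply: le_lt_trans total_lty; rewrite -balance leeDl// mule_ge0//.
by rewrite lee_fin ltW.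
Qed.

Let G_lty : (G < +oo)%E.
Proof.
have : (c%:E * G < +oo)%E.
  apply: le_lt_trans total_lty; rewrite -balance leeDr//.
  by apply: integral_ge0 => z _; rewrite lee_fin k_plus_tail_ge0.
case: G G_ge0 => [g _ _|_|//]; first exact: ltry.
by rewrite gt0_muley// lte_fin.
Qed.

(* Splitting at radius r d and rescaling the outer part by r bounds G by
   (ln r) F + r^(-2s) G; let r tend to 1. *)
Let log_tail_le : fine G <= fine F / (2 * s).
Proof.
have GE : G = (fine G)%:E by rewrite fineK// ge0_fin_numE.
have FE : F = (fine F)%:E by rewrite fineK// ge0_fin_numE.
have f0 : 0 <= fine F by exact: fine_ge0.
have g0 : 0 <= fine G by exact: fine_ge0.
have s20 : 0 < 2 * s by rewrite mulr_gt0.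
(* With r = e^x, the comparison G <= x F + e^(-2 s x) G and e^(2 s x) >= 1 + 2 s x give this
   inequality, in which x then tends to 0. *)
suff H x : 0 < x -> 2 * s * fine G <= (1 + 2 * s * x) * fine F.
  rewrite ler_pdivlMr// mulrC; apply/ler_addgt0Pr => e e0.
  have f1 : 0 < 2 * s * (fine F + 1) by rewrite mulr_gt0// ltr_wpDl.
  apply: (le_trans (H (e / (2 * s * (fine F + 1))) _)); first by rewrite divr_gt0.
  rewrite mulrDl mul1r lerD2l.
  rewrite [leLHS](_ : _ = e * (fine F / (fine F + 1))); last first.
    by field; rewrite !gt_eqF// ltr_wpDl.
  by rewrite ler_piMr ?(ltW e0)// ler_pdivrMr ?ltr_wpDl// mul1r lerDl.
move=> x0; pose r := expR x; have r0 : 0 < r by exact: expR_gt0.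
have r1 : 1 < r by rewrite -expR0 ltr_expR.
have rd0 : 0 < r * d by rewrite mulr_gt0.
(* The dilation by r contributes r^n from the volume and r^(-n-2s) from the kernel. *)
have scal : (\int[mu]_z (log_tail (r * d) z)%:E = (r `^ (- (2 * s)))%:E * G)%E.
  have mlt := measurable_log_tail (r * d).
  have mltE : measurable_fun [set: 'rV[R]_n] (fun z => (log_tail (r * d) z)%:E).
    exact/measurable_EFinP.
  have H := @integral_rV_affine R n 0 r _ (lt0r_neq0 r0) mltE.
  have rn0 : `|r| ^+ n != 0 by rewrite expf_neq0// normr_eq0 gt_eqF.
  transitivity ((`|r| ^+ n)%:E * ((`|r| ^+ n)^-1%:E * \int[mu]_z (log_tail (r * d) z)%:E))%E.
    by rewrite muleA -EFinM mulfV// mul1e.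
  rewrite -H; last by move=> z; rewrite lee_fin log_tail_ge0.
  have E z : log_tail (r * d) (affine_rV 0 r z) = r `^ (- n%:R - 2 * s) * log_tail d z.
    rewrite /affine_rV add0r /log_tail enormZ gtr0_norm// -mulf_div divff ?gt_eqF// mul1r mulrA.
    congr (_ * _); have [dz|zd] := leP d (enorm z); last first.
      by rewrite !frac_tail_out ?mulr0// enormZ gtr0_norm// ltr_pM2l.
    by rewrite !frac_tail_in// /frac_kernel ?enormZ gtr0_norm// ?powRM ?enorm_ge0 ?(ltW r0)// ler_pM2l.
  under eq_integral do rewrite E EFinM.
  rewrite ge0_integralZl_EFin//; last 3 first.
  - by move=> z _; rewrite lee_fin log_tail_ge0.
  - by apply/measurable_EFinP; exact: measurable_log_tail.
  - exact: powR_ge0.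
  rewrite muleA -EFinM -/G gtr0_norm// -powR_mulrn ?(ltW r0)// -powRD; last first.
    by apply/implyP => _; rewrite gt_eqF.
  by congr (_ * _)%E; congr (_ `^ _)%:E; ring.
have le : (G <= x%:E * F + (r `^ (- (2 * s)))%:E * G)%E.
  rewrite -scal -ge0_integralZl_EFin//; last 3 first.
  - by move=> z _; rewrite lee_fin frac_tail_ge0.
  - by apply/measurable_EFinP; exact: measurable_frac_tail.
  - exact: ltW.
  rewrite -ge0_integralD//; last 4 first.
  - by move=> z _; rewrite -EFinM lee_fin mulr_ge0 ?frac_tail_ge0// ltW.
  - by apply/measurable_EFinP/measurable_funM => //; exact: measurable_frac_tail.
  - by move=> z _; rewrite lee_fin log_tail_ge0.
  - by apply/measurable_EFinP; exact: measurable_log_tail.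
  apply: ge0_le_integral => //.
  - by move=> z _; rewrite lee_fin log_tail_ge0.
  - by apply/measurable_EFinP; exact: measurable_log_tail.
  - apply/measurable_EFinP; apply: measurable_funD; last exact: measurable_log_tail.
    by apply: measurable_funM => //; exact: measurable_frac_tail.
  move=> z _; rewrite -EFinM -EFinD lee_fin.
  have [dz|zd] := leP d (enorm z); last first.
    by rewrite {1}/log_tail frac_tail_out// mul0r mulr0 add0r log_tail_ge0.
  have z0 : 0 < enorm z by exact: lt_le_trans dz.
  rewrite /log_tail (frac_tail_in _ dz).
  (* Beyond r d, ln (|z| / d) = x + ln (|z| / (r d)); between d and r d it is at most x. *)
  have [rz|zr] := leP (r * d) (enorm z).
    rewrite frac_tail_in// -[X in X + _]mulrC -mulrDr ler_wpM2l ?frac_kernel_ge0//.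
    by rewrite !ln_div ?posrE// lnM ?posrE// /r expRK; lra.
  rewrite [frac_tail _ (r * d) _]frac_tail_out// mul0r addr0 mulrC ler_wpM2r ?frac_kernel_ge0//.
  by rewrite -ler_expR lnK ?posrE ?divr_gt0// ler_pdivrMr// ltW.
move: le; rewrite GE FE -!EFinM -EFinD lee_fin /=.
set q := r `^ _; set g := fine G; set f := fine F => le.
have q0 : 0 < q by rewrite powR_gt0.
have qE : q = (expR (2 * s * x))^-1.
  by rewrite /q /powR gt_eqF// /r expRK mulNr expRN.
have qx : q * (1 + 2 * s * x) <= 1.
  rewrite qE mulrC ler_pdivrMr ?expR_gt0// mul1r; exact: expR_ge1Dx.
have sx0 : 0 < 1 + 2 * s * x by rewrite addr_gt0// mulr_gt0.
have h1 : (1 + 2 * s * x) * (g * (1 - q)) <= (1 + 2 * s * x) * (x * f).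
  by rewrite ler_pM2l//; rewrite -/g -/f in le; lra.
have h2 : 2 * s * x * g <= (1 + 2 * s * x) * (g * (1 - q)).
  have := ler_wpM2r g0 qx; rewrite -/g; lra.
rewrite -(ler_pM2r x0); apply: le_trans (_ : (1 + 2 * s * x) * (x * f) <= _); last first.
  by rewrite le_eqVlt; apply/orP; left; apply/eqP; ring.
by apply: le_trans h1; apply: le_trans h2; rewrite le_eqVlt; apply/orP; left; apply/eqP; ring.
Qed.

Let F_gt0 : 0 < fine F.
Proof.
apply: fine_gt0; rewrite F_lty andbT.
(* A cube of unit volume contained in {|z| >= d}, because each coordinate exceeds d. *)
pose D := [set z : 'rV[R]_n | forall i, (`]d, d + 1[%classic : set R) (z ord0 i)].
have mI (i : 'I_n) : measurable (`]d, d + 1[%classic : set R) by exact: measurable_itv.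
have mD : measurable D by exact: (measurable_rV_box mI).
have muD : mu D = 1%E.
  rewrite (lebesgue_rV_box (h := 1) mI) ?expr1n// => i.
  by rewrite lebesgue_measure_itv/= lte_fin ltrDl ltr01 -EFinB addrAC subrr add0r.
have mft : measurable_fun [set: 'rV[R]_n] (fun z => (frac_tail s d z)%:E).
  by apply/measurable_EFinP; exact: measurable_frac_tail.
apply: (@lt_le_trans _ _ (\int[mu]_(z in D) (frac_tail s d z)%:E)%E); last first.
  by apply: ge0_subset_integral => // z _; rewrite lee_fin frac_tail_ge0.
apply: pos_integral_gt0 => //; first by rewrite [X in (_ < X)%E]muD.
  exact: measurable_funTS.
move=> z Dz; have := Dz (Ordinal n0); rewrite /= in_itv/= => /andP[dz _].
have dz' : d < enorm z by apply: (lt_le_trans dz); exact: le_trans (ler_norm _) (coord_le_enorm _ _).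
by rewrite lte_fin frac_tail_in ?(ltW dz')// powR_gt0// (lt_trans d0).
Qed.

(** By the balance the gap is c ((- ln d) F - G), positive because G <= F / (2 s), F > 0 and 1 / (2
    s) < - ln d. *)
Lemma k_minus_lt_k_plus_tail : d < expR (- (2 * s)^-1) ->
  fine Km < fine (\int[mu]_z (k_plus_tail z)%:E)%E.
Proof.
move=> dlt; have Ld : (2 * s)^-1 < - ln d.
  by rewrite ltrNr -ltr_expR lnK ?posrE.
have KpE : (\int[mu]_z (k_plus_tail z)%:E = (fine (\int[mu]_z (k_plus_tail z)%:E))%:E)%E.
  rewrite fineK// ge0_fin_numE ?k_plus_tail_lty//.
  by apply: integral_ge0 => z _; rewrite lee_fin k_plus_tail_ge0.
have KmE : Km = (fine Km)%:E by rewrite fineK// ge0_fin_numE// k_minus_lty.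
have GE : G = (fine G)%:E by rewrite fineK// ge0_fin_numE.
have FE : F = (fine F)%:E by rewrite fineK// ge0_fin_numE.
have := balance; rewrite KpE KmE GE FE -!EFinM -!EFinD => -[E].
rewrite /= -(ltrD2r (c * fine G)) E ltrD2l.
rewrite -(mulrA c (- ln d)) (ltr_pM2l c0)//; apply: (le_lt_trans log_tail_le).
by rewrite mulrC ltr_pM2r.
Qed.

End small_diameter_kernels.

(** * Passing to the absolute value *)

Section absolute_value.
Context (R : realType) (n : nat).
Local Notation mu := (lebesgue_rV R n).
Local Notation mu2 := (mu \x mu)%E.
Implicit Types k u : 'rV[R]_n -> R.

Lemma lift_normr_le k u p : `|lift k (fun x => `|u x|) p| <= `|lift k u p|.
Proof. by rewrite /lift !normrM ler_wpM2r// ler_dist_dist. Qed.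

Lemma lift_normr k u : measurable_fun [set: 'rV[R]_n] k ->
  measurable_fun [set: 'rV[R]_n] u -> L2 mu2 (lift k u) ->
  L2 mu2 (lift k (fun x => `|u x|)) /\
  ip mu2 (lift k (fun x => `|u x|)) (lift k (fun x => `|u x|)) <= ip mu2 (lift k u) (lift k u).
Proof.
move=> mk mu_ Lu; apply: L2_le => //.
  by apply: measurable_lift => //; exact: (measurableT_comp (@normr_measurable R setT) mu_).
by apply: nearW => p; exact: lift_normr_le.
Qed.

Lemma normr_L2 u : L2 mu u -> L2 mu (fun x => `|u x|) /\
  ip mu (fun x => `|u x|) (fun x => `|u x|) = ip mu u u.
Proof.
move=> [mu_ uy].
have E : (\int[mu]_x (`|u x| ^+ 2)%:E = \int[mu]_x (u x ^+ 2)%:E)%E.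
  by apply: eq_integral => x _; rewrite real_normK ?num_real.
split; last by rewrite /ip -[in RHS]/(ip mu u u) /ip; congr fine; under eq_integral do rewrite -expr2;
  under [RHS]eq_integral do rewrite -expr2.
split; first exact: (measurableT_comp (@normr_measurable R setT) mu_).
by rewrite E.
Qed.

End absolute_value.

Section small_diameter.
Context (R : realType) (n : nat) (s : R) (n0 : (0 < n)%N) (s01 : 0 < s < 1).
Context (Om : set 'rV[R]_n) (d : R) (d01 : 0 < d < 1).
Context (Omd : forall x y, Om x -> Om y -> enorm (x - y) < d).
Local Notation mu := (lebesgue_rV R n).
Local Notation mu2 := (mu \x mu)%E.
Local Notation dom := (@form_domain R n s s01 Om).
Local Notation c := (c_ns n s).
Implicit Types (u w : dom) (f g : 'rV[R]_n -> R).

Let beta_ge0 : 0 <= b_ns n s -> 0 <= b_ns n s * c / 2.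
Proof.
by move=> b0; apply: divr_ge0 => //; apply: mulr_ge0 => //; apply: ltW; exact: c_ns_gt0.
Qed.

(* Two points of Om are closer than d, so the cross term never meets g. *)
Lemma lift_far_kernel f g : measurable_fun [set: 'rV[R]_n] g -> (forall z, 0 <= g z) ->
  (\int[mu]_z (g z)%:E < +oo)%E -> (forall z, enorm z < d -> g z = 0) ->
  L2 mu f -> {ae mu, forall x, ~ Om x -> f x = 0} ->
  ip mu2 (lift g f) (lift g f) = 2 * fine (\int[mu]_z (g z)%:E)%E * ip mu f f.
Proof.
move=> mg g0 gy gd Lf f0; have [mf _] := Lf.
set G := fine _; have GE : (\int[mu]_z (g z)%:E = G%:E)%E.
  by rewrite /G fineK// ge0_fin_numE// integral_ge0// => z _; rewrite lee_fin.
have [Lg _] := lift_conv_le mg g0 gy Lf.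
pose a x := (f x ^+ 2)%:E.
have ma : measurable_fun [set: 'rV[R]_n] a by exact/measurable_EFinP/measurable_funX.
have a0 x : (0 <= a x)%E by rewrite lee_fin sqr_ge0.
have mgE : measurable_fun [set: 'rV[R]_n] (EFin \o g) by exact/measurable_EFinP.
have gE0 z : (0 <= (g z)%:E)%E by rewrite lee_fin.
have aE : (\int[mu]_x a x = (ip mu f f)%:E)%E by rewrite -EFin_ip_sqr.
have m1 : measurable_fun [set: 'rV[R]_n * 'rV[R]_n] (fun p => a p.1 * (g (p.1 - p.2))%:E)%E.
  apply: emeasurable_funM; first exact: (measurableT_comp ma measurable_fst).
  exact: (measurableT_comp mgE (@measurable_rV_sub R n)).
have m2 : measurable_fun [set: 'rV[R]_n * 'rV[R]_n] (fun p => a p.2 * (g (p.1 - p.2))%:E)%E.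
  apply: emeasurable_funM; first exact: (measurableT_comp ma measurable_snd).
  exact: (measurableT_comp mgE (@measurable_rV_sub R n)).
apply: EFin_inj; rewrite -EFin_ip_sqr//.
transitivity (\int[mu2]_p (a p.1 * (g (p.1 - p.2))%:E + a p.2 * (g (p.1 - p.2))%:E))%E.
  apply: ae_eq_integral => //.
  - by apply/measurable_EFinP/measurable_funX; case: Lg.
  - exact: emeasurable_funD.
  apply: filterS (ae_prod f0) => p [p1 p2] _.
  rewrite -!EFinM -EFinD; congr EFin; rewrite expr2 lift_mul// -mulrDl.
  have [H1|H1] := pselect (Om p.1); last by rewrite p1//; ring.
  have [H2|H2] := pselect (Om p.2); last by rewrite p2//; ring.
  by rewrite gd ?mulr0//; exact: Omd.
rewrite ge0_integralD//; last 2 first.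
- by move=> p _; rewrite mule_ge0.
- by move=> p _; rewrite mule_ge0.
rewrite (integral_conv1 ma mgE a0 gE0) (integral_conv2 ma mgE a0 gE0) aE.
rewrite (_ : \int[mu]_x (EFin \o g) x = G%:E)%E//.
by rewrite -EFinM -EFinD; congr EFin; ring.
Qed.

(** [k_minus] vanishes for |z| < 1, in particular for |z| < d, so it is a far kernel as a whole;
    [k_plus] is one only after truncation, whence an inequality in its case. *)
Lemma form_minus_far u :
  form_minus u u = 2 * fine (\int[mu]_z (@k_minus R n s z)%:E)%E * form_D u u.
Proof.
apply: lift_far_kernel.
- exact: measurable_k_minus.
- exact: k_minus_ge0.
- exact: k_minus_lty.
- by move=> z zd; apply: k_minus_small; apply: (lt_trans zd); case/andP: d01.
- exact: domain_L2.
- exact: domain_ae0.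
Qed.

Lemma form_plus_far u :
  2 * fine (\int[mu]_z (@k_plus_tail R n s d z)%:E)%E * form_D u u <= form_plus u u.
Proof.
have mk := @measurable_k_plus_tail R n s d.
rewrite -(lift_far_kernel mk); last 5 first.
- exact: k_plus_tail_ge0.
- exact: k_plus_tail_lty.
- exact: k_plus_tail_out.
- exact: domain_L2.
- exact: domain_ae0.
apply: (L2_le _ (domain_L2_plus u) _).2.
  by apply: measurable_lift => //; case: (domain_L2 u).
apply: nearW => p; rewrite /lift !normrM ler_wpM2l// !ger0_norm ?sqrtr_ge0//.
by rewrite ler_wsqrtr// k_plus_tail_le.
Qed.

Lemma form_B_positive : d < expR (- (2 * s)^-1) -> 0 <= b_ns n s ->
  exists2 delta : R, 0 < delta & forall u, delta * form_D u u <= form_B u u.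
Proof.
move=> dlt b0; have := k_minus_lt_k_plus_tail n0 s01 d01 dlt.
set Km := fine _; set Kp := fine _ => KK.
exists (2 * (Kp - Km)); first by rewrite mulr_gt0// subr_gt0.
move=> u; rewrite /form_B form_minus_far -/Km.
have := form_plus_far u; rewrite -/Kp => H.
have h : 0 <= b_ns n s * c / 2 * form_frac u u.
  by apply: mulr_ge0; [exact: beta_ge0|exact: ip_ge0].
by rewrite mulrBr mulrBl; lra.
Qed.

(** Taking absolute values shrinks every increment, which is the wrong direction for the subtracted
    form. But [form_minus_far] makes that form a multiple of the L^2 norm, hence unchanged, and b >=
    0 settles the fractional term. *)
Lemma form_B_normr u : 0 <= b_ns n s ->
  exists w, [/\ forall x, w x = `|u x|, form_D w w = form_D u u & form_B w w <= form_B u u].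
Proof.
move=> b0; have [mu_ _] := domain_L2 u.
have [Lw wE] := normr_L2 (domain_L2 u).
have mkp := @measurable_k_plus R n s.
have mkf := @measurable_frac_kernel R n s.
have [Lp lp] := lift_normr mkp mu_ (domain_L2_plus u).
have [_ lf] := lift_normr mkf mu_ (domain_L2_frac u).
have Hw : admissible s Om (fun x => `|u x|).
  split=> //; apply: filterS (domain_ae0 u) => x ux Omx.
  by rewrite ux// normr0.
exists (to_domain s01 Hw); split=> //.
rewrite /form_B !form_minus_far -[form_D (to_domain _ _) _]/(ip mu (fun x => `|u x|) (fun x => `|u x|)) wE.
apply: lerD; first by rewrite lerD2r.
by apply: ler_wpM2l => //; exact: beta_ge0.
Qed.

End small_diameter.

(** * Fourier series in L^2 *)

Section fourier_series.
Context (R : realType) (V : lmodType R) (Q : V -> V -> R).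
Context (Qsym : forall u v, Q u v = Q v u).
Context (Qlin : forall a u v w, Q (a *: u + v) w = a * Q u w + Q v w).
Context (Q0 : forall u, 0 <= Q u u).
Context (e : nat -> V) (eon : forall i j, Q (e i) (e j) = (i == j)%:R).

Definition fourier_sum f k : V := \sum_(i < k) Q f (e i) *: e i.

Let sigma f k : R := \sum_(i < k) Q f (e i) ^+ 2.

Lemma fourier_sum_coef f k i : Q (fourier_sum f k) (e i) = if (i < k)%N then Q f (e i) else 0.
Proof.
rewrite /fourier_sum (form_suml Qlin).
under eq_bigr do rewrite (formZl Qlin) eon.
case: ltnP => ik.
  rewrite (bigD1 (Ordinal ik))//= eqxx mulr1 big1 ?addr0// => j ji.
  by rewrite (_ : (_ == _) = false) ?mulr0//; apply: contraNF ji => /eqP ji; exact/eqP/val_inj.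
by rewrite big1// => j _; rewrite (_ : (_ == _) = false) ?mulr0//; apply/negbTE; rewrite neq_ltn (leq_trans (ltn_ord j)).
Qed.

Let fourier_sumE f i j : (i <= j)%N -> Q (fourier_sum f i) (fourier_sum f j) = sigma f i.
Proof.
move=> ij; rewrite {1}/fourier_sum (form_suml Qlin); apply: eq_bigr => k _.
by rewrite (formZl Qlin) (Qsym (e k)) fourier_sum_coef (leq_trans (ltn_ord k))// expr2.
Qed.

Let sigma_le f k : sigma f k <= Q f f.
Proof.
have := Q0 (f - fourier_sum f k); rewrite (formBB Qsym Qlin) fourier_sumE//.
rewrite (_ : Q f (fourier_sum f k) = sigma f k); first by lra.
by rewrite (form_sumr Qsym Qlin); apply: eq_bigr => i _; rewrite (formZr Qsym Qlin) expr2.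
Qed.

(** The squared distance of two partial sums is a difference of partial sums of squared
    coefficients, which increase and are bounded by Bessel's inequality. *)
Lemma fourier_sum_cauchy f (eps : R) : 0 < eps -> exists N, forall i j, (N <= i)%N -> (N <= j)%N ->
  Q (fourier_sum f i - fourier_sum f j) (fourier_sum f i - fourier_sum f j) < eps.
Proof.
move=> eps0.
have nd : nondecreasing_seq (sigma f).
  apply/nondecreasing_seqP => k; rewrite /sigma big_ord_recr/= lerDl; exact: sqr_ge0.
have cv : cvgn (sigma f).
  by apply: nondecreasing_is_cvgn => //; exists (Q f f) => _ [k _ <-]; exact: sigma_le.
have e2 : 0 < eps / 2 by rewrite divr_gt0.
have /cvgrPdist_lt/(_ _ e2)[N _ HN] := cv.
exists N => i j Ni Nj.
have H a b : (N <= a)%N -> (a <= b)%N ->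
    Q (fourier_sum f a - fourier_sum f b) (fourier_sum f a - fourier_sum f b) < eps.
  move=> Na ab; rewrite (formBB Qsym Qlin) !fourier_sumE//.
  have := HN _ Na; have := HN _ (leq_trans Na ab).
  by rewrite /= !ltr_norml => /andP[h1 h2] /andP[h3 h4]; lra.
case/orP: (leq_total i j) => ij; first exact: H.
have := H _ _ Nj ij; rewrite !(formBB Qsym Qlin) (Qsym (fourier_sum f j)); lra.
Qed.

Lemma fourier_limit_coef f v k :
  Q (fourier_sum f i - v) (fourier_sum f i - v) @[i --> \oo] --> 0 -> Q v (e k) = Q f (e k).
Proof.
move=> Sv; have := @form_cvgl _ _ Q Qsym Qlin Q0 _ _ (e k) Sv.
move=> /cvg_lim <-//; apply/cvg_lim => //.
apply: cvg_near_cst; near=> i; rewrite fourier_sum_coef ifT//.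
by near: i; exists k.+1.
Unshelve. all: end_near. Qed.

(** Lets an L^2 function orthogonal to the eigenfunctions be tested against the form domain, whose
    elements are approximated by their combinations. *)
Lemma orthogonal_dense h phi : (forall k, Q h (e k) = 0) ->
  (forall eps : R, 0 < eps -> exists m (a : nat -> R),
    Q (phi - \sum_(i < m) a i *: e i) (phi - \sum_(i < m) a i *: e i) < eps) ->
  Q h phi = 0.
Proof.
move=> he dense; apply/eqP; rewrite -normr_le0; apply/ler_addgt0Pr => eps eps0; rewrite add0r.
have h1 : 0 < Num.sqrt (Q h h) + 1 by rewrite ltr_wpDl// sqrtr_ge0.
have d0 : 0 < eps / (Num.sqrt (Q h h) + 1) by rewrite divr_gt0.
have [m [a Ha]] := dense _ (exprn_gt0 2 d0).
set S := \sum_(i < m) _ in Ha.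
have -> : Q h phi = Q h (phi - S).
  rewrite (formBr Qsym Qlin) (form_sumr Qsym Qlin) big1 ?subr0// => i _.
  by rewrite (formZr Qsym Qlin) he mulr0.
apply: (le_trans (form_cauchy_schwarz Qsym Qlin Q0 _ _)).
have : Num.sqrt (Q (phi - S) (phi - S)) <= eps / (Num.sqrt (Q h h) + 1).
  rewrite -[leRHS]ger0_norm ?(ltW d0)// -sqrtr_sqr ler_wsqrtr//; exact: ltW.
move=> /(ler_wpM2l (sqrtr_ge0 (Q h h))) /le_trans; apply.
rewrite mulrCA ler_piMr ?(ltW eps0)// ler_pdivrMr// mul1r lerDl//.
Qed.

End fourier_series.

Section L2_space.
Context d (T : measurableType d) (R : realType) (m : {measure set T -> \bar R}).
Local Notation W := (T -> R).

(** All of L^2 as a module: the function to be expanded lies in general outside the form domain, so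
    the Fourier lemmas need this larger space. *)
Definition L2_space_pred : {pred W} := fun u => `[< L2 m u >].

Lemma L2_space_submod : submod_closed (L2_space_pred).
Proof.
split; first by apply/asboolP; exact: L2_0.
by move=> a u v /asboolP Lu /asboolP Lv; apply/asboolP; exact: L2_lin.
Qed.

HB.instance Definition _ := GRing.isSubmodClosed.Build R W (L2_space_pred) L2_space_submod.

Record L2_space := L2Space { L2_val :> W; L2_valP : L2_val \in L2_space_pred }.

HB.instance Definition _ := [isSub for L2_val].
HB.instance Definition _ := [Choice of L2_space by <:].
HB.instance Definition _ := [SubChoice_isSubLmodule of L2_space by <:].

Lemma L2_spaceP (u : L2_space) : L2 m u.
Proof. by case: u => u /= /asboolP. Qed.

Definition to_L2 u (Hu : L2 m u) : L2_space := @L2Space u (introT (asboolP _) Hu).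

Lemma L2_val_sum I (r : seq I) (P : pred I) (F : I -> L2_space) :
  L2_val (\sum_(i <- r | P i) F i) = \sum_(i <- r | P i) L2_val (F i).
Proof. exact: (big_morph L2_val). Qed.

Definition L2_form (u v : L2_space) : R := ip m u v.

Lemma L2_form_sym u v : L2_form u v = L2_form v u. Proof. exact: ipC. Qed.

Lemma L2_form_lin a u v w : L2_form (a *: u + v) w = a * L2_form u w + L2_form v w.
Proof. by apply: ip_lin; exact: L2_spaceP. Qed.

Lemma L2_form_ge0 u : 0 <= L2_form u u. Proof. exact: ip_ge0. Qed.

End L2_space.

(** * The eigenvalue problem *)

Section restriction.
Context (R : realType) (n : nat) (Om : set 'rV[R]_n) (mOm : measurable Om).
Local Notation mu := (lebesgue_rV R n).
Implicit Types f g : 'rV[R]_n -> R.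

Lemma restrict_ae f : {ae mu, forall x, ~ Om x -> f x = 0} ->
  {ae mu, forall x, (f \_ Om) x = f x}.
Proof.
apply: filterS => x fx; have [Ox|nOx] := pselect (Om x); first by rewrite patchE mem_set.
by rewrite patchE memNset// fx.
Qed.

Lemma measurable_restrict_fun f : measurable_fun [set: 'rV[R]_n] f ->
  measurable_fun [set: 'rV[R]_n] (f \_ Om).
Proof. by move=> mf; by apply/(measurable_restrictT f mOm); exact: measurable_funTS. Qed.

Lemma L2_restrict f : L2 mu f -> {ae mu, forall x, ~ Om x -> f x = 0} ->
  L2 mu (f \_ Om) /\ ip mu (f \_ Om) (f \_ Om) = ip mu f f.
Proof.
move=> [mf fy] f0; have mr := measurable_restrict_fun mf.
have fr := restrict_ae f0; split; last exact: ip_ae_eq.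
by apply: (L2_le mr (conj mf fy) _).1; apply: filterS fr => x ->.
Qed.

Lemma dotL2_ip f g : L2 mu f -> L2 mu g -> {ae mu, forall x, ~ Om x -> g x = 0} ->
  dotL2 Om f g = (ip mu f g)%:E.
Proof.
move=> Lf Lg g0; rewrite -EFin_ip// /dotL2 [LHS]integral_mkcond.
have [mf _] := Lf; have [mg _] := Lg.
apply: ae_eq_integral => //.
- apply/(measurable_restrictT _ mOm); apply: measurable_funTS.
  by apply/measurable_EFinP; exact: measurable_funM.
- by apply/measurable_EFinP; exact: measurable_funM.
apply: filterS g0 => x gx _; have [Ox|nOx] := pselect (Om x); first by rewrite patchE mem_set.
by rewrite patchE memNset// gx// mulr0.
Qed.

Lemma Lnorm2_ip d (T : measurableType d) (m : {measure set T -> \bar R}) (f : T -> R) :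
  L2 m f -> ('N[m]_2%:E[EFin \o f] = (Num.sqrt (ip m f f))%:E)%E.
Proof.
move=> Lf; have : ('N[m]_2%:E[EFin \o f] `^ 2 = (ip m f f)%:E)%E.
  rewrite poweR_Lnorm// -EFin_ip_sqr//; apply: eq_integral => x _ /=.
  by rewrite powR_mulrn// real_normK ?num_real.
have := Lnorm_ge0 m 2%:E (EFin \o f); case: ('N[m]_2%:E[_])%E => [r|//|//].
  rewrite lee_fin => r0; rewrite poweR_EFin powR_mulrn// => -[<-].
  by rewrite sqrtr_sqr ger0_norm.
by rewrite poweRyr.
Qed.

End restriction.

Section bounded_domain.
Context (R : realType) (n : nat) (s : R) (n0 : (0 < n)%N) (s01 : 0 < s < 1).
Context (Om : set 'rV[R]_n) (oOm : open Om) (Om0 : Om !=set0).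
Context (M : R) (M0 : 0 < M) (OmM : forall x, Om x -> enorm x < M).
Local Notation mu := (lebesgue_rV R n).
Local Notation dom := (@form_domain R n s s01 Om).
Local Notation form_B := (@form_B R n s s01 Om).
Local Notation form_D := (@form_D R n s s01 Om).

Let mOm : measurable Om. Proof. exact: open_rV_measurable. Qed.

Let Omy : (mu Om < +oo)%E.
Proof.
apply: le_lt_trans (ltry (2 ^+ n * M `^ n%:R)).
apply: le_trans (lebesgue_rV_ball_le _ M0); apply: le_measure; rewrite ?inE//.
rewrite (_ : [set _ | _] = @enorm R n @^-1` `]-oo, M[%classic).
  by rewrite -[X in measurable X]setTI; exact: measurable_enorm.
by apply/seteqP; split => z; rewrite /= in_itv.
Qed.

Let OmT : exists y, ~ Om y.
Proof.
exists (const_mx M) => /OmM; apply/negP; rewrite -leNgt.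
by have := coord_le_enorm (const_mx M : 'rV[R]_n) (Ordinal n0); rewrite mxE gtr0_norm.
Qed.

(** Two stages: a first minimizer exists, and any first minimizer starts a full sequence. In between
    the caller may exchange the minimizer for another one. *)
Lemma domain_spectral :
  (exists2 u0 : dom, form_D u0 u0 = 1 & forall w, form_B u0 u0 * form_D w w <= form_B w w) /\
  (forall u0 : dom, form_D u0 u0 = 1 -> (forall w, form_B u0 u0 * form_D w w <= form_B w w) ->
  exists (lam : nat -> R) (xi : nat -> dom),
    [/\ xi 0%N = u0, forall i j, form_D (xi i) (xi j) = (i == j)%:R,
        forall k, form_B (xi k) (xi k) = lam k /\
          forall w, (forall i, (i < k)%N -> form_D w (xi i) = 0) -> lam k * form_D w w <= form_B w w,
        nondecreasing_seq lam &
    [/\ forall k w, form_B (xi k) w = lam k * form_D (xi k) w,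
        lam k @[k --> \oo] --> +oo &
        forall f (eps : R), 0 < eps -> exists m (a : nat -> R),
          form_D (f - \sum_(i < m) a i *: xi i) (f - \sum_(i < m) a i *: xi i) < eps]]).
Proof.
have [kappa k0 [C C0 HC]] := form_coercive s01 Om.
have A0 u : 0 <= shifted_form form_B form_D kappa u u.
  rewrite /shifted_form; have [h _] := HC u; apply: le_trans h.
  by rewrite addr_ge0 ?form_D_ge0// divr_ge0 ?form_plus_ge0.
have complete (u : nat -> dom) :
    (forall eps : R, 0 < eps -> exists N, forall i j, (N <= i)%N -> (N <= j)%N ->
      shifted_form form_B form_D kappa (u i - u j) (u i - u j) + form_D (u i - u j) (u i - u j) < eps) ->
    exists v, shifted_form form_B form_D kappa (u i - v) (u i - v) + form_D (u i - v) (u i - v)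
      @[i --> \oo] --> 0.
  move=> cau; have [|v Hv] := @domain_complete _ _ _ s01 _ mOm Omy u.
    move=> eps eps0; have [|N HN] := cau (eps / 2); first by rewrite divr_gt0.
    exists N => i j Ni Nj; have := HN _ _ Ni Nj; have [+ _] := HC (u i - u j).
    rewrite /shifted_form.
    have := form_D_ge0 (u i - u j); have := form_plus_ge0 (u i - u j).
    set a := form_plus _ _; set b := form_D _ _; set c := form_B _ _; lra.
  exists v; apply/cvgrPdist_le => eps eps0.
  have C1 : 0 < 2 * C + 1 by rewrite ltr_wpDl// mulr_ge0.
  have [|N HN] := Hv (eps / (2 * C + 1)); first by rewrite divr_gt0.
  exists N => // i Ni; have [h1 h2] := HN _ Ni; have [_ h3] := HC (u i - v).
  have D0 := form_D_ge0 (u i - v).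
  rewrite sub0r normrN ger0_norm; last by apply: addr_ge0; [exact: A0|].
  apply: (le_trans (lerD h3 (lexx _))).
  have e1 : (2 * C + 1) * (eps / (2 * C + 1)) = eps by rewrite mulrCA divff ?mulr1// gt_eqF.
  have := ler_wpM2l C0 h1; have := ler_wpM2l C0 h2; rewrite -{3}e1; lra.
have comp (eps : R) : 0 < eps -> exists (I : finType) (l : I -> dom -> R) (C : R),
    [/\ forall q u v, l q (u - v) = l q u - l q v,
        forall q u, l q u ^+ 2 <= C * form_D u u
      & forall u, form_D u u <= eps * shifted_form form_B form_D kappa u u + \sum_q l q u ^+ 2].
  move=> eps0; have e2 : 0 < eps / 2 by rewrite divr_gt0.
  have [I [l [C' [h1 h2 h3]]]] := domain_compact_embedding s01 n0 OmM e2.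
  exists I; exists l; exists C'; split => // u; apply: (le_trans (h3 u)); rewrite lerD2r.
  rewrite -mulrA ler_wpM2l ?(ltW eps0)//; have [+ _] := HC u.
  rewrite /shifted_form; have := form_D_ge0 u; rewrite mulrC; lra.
have on := exists_orthonormal s01 n0 oOm Om0 Omy OmT.
have [[l0 u0] [_ /= D1 Bl H]] := @exists_minimizer _ _ form_B form_D kappa (@form_B_sym _ _ _ _ _)
  (@form_D_sym _ _ _ _ _) (@form_B_lin _ _ _ _ _) (@form_D_lin _ _ _ _ _) (@form_D_ge0 _ _ _ _ _)
  A0 complete comp on [::].
split; first by exists u0 => // w; rewrite Bl; apply: H.
exact: (@spectral_decomposition _ _ form_B form_D kappa (@form_B_sym _ _ _ _ _)
  (@form_D_sym _ _ _ _ _) (@form_B_lin _ _ _ _ _) (@form_D_lin _ _ _ _ _) (@form_D_ge0 _ _ _ _ _)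
  A0 complete comp on).
Qed.

(** The Fourier sums of g converge in L^2 to some v. The difference g - v is orthogonal to every xi
    k, hence to the form domain, hence 0 almost everywhere. *)
Lemma domain_basis (xi : nat -> dom) : (forall i j, form_D (xi i) (xi j) = (i == j)%:R) ->
  (forall f (eps : R), 0 < eps -> exists m (a : nat -> R),
     form_D (f - \sum_(i < m) a i *: xi i) (f - \sum_(i < m) a i *: xi i) < eps) ->
  orthonormal_basis_L2 Om xi.
Proof.
move=> on dense.
have Lxi i := domain_L2 (xi i); have xi0 i := domain_ae0 (xi i).
split.
- by move=> i; apply/Lfun2P; exact: (L2_restrict mOm (Lxi i) (xi0 i)).1.
- by move=> i j; rewrite (dotL2_ip mOm)// -on.
move=> f /Lfun2P Lf eps eps0.
pose g : 'rV[R]_n -> R := f \_ Om; have g0 x : ~ Om x -> g x = 0.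
  by move=> nO; rewrite /g patchE memNset.
pose e i := to_L2 (Lxi i); pose G : L2_space mu := to_L2 (Lf : L2 mu g).
pose Q := @L2_form _ _ _ mu.
have Qs : forall u v, Q u v = Q v u := @L2_form_sym _ _ _ mu.
have Ql : forall a u v w, Q (a *: u + v) w = a * Q u w + Q v w := @L2_form_lin _ _ _ mu.
have Q0 : forall u, 0 <= Q u u := @L2_form_ge0 _ _ _ mu.
have eon i j : Q (e i) (e j) = (i == j)%:R by rewrite -on.
pose S := fourier_sum Q e G.
have SE k x : S k x = \sum_(i < k) Q G (e i) * xi i x.
  rewrite /S /fourier_sum.
  have -> : L2_val (\sum_(i < k) Q G (e i) *: e i) = \sum_(i < k) Q G (e i) *: (xi i : 'rV[R]_n -> R).
    by rewrite L2_val_sum.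
  by rewrite fct_sumE.
have LS k : L2 mu (S k) by exact: L2_spaceP.
have S0 k : {ae mu, forall x, ~ Om x -> S k x = 0}.
  have : {ae mu, forall x, forall i, ~ Om x -> xi i x = 0} by apply/ae_foralln.
  by apply: filterS => x H Ox; rewrite SE big1// => i _; rewrite H// mulr0.
have cau (e0 : R) : 0 < e0 -> exists N, forall i j, (N <= i)%N -> (N <= j)%N ->
    ip mu (fun x => S i x - S j x) (fun x => S i x - S j x) < e0.
  exact: (fourier_sum_cauchy Qs Ql Q0 eon).
have [v [h [mv v0 hk hv]]] := L2_cauchy_cvg mOm Omy LS S0 cau.
have [Lv Sv] := L2_ae_limit LS mv hk hv cau.
pose V := to_L2 Lv.
have SV : Q (S k - V) (S k - V) @[k --> \oo] --> 0.
  apply/cvgrPdist_le => e0 e00; have [N HN] := Sv _ e00.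
  by exists N => // k Nk; rewrite sub0r normrN ger0_norm//; exact: HN.
have GV k : Q (G - V) (e k) = 0.
  by rewrite (formBl Ql) (fourier_limit_coef Qs Ql Q0 eon k SV) subrr.
have gv0 : {ae mu, forall x, g x - v x = 0}.
  apply: (@orthogonal_ae0 _ _ _ s01 _ oOm Omy OmT (fun x => g x - v x)).
  - exact: L2_sub.
  - by move=> x nO; rewrite g0// v0// subrr.
  move=> phi; apply: (@orthogonal_dense _ _ Q Qs Ql Q0 e (G - V) (to_L2 (domain_L2 phi)) GV).
  move=> e0 e00; have [m [a Ha]] := dense phi _ e00; exists m, a.
  rewrite (_ : Q _ _ = form_D (phi - \sum_(i < m) a i *: xi i) (phi - \sum_(i < m) a i *: xi i))//.
  have E : L2_val (to_L2 (domain_L2 phi) - \sum_(i < m) a i *: e i) =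
      form_val (phi - \sum_(i < m) a i *: xi i).
    rewrite -[LHS]/(form_val phi - L2_val (\sum_(i < m) a i *: e i)).
    by rewrite -[RHS]/(form_val phi - form_val (\sum_(i < m) a i *: xi i)) L2_val_sum form_val_sum.
  by rewrite /Q /L2_form /form_D E.
have e2 : 0 < eps ^+ 2 / 2 by rewrite divr_gt0// exprn_gt0.
have [k Hk] := Sv _ e2; exists k, (fun i => Q G (e i)).
have LgS : L2 mu (fun x => g x - S k x) by exact: L2_sub.
have gS0 : {ae mu, forall x, ~ Om x -> g x - S k x = 0}.
  by apply: filterS (S0 k) => x H nO; rewrite H// g0// subrr.
have [Lr rE] := L2_restrict mOm LgS gS0.
rewrite /normL2.
have -> : EFin \o (fun x => f x - \sum_(i < k) Q G (e i) * xi i x) \_ Om =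
    EFin \o ((fun x => g x - S k x) \_ Om).
  apply/funext => x; rewrite /= /patch; case: ifPn => // Ox.
  by rewrite SE /g patchE Ox.
rewrite Lnorm2_ip// lte_fin rE.
have mg : measurable_fun [set: 'rV[R]_n] g by case: (Lf).
have -> : ip mu (fun x => g x - S k x) (fun x => g x - S k x) =
    ip mu (fun x => S k x - v x) (fun x => S k x - v x).
  have mS : measurable_fun [set: 'rV[R]_n] (S k) by case: (LS k).
  have mSv : measurable_fun [set: 'rV[R]_n] (fun x => S k x - v x) by exact: measurable_funB.
  transitivity (ip mu (fun x => - (S k x - v x)) (fun x => - (S k x - v x))).
    have mN : measurable_fun [set: 'rV[R]_n] (fun x => - (S k x - v x)) by exact: measurable_funN.
    have mgS : measurable_fun [set: 'rV[R]_n] (fun x => g x - S k x) by exact: measurable_funB.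
    by apply: ip_ae_eq => //; apply: filterS gv0 => x /eqP; rewrite subr_eq0 => /eqP ->; rewrite opprB.
  by congr fine; apply: eq_integral => x _; rewrite mulrNN.
rewrite -[ltRHS]ger0_norm ?(ltW eps0)// -sqrtr_sqr ltr_sqrt ?exprn_gt0//.
apply: (le_lt_trans (Hk _ (leqnn _))).
by rewrite ltr_pdivrMr// ltr_pMr ?exprn_gt0// ltr1n.
Qed.

End bounded_domain.

Section main.
Context (R : realType) (n : nat) (s : R) (n0 : (0 < n)%N) (s01 : 0 < s < 1).
Context (Om : set 'rV[R]_n) (M : R) (OmM : forall x, Om x -> enorm x < M).
Local Notation mu := (lebesgue_rV R n).
Local Notation dom := (@form_domain R n s s01 Om).
Implicit Types u w : dom.

Lemma enorm_sub_le_diam x y : Om x -> Om y -> enorm (x - y) <= diam Om.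
Proof.
move=> Ox Oy; apply: ub_le_sup; last by exists x => //; exists y.
exists (n%:R * (M + M)) => _ [a Oa [b Ob <-]].
have ca i := le_lt_trans (coord_le_enorm a i) (OmM Oa).
have cb i := le_lt_trans (coord_le_enorm b i) (OmM Ob).
apply: enorm_le.
  move=> i; rewrite !mxE; apply: (le_trans (ler_normB _ _)).
  by rewrite lerD ?ltW.
have M0 : 0 <= M by apply: (le_trans (enorm_ge0 a)); exact/ltW/OmM.
exact: addr_ge0.
Qed.

(** The midpoint leaves room on both sides: distances in Om may attain the diameter, while the
    far-kernel argument wants them strictly below d. *)
Lemma diam_lt_expR : diam Om < expR (- (1 / (2 * s))) -> Om !=set0 ->
  exists d : R, [/\ 0 < d < 1, d < expR (- (2 * s)^-1) &
    forall x y, Om x -> Om y -> enorm (x - y) < d].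
Proof.
rewrite div1r => dlt [x0 Ox0]; have s0 : 0 < s by case/andP: s01.
set e := expR _ in dlt *.
have e0 : 0 < e by exact: expR_gt0.
have e1 : e < 1 by rewrite -expR0 ltr_expR oppr_lt0 invr_gt0 mulr_gt0.
have d0 : 0 <= diam Om by apply: le_trans (enorm_sub_le_diam Ox0 Ox0); exact: enorm_ge0.
exists ((diam Om + e) / 2); split; [lra|lra|].
by move=> x y Ox Oy; have := enorm_sub_le_diam Ox Oy; lra.
Qed.

Lemma domain_H0 u : H0 s Om u. Proof. exact/(H0P s01)/form_domainP. Qed.

End main.

Theorem theorem1p5 (R : realType) (n : nat) (s : R) (Omega : set 'rV[R]_n) :
  (1 <= n)%N -> 0 < s < 1 -> bounded_lipschitz_domain Omega ->
  exists (lam : nat -> R) (xi : nat -> 'rV[R]_n -> R),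
    [/\ nondecreasing_seq lam,
        forall k, eigenfunction s Omega (lam k) (xi k),
        forall k, is_minimum
          [set E_sLog s u u | u in
             [set u | Hk s Omega xi k u /\ normL2 Omega u = 1%E]] (lam k)%:E,
        lam k @[k --> \oo] --> +oo
      & orthonormal_basis_L2 Omega xi /\
        (diam Omega < expR (- (1 / (2 * s))) -> 0 <= b_ns n s ->
          0 < lam 0%N /\ {ae lebesgue_rV R n, forall x, 0 <= xi 0%N x})].
Proof.
move=> n0 s01 [oOm _ Om0 [M' OmM'] _].
pose M := `|M'| + 1; have M0 : 0 < M by rewrite ltr_wpDl.
have OmM x : Omega x -> enorm x < M.
  by move=> /OmM' /le_lt_trans; apply; rewrite /M (le_lt_trans (ler_norm _))// ltrDl.
have mOm : measurable Omega by exact: open_rV_measurable.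
case: (domain_spectral n0 s01 oOm Om0 M0 OmM) => -[u1 u11 u1min] spec.
pose small := diam Omega < expR (- (1 / (2 * s))) /\ 0 <= b_ns n s.
(* The first minimizer is fixed here, before the sequence is built; without the smallness assumption
   any minimizer serves. *)
have [u0 [u01 u0min u0small]] : exists u0 : form_domain s01 Omega,
    [/\ form_D u0 u0 = 1, forall w : form_domain s01 Omega, form_B u0 u0 * form_D w w <= form_B w w &
      small -> 0 < form_B u0 u0 /\ forall x, 0 <= u0 x].
  have [[dlt b0]|nsmall] := pselect small; last by exists u1.
  have [d [d01 de Omd]] := diam_lt_expR s01 OmM dlt Om0.
  have [delta delta0 Hdelta] := form_B_positive n0 s01 d01 Omd de b0.
  have [w [wE wD wB]] := form_B_normr d01 Omd u1 b0.
  (* w has the same L^2 norm as u1 and no larger form; minimality of u1 gives the reverse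
     inequality, so w is a minimizer too. *)
  have wu : form_B w w = form_B u1 u1.
    by apply/le_anti; rewrite wB/= -[leLHS]mulr1 -u11 -wD u1min.
  exists w; split; [by rewrite wD|by move=> v; rewrite wu|move=> _; split].
    by apply: lt_le_trans (Hdelta w); rewrite wD u11 mulr1.
  by move=> x; rewrite wE.
have [lam [xi [xi0 on mini nd [eig lamoo dense]]]] := spec u0 u01 u0min.
exists lam, (fun k => xi k : 'rV[R]_n -> R).
have H0_dom u : H0 s Omega u -> exists w : form_domain s01 Omega, u = w.
  by move=> /(H0P s01) Hu; exists (to_domain s01 Hu).
have dotE (u w : form_domain s01 Omega) : dotL2 Omega u w = (form_D u w)%:E.
  by rewrite dotL2_ip//; [exact: domain_L2|exact: domain_L2|exact: domain_ae0].
have normE (u : form_domain s01 Omega) : normL2 Omega u = (Num.sqrt (form_D u u))%:E.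
  have [Lr rE] := L2_restrict mOm (domain_L2 u) (domain_ae0 u).
  by rewrite -[form_D u u]rE -Lnorm2_ip.
split => //.
- move=> k; split.
  + exact: domain_H0.
  + move=> xik0; have [mxi _] := domain_L2 (xi k).
    have : form_D (xi k) (xi k) = ip (lebesgue_rV R n) (fun=> 0) (fun=> 0).
      by apply: ip_ae_eq.
    rewrite on eqxx /ip; under eq_integral do rewrite mulr0.
    by rewrite integral0 /=; apply/eqP; rewrite oner_eq0.
  + by move=> phi /H0_dom[w ->]; rewrite E_sLogE dotE eig EFinM.
- move=> k; have [Bk mink] := mini k; split.
  + exists (xi k); last by rewrite E_sLogE Bk.
    split; last by rewrite normE on eqxx sqrtr1.
    split; first exact: domain_H0.
    by move=> i ik; rewrite dotE on gtn_eqF.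
  + move=> _ [u [[/H0_dom[w ->] orth] nw] <-].
    rewrite E_sLogE lee_fin.
    have w1 : form_D w w = 1.
      move: nw; rewrite normE => -[w1].
      by rewrite -[LHS]sqr_sqrtr ?form_D_ge0// w1 expr1n.
    rewrite -[leLHS]mulr1 -w1; apply: mink => i ik.
    by have := orth i ik; rewrite dotE => -[].
split; first exact: (domain_basis n0 oOm M0 OmM on dense).
move=> dlt b0; have [lam0 xi0_ge0] := u0small (conj dlt b0).
have [B0 _] := mini 0%N.
by rewrite -B0 xi0; split=> //; exact: nearW.
Qed.
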